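(* Let $a>0$, $\alpha\in(0,2)$, and let $\sigma\colon\mathbb{R}^2\times\mathbb{R}_+\to\mathbb{R}$ be bounded ($|\sigma(x,t)|\le C$ for all $t\ge0$, $x\in\mathbb{R}^2$) and continuous. Let $U(x,t)=\iint_{\mathbb{R}^2}G(x,y,t)\,M(dy)$ with $G(x,y,t)=\frac{1}{2\pi a}\int_0^{t-|x-y|/a}\frac{\sigma(y,\tau)}{\sqrt{a^2(t-\tau)^2-|y-x|^2}}\,d\tau\,\mathbf{1}_{\{|x-y|<at\}}$. For $\theta\in\mathcal D(\mathbb{R}^2\times\mathbb{R}_+)$ consider the identity $$\int_0^{\infty}\iint_{\mathbb{R}^2}U(x,t)\Big(\frac{\partial^2}{\partial t^2}\theta(x,t)-a^2\Delta\theta(x,t)\Big)\,dx\,dt=\int_0^{\infty}\iint_{\mathbb{R}^2}\theta(x,t)\sigma(x,t)\,M(dx)\,dt. \quad ( * )$$ 1. If $\alpha\in(0,1)$, then there is $\Omega_0\in\mathcal F$ with $\mathbb{P}(\Omega_0)=1$ such that, for all $\omega\in\Omega_0$ and all $\theta\in\mathcal D(\mathbb{R}^2\times\mathbb{R}_+)$, the identity $( * )$ holds. 2. If $\alpha\in[1,2)$, then, for any $\theta\in\mathcal D(\mathbb{R}^2\times\mathbb{R}_+)$, the identity $( * )$ holds almost surely.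
   Context: $(\Omega,\mathcal F,\mathbb{P})$ is a complete probability space and $M$ is an independently scattered symmetric $\alpha$-stable random measure on $\mathbb{R}^2$ with Lebesgue control measure, assumed to be given by its LePage series $M(A)=C_\alpha\sum_{k\ge1}\Gamma_k^{-1/\alpha}\varphi(\xi_k)^{-1/\alpha}\mathbf{1}_A(\xi_k)g_k$, where $\varphi$ is a continuous positive probability density on $\mathbb{R}^2$, $\Gamma_k$ are arrival times of a unit-intensity Poisson process, $\xi_k$ are i.i.d. with density $\varphi$, $g_k$ are i.i.d. centered Gaussian with $\mathbb{E}|g_k|^\alpha=1$, these three families are independent, and $C_\alpha=\big(\frac{\Gamma(2-\alpha)\cos(\pi\alpha/2)}{1-\alpha}\big)^{1/\alpha}$. Integrals $\iint f\,dM$ for $f\in L^\alpha(\mathbb{R}^2)$ are given by the corresponding almost surely convergent LePage series $C_\alpha\sum_k\Gamma_k^{-1/\alpha}\varphi(\xi_k)^{-1/\alpha}f(\xi_k)g_k$; in particular the right-hand side of $( * )$ is $C_\alpha\int_0^\infty\sum_k\Gamma_k^{-1/\alpha}\varphi(\xi_k)^{-1/\alpha}\theta(\xi_k,t)\sigma(\xi_k,t)g_k\,dt$. $\mathcal D(\mathbb{R}^2\times\mathbb{R}_+)$ is the class of compactly supported infinitely differentiable functions on $\mathbb{R}^2\times\mathbb{R}_+$, and $\mathbb{R}_+=[0,\infty)$. The identity $( * )$ expresses that $U$ is a generalized solution of $\big(\frac{\partial^2}{\partial t^2}-a^2\Delta\big)U(x,t)=\sigma(x,t)\dot M(x)$ with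 zero initial conditions. *)

(* Defs.v *)
From HB Require Import structures.
From mathcomp Require Import all_boot all_order all_algebra.
From mathcomp Require Import all_classical all_reals all_analysis.
From mathcomp Require Import exponential_distribution normal_distribution.
Set Implicit Arguments. Unset Strict Implicit. Unset Printing Implicit Defensive.
Import Order.TTheory GRing.Theory Num.Def Num.Theory.
Import numFieldNormedType.Exports.
Local Open Scope classical_set_scope.
Local Open Scope ring_scope.

Definition leb2 (R : realType) := (@lebesgue_measure R \x @lebesgue_measure R)%E.

Definition edist (R : realType) (x y : R * R) : R :=
  Num.sqrt ((x.1 - y.1) ^+ 2 + (x.2 - y.2) ^+ 2).

Definition events_of d d' (Om : measurableType d) (T : measurableType d')
  (X : Om -> T) : set (set Om) :=
  fun A => exists2 B, measurable B & A = X @^-1` B.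

Definition mutual_indep d (Om : measurableType d) (R : realType)
  (P : probability Om R) (I : eqType) (F : I -> set (set Om)) : Prop :=
  forall (J : seq I) (A : I -> set Om), uniq J ->
    (forall i, i \in J -> F i (A i)) ->
    P (\bigcap_(i in [set` J]) A i) = (\prod_(i <- J) fine (P (A i)))%:E.

Definition complete_prob d (Om : measurableType d) (R : realType)
  (P : probability Om R) : Prop :=
  forall N, measurable N -> P N = 0%E -> forall A, A `<=` N -> measurable A.

Definition Gammaf (R : realType) (z : R) : R :=
  Rintegral lebesgue_measure `]0, +oo[%classic
    (fun t : R => t `^ (z - 1) * expR (- t)).

(* C_alpha = (Gamma(2-alpha) cos(pi alpha/2) / (1-alpha))^(1/alpha), extended by
   continuity at alpha = 1 (limit value pi/2). *)
Definition C_alpha (R : realType) (alpha : R) : R :=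
  if alpha == 1 then pi / 2
  else (Gammaf (2 - alpha) * cos (pi * alpha / 2) / (1 - alpha)) `^ (alpha^-1).

Definition series_val (R : realType) (u : nat -> R) : R :=
  if asbool (cvgn (series u)) then limn (series u) else 0.

(* LePage series of f : R^2 -> R, i.e. the integral  \iint f dM  (pathwise).
   Gam k, xi k, g k stand for Gamma_{k+1}, xi_{k+1}, g_{k+1}. *)
Definition lepage (R : realType) (Om : Type) (alpha : R) (phi : R * R -> R)
  (Gam : nat -> Om -> R) (xi : nat -> Om -> R * R) (g : nat -> Om -> R)
  (f : R * R -> R) (w : Om) : R :=
  C_alpha alpha * series_val (fun k =>
    Gam k w `^ (- alpha^-1) * phi (xi k w) `^ (- alpha^-1) * f (xi k w) * g k w).

Definition Gfun (R : realType) (a : R) (sigma : R * R -> R -> R)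
  (x y : R * R) (t : R) : R :=
  if edist x y < a * t then
    (2 * pi * a)^-1 *
    Rintegral lebesgue_measure `[0, t - edist x y / a]%classic
      (fun tau : R => sigma y tau /
         Num.sqrt (a ^+ 2 * (t - tau) ^+ 2 - edist y x ^+ 2))
  else 0.

Definition Usol (R : realType) (Om : Type) (alpha a : R) (phi : R * R -> R)
  (Gam : nat -> Om -> R) (xi : nat -> Om -> R * R) (g : nat -> Om -> R)
  (sigma : R * R -> R -> R) (x : R * R) (t : R) (w : Om) : R :=
  lepage alpha phi Gam xi g (fun y => Gfun a sigma x y t) w.

Inductive dir := D1 | D2 | Dt.

Definition slice (R : realType) (d : dir) (f : R * R -> R -> R) (x : R * R) (t : R)
  : R -> R :=
  match d with
  | D1 => fun s => f (s, x.2) t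
  | D2 => fun s => f (x.1, s) t
  | Dt => fun s => f x s
  end.
Definition coord (R : realType) (d : dir) (x : R * R) (t : R) : R :=
  match d with D1 => x.1 | D2 => x.2 | Dt => t end.

Definition pder (R : realType) (d : dir) (f : R * R -> R -> R) : R * R -> R -> R :=
  fun x t => (slice d f x t)^`()%classic (coord d x t).

Definition iter_pder (R : realType) (l : seq dir) (f : R * R -> R -> R) :=
  foldr (@pder R) f l.

Definition smooth (R : realType) (f : R * R -> R -> R) : Prop :=
  forall l : seq dir,
    continuous (fun p : (R * R) * R => iter_pder l f p.1 p.2) /\
    forall d x t, derivable (slice d (iter_pder l f) x t) (coord d x t) 1.

(* D(R^2 x R_+): restrictions to R^2 x [0,oo) of C_c^infinity(R^3) functions
   (equivalently, by Seeley extension, smooth functions on R^2 x [0,oo) with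
   compact support). *)
Definition test_fun (R : realType) (f : R * R -> R -> R) : Prop :=
  smooth f /\
  exists r : R, forall x t, r < `|x.1| + `|x.2| + `|t| -> f x t = 0.

Definition wave_op (R : realType) (a : R) (f : R * R -> R -> R) : R * R -> R -> R :=
  fun x t => pder Dt (pder Dt f) x t
             - a ^+ 2 * (pder D1 (pder D1 f) x t + pder D2 (pder D2 f) x t).

Definition identity_star (R : realType) (Om : Type) (alpha a : R) (phi : R * R -> R)
  (Gam : nat -> Om -> R) (xi : nat -> Om -> R * R) (g : nat -> Om -> R)
  (sigma : R * R -> R -> R) (theta : R * R -> R -> R) (w : Om) : Prop :=
  (\int[lebesgue_measure]_(t in (`[0%R, +oo[%classic : set R))
     \int[@leb2 R]_(x in setT)
        (Usol alpha a phi Gam xi g sigma x t w * wave_op a theta x t)%:E)%E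
  =
  (\int[lebesgue_measure]_(t in (`[0%R, +oo[%classic : set R))
     (lepage alpha phi Gam xi g (fun y => theta y t * sigma y t) w)%:E)%E.

(* Main.v *)
(* A source at y switched on at time tau alone produces the kernel
   1 / (2 pi a sqrt (a^2 (t - tau)^2 - |x - y|^2)).  In the coordinates
   x = y + a (t - tau) (cos c sin b, sin c) the kernel becomes smooth, and its
   product with the wave operator applied to theta is a divergence whose only
   boundary contribution is theta (y, tau).  Integrating over tau against
   sigma (y, tau) gives the identity for each term of the LePage series, so it
   remains to exchange the series with the integrals over space-time.

   For alpha < 1 this holds on the single event where
   sum_k Gamma_k^(-1/alpha) |g_k| is finite, which has probability one since
   E exp (- Gamma_k) = 2^-k forces Gamma_k >= c k.  For alpha >= 1, once
   Gamma_k^(-1/alpha) is truncated at m k^(-1/alpha), the terms are orthogonal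
   in L^2 (P) with second moments O(k^(-2/alpha)), uniformly in (x, t), because
   |G (x, y, t)| <= c |x - y|^(-1/2) is locally square integrable in y.  A
   Rademacher-Menshov inequality on the product of Omega with a space-time box
   then yields convergence together with an integrable bound for the partial
   sums at almost every omega. *)
Require Import Defs.
From HB Require Import structures.
From mathcomp Require Import all_boot all_order all_algebra.
From mathcomp Require Import all_classical all_reals all_analysis.
From mathcomp Require Import exponential_distribution normal_distribution.
From mathcomp Require Import measurable_realfun ring lra zify.
Set Implicit Arguments. Unset Strict Implicit. Unset Printing Implicit Defensive.
Import Order.TTheory GRing.Theory Num.Def Num.Theory.
Import numFieldNormedType.Exports.
Local Open Scope classical_set_scope.
Local Open Scope ring_scope.

(** * Spherical coordinates for the wave operator *)

(** The coordinates come from the method of descent: (cos c sin b, sin c, cos c cos b) runs over a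
    unit hemisphere with area element cos c, and the planar kernel is, up to a factor, the
    projection of the uniform measure on a hemisphere of radius a (t - tau). A function on the plane
    ignores the third coordinate, so the spherical argument in space applies to it and the
    singularity on the light cone disappears.

    Two obstacles shape the probabilistic half. The factor phi (xi_k)^(-1/alpha) is unbounded, but
    finite propagation speed confines the sources that matter for a given theta to a box, where phi
    is bounded below. And both sides of the identity are defined pathwise, with value 0 where a
    series diverges, so L^2 convergence is too weak: dominated convergence asks for one integrable
    majorant of all partial sums at a fixed omega. For alpha < 1 it is a sum of absolute values,
    finite on an event in which theta does not occur. For alpha >= 1 it comes from a maximal
    inequality, whose logarithmic loss is absorbed because 2 / alpha > 1; it is built for a given
    theta, and so is the exceptional event. *)

Lemma MVT_point (R : realType) (f df : R -> R) (x y : R) :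
  (forall z, is_derive z (1 : R) f (df z)) ->
  exists2 c, `|c - x| <= `|y - x| & f y - f x = df c * (y - x).
Proof.
move=> fd.
have cf a b : {within `[a, b], continuous f}.
  apply: continuous_subspaceT => z.
  by apply/differentiable_continuous/derivable1_diffP; case: (fd z).
case: (leP x y) => [xy|/ltW xy].
- have [c /andP[xc cy] ->] := MVT_segment xy (fun z _ => fd z) (cf x y).
  rewrite !bnd_simp in xc cy.
  by exists c => //; rewrite !ger0_norm ?subr_ge0// lerB.
- have [c /andP[xc cy] e] := MVT_segment xy (fun z _ => fd z) (cf y x).
  rewrite !bnd_simp in xc cy.
  exists c; first by rewrite !ler0_norm ?subr_le0// lerN2 lerB.
  by rewrite -opprB e -mulrN opprB.
Qed.

(** One coordinate's share of the chain rule. The mean value theorem turns the quotient into [k'] at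
    an intermediate point times the quotient of [p]; the parameter [s] moves as well, hence the
    joint continuity of [k'] at [(p s0, s0)]. *)
Lemma cvg_slice_quotient (R : realType) (k k' : R -> R -> R) (p : R -> R) (dp s0 : R) :
  (forall u s, is_derive u (1 : R) (k^~ s) (k' u s)) ->
  {for (p s0, s0), continuous (fun q : R * R => k' q.1 q.2)} ->
  is_derive s0 (1 : R) p dp ->
  h^-1 * (k (p (h + s0)) (h + s0) - k (p s0) (h + s0)) @[h --> (0 : R)^'] -->
    k' (p s0) s0 * dp.
Proof.
move=> kd ck [pd pe].
have /choice[c cP] : forall h, exists c, `|c - p s0| <= `|p (h + s0) - p s0| /\
    k (p (h + s0)) (h + s0) - k (p s0) (h + s0) =
    k' c (h + s0) * (p (h + s0) - p s0).
  move=> h; have [c c1 c2] := MVT_point (p s0) (p (h + s0)) (kd^~ (h + s0)).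
  by exists c.
have h0 : (h + s0) @[h --> (0:R)^'] --> s0.
  rewrite -[X in _ --> X](add0r s0).
  apply: cvg_trans (_ : (h + s0) @[h --> (0 : R)] --> 0 + s0).
    by apply: cvg_app; exact: cvg_within.
  by apply: cvgD; [exact: cvg_id|exact: cvg_cst].
have cp : p (h + s0) @[h --> (0:R)^'] --> p s0.
  apply: (cvg_comp _ _ h0).
  by have /derivable1_diffP/differentiable_continuous := pd.
have cc : c h @[h --> (0:R)^'] --> p s0.
  apply/cvgrPdist_lt => e e0.
  move/cvgrPdist_lt : cp => /(_ _ e0); apply: filterS => h.
  by rewrite distrC (distrC _ (c h)); apply: le_lt_trans; have [] := cP h.
have e1 : (k' (c h) (h + s0) @[h --> (0:R)^'] --> k' (p s0) s0).
  apply: (@cvg_comp _ _ _ (fun h : R => (c h, h + s0)) (fun q : R * R => k' q.1 q.2)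
    (0:R)^' (nbhs (p s0, s0)) _ _ ck).
  exact: (cvg_pair (G := nbhs (p s0)) (H := nbhs s0)).
have e2 : h^-1 * (p (h + s0) - p s0) @[h --> (0:R)^'] --> dp.
  have := pd; rewrite /derivable => /cvg_ex[l hl].
  have : 'D_1 p s0 = l by apply: cvg_lim.
  rewrite pe => ->; apply: cvg_trans hl; apply: near_eq_cvg; near=> h.
  by rewrite /= -[h%:A]/(h * 1) mulr1.
rewrite (_ : (fun h => _) = (fun h => k' (c h) (h + s0) * (h^-1 * (p (h + s0) - p s0)))).
  exact: (cvgM e1 e2).
by apply/funext => h; have [_ ->] := cP h; rewrite mulrCA.
Unshelve. all: by end_near. Qed.

(** The mean value theorem is applied in [v] to a difference of two slices, then in [u] to its
    derivative. *)
Lemma mvt2 (R : realType) (k kv kvu : R -> R -> R) (u v h : R) :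
  (forall u v, is_derive v (1 : R) (k u) (kv u v)) ->
  (forall u v, is_derive u (1 : R) (kv^~ v) (kvu u v)) ->
  exists c : R * R, [/\ `|c.1 - u| <= `|h|, `|c.2 - v| <= `|h| &
    k (u + h) (v + h) - k (u + h) v - (k u (v + h) - k u v) = kvu c.1 c.2 * h * h].
Proof.
move=> kd kvd.
have gd z : is_derive z (1 : R) (fun z => k (u + h) z - k u z) (kv (u + h) z - kv u z).
  by apply: is_deriveB.
have [c2 c2v e2] := MVT_point v (v + h) gd.
have [c1 c1u e1] := MVT_point u (u + h) (kvd^~ c2).
exists (c1, c2) => /=; split; first by move: c1u; rewrite addrAC subrr add0r.
  by move: c2v; rewrite addrAC subrr add0r.
move: e2 e1; rewrite [v + h - v]addrAC subrr add0r [u + h - u]addrAC subrr add0r => e2 e1.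
by rewrite -e1 -e2; ring.
Qed.

(** The second difference is symmetric in the two variables, so it equals [h * h] times either mixed
    derivative at a point near [(u, v)]; division by [h * h] and continuity conclude. *)
Lemma schwarz_symmetry (R : realType) (k ku kv kuv kvu : R -> R -> R) (u v : R) :
  (forall u v, is_derive v (1 : R) (k u) (kv u v)) ->
  (forall u v, is_derive u (1 : R) (k^~ v) (ku u v)) ->
  (forall u v, is_derive u (1 : R) (kv^~ v) (kvu u v)) ->
  (forall u v, is_derive v (1 : R) (ku u) (kuv u v)) ->
  {for (u, v), continuous (fun q : R * R => kuv q.1 q.2)} ->
  {for (u, v), continuous (fun q : R * R => kvu q.1 q.2)} ->
  kuv u v = kvu u v.
Proof.
move=> k1 k2 k3 k4 cuv cvu.
have /choice[c cP] h := mvt2 u v h k1 k3.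
have /choice[e eP] h := mvt2 v u h (fun v u => k2 u v) (fun v u => k4 u v).
have ch (b : R -> R) x : (forall h, `|b h - x| <= `|h|) -> b h @[h --> (0:R)^'] --> x.
  move=> bx; apply/cvgrPdist_lt => r r0; near=> h.
  rewrite distrC (le_lt_trans (bx h))//.
  near: h; apply: dnbhs0_lt => //.
have l1 : kvu (c h).1 (c h).2 @[h --> (0:R)^'] --> kvu u v.
  apply: (@cvg_comp _ _ _ (fun h : R => ((c h).1, (c h).2)) (fun q : R * R => kvu q.1 q.2)
    (0:R)^' (nbhs (u, v)) _ _ cvu).
  by apply: (cvg_pair (G := nbhs u) (H := nbhs v)); apply: ch => h; have [] := cP h.
have l2 : kuv (e h).2 (e h).1 @[h --> (0:R)^'] --> kuv u v.
  apply: (@cvg_comp _ _ _ (fun h : R => ((e h).2, (e h).1)) (fun q : R * R => kuv q.1 q.2)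
    (0:R)^' (nbhs (u, v)) _ _ cuv).
  by apply: (cvg_pair (G := nbhs u) (H := nbhs v)); apply: ch => h; have [] := eP h.
apply: (@cvg_unique _ _ _ _ _ _ l2) => //.
apply: cvg_trans l1; apply: near_eq_cvg; near=> h.
have h0 : h != 0 by near: h; exact: nbhs_dnbhs_neq.
have [_ _ c3] := cP h; have [_ _ e3] := eP h.
apply: (mulIf h0); apply: (mulIf h0); rewrite -c3 -e3; ring.
Unshelve. all: by end_near. Qed.


(** * Continuity and differentiation rules *)

Section continuity_rules.
Variables (R : realType) (T : topologicalType).
Implicit Types f g : T -> R.

Lemma ct_cst (c : R) : continuous (fun _ : T => c).
Proof. by move=> x; exact: cvg_cst. Qed.

Lemma ctD f g : continuous f -> continuous g -> continuous (fun x => f x + g x).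
Proof. by move=> cf cg x; apply: cvgD; [exact: cf|exact: cg]. Qed.

Lemma ctN f : continuous f -> continuous (fun x => - f x).
Proof. by move=> cf x; apply: cvgN; exact: cf. Qed.

Lemma ctM f g : continuous f -> continuous g -> continuous (fun x => f x * g x).
Proof. by move=> cf cg x; apply: cvgM; [exact: cf|exact: cg]. Qed.

Lemma ct_comp (h : R -> R) f : continuous h -> continuous f ->
  continuous (fun x => h (f x)).
Proof. by move=> ch cf x; apply: cvg_comp; [exact: cf|exact: ch]. Qed.

Lemma ct_comp2 (h : R * R -> R) f g : continuous h -> continuous f ->
  continuous g -> continuous (fun x => h (f x, g x)).
Proof.
move=> ch cf cg x; apply: (@cvg_comp _ _ _ (fun x => (f x, g x)) h _ (nbhs (f x, g x))).
  by apply: (cvg_pair (G := nbhs (f x)) (H := nbhs (g x))); [exact: cf|exact: cg].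
exact: ch.
Qed.

Lemma ct_comp3 (h : R * R -> R -> R) f1 f2 f3 :
  continuous (fun q : (R * R) * R => h q.1 q.2) ->
  continuous f1 -> continuous f2 -> continuous f3 ->
  continuous (fun x => h (f1 x, f2 x) (f3 x)).
Proof.
move=> ch c1 c2 c3 x.
apply: (@cvg_comp _ _ _ (fun x => ((f1 x, f2 x), f3 x))
  (fun q : (R * R) * R => h q.1 q.2) _ (nbhs ((f1 x, f2 x), f3 x))).
  apply: (cvg_pair (G := nbhs (f1 x, f2 x)) (H := nbhs (f3 x))); last exact: c3.
  by apply: (cvg_pair (G := nbhs (f1 x)) (H := nbhs (f2 x))); [exact: c1|exact: c2].
exact: (ch ((f1 x, f2 x), f3 x)).
Qed.

End continuity_rules.

Lemma ct_fst (R : realType) (T U : topologicalType) (h : T -> R) :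
  continuous h -> continuous (fun q : T * U => h q.1).
Proof. by move=> ch q; apply: (cvg_comp _ _ (@cvg_fst _ _ _ _ _)); exact: ch. Qed.

Lemma ct_snd (R : realType) (T U : topologicalType) (h : U -> R) :
  continuous h -> continuous (fun q : T * U => h q.2).
Proof. by move=> ch q; apply: (cvg_comp _ _ (@cvg_snd _ _ _ _ _)); exact: ch. Qed.

Lemma ct_pairl (R : realType) (T U : topologicalType) (h : T * U -> R) u :
  continuous h -> continuous (fun x => h (x, u)).
Proof.
move=> ch x; apply: (@cvg_comp _ _ _ (fun x => (x, u)) h _ (nbhs (x, u))) (ch (x, u)).
by apply: (cvg_pair (G := nbhs x) (H := nbhs u)); [exact: cvg_id|exact: cvg_cst].
Qed.

Lemma ct_pairr (R : realType) (T U : topologicalType) (h : T * U -> R) u :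
  continuous h -> continuous (fun x => h (u, x)).
Proof.
move=> ch x; apply: (@cvg_comp _ _ _ (fun x => (u, x)) h _ (nbhs (u, x))) (ch (u, x)).
by apply: (cvg_pair (G := nbhs u) (H := nbhs x)); [exact: cvg_cst|exact: cvg_id].
Qed.

Lemma ct_id (R : realType) : continuous (fun x : R => x).
Proof. by move=> x; exact: cvg_id. Qed.

Lemma ctX (R : realType) (T : topologicalType) (f : T -> R) n :
  continuous f -> continuous (fun x => f x ^+ n).
Proof.
move=> cf; elim: n => [|n ih]; first exact: ct_cst.
by rewrite (_ : (fun x => _) = (fun x => f x * f x ^+ n)); [exact: ctM|apply/funext => x; rewrite exprS].
Qed.

Ltac ct := lazymatch goal with
  | |- forall _, continuous_at _ (fun x => @?f x + @?g x) => refine (@ctD _ _ f g _ _); ct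
  | |- forall _, continuous_at _ (fun x => @?f x * @?g x) => refine (@ctM _ _ f g _ _); ct
  | |- forall _, continuous_at _ (fun x => - @?f x) => refine (@ctN _ _ f _); ct
  | |- forall _, continuous_at _ (fun x => @?f x ^+ ?n) => refine (@ctX _ _ f n _); ct
  | |- forall _, continuous_at _ (fun x => cos (@?f x)) =>
      refine (@ct_comp _ _ _ f (@continuous_cos _) _); ct
  | |- forall _, continuous_at _ (fun x => sin (@?f x)) =>
      refine (@ct_comp _ _ _ f (@continuous_sin _) _); ct
  | |- forall _, continuous_at _ (fun x => x) => exact: ct_id
  | |- forall _, continuous_at _ fst => move=> ?; exact: cvg_fst
  | |- forall _, continuous_at _ snd => move=> ?; exact: cvg_snd
  | |- forall _, continuous_at _ (fun x => x.1) => move=> ?; exact: cvg_fst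
  | |- forall _, continuous_at _ (fun x => x.2) => move=> ?; exact: cvg_snd
  | |- forall _, continuous_at _ (fun x => x.1.1) =>
      refine (@ct_fst _ _ _ (fun q => q.1) _); move=> ?; exact: cvg_fst
  | |- forall _, continuous_at _ (fun x => x.1.2) =>
      refine (@ct_fst _ _ _ (fun q => q.2) _); move=> ?; exact: cvg_snd
  | |- forall _, continuous_at _ (fun x => x.2.1) =>
      refine (@ct_snd _ _ _ (fun q => q.1) _); move=> ?; exact: cvg_fst
  | |- forall _, continuous_at _ (fun x => x.2.2) =>
      refine (@ct_snd _ _ _ (fun q => q.2) _); move=> ?; exact: cvg_snd
  | |- forall _, continuous_at _ (fun _ => ?c) => exact: ct_cst
  | _ => try assumption
  end.

(** Only partial derivatives are given, so differentiability along a curve has to come from their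
    continuity: the increment is telescoped by moving one coordinate at a time. *)
Lemma is_derive_curve (R : realType) (f : R * R -> R -> R) (p1 p2 p3 : R -> R) (s d1 d2 d3 : R) :
  (forall d x t, derivable (slice d f x t) (Defs.coord d x t) 1) ->
  (forall d, continuous (fun q : (R * R) * R => pder d f q.1 q.2)) ->
  is_derive s (1 : R) p1 d1 -> is_derive s (1 : R) p2 d2 -> is_derive s (1 : R) p3 d3 ->
  is_derive s (1 : R) (fun s => f (p1 s, p2 s) (p3 s))
    (pder D1 f (p1 s, p2 s) (p3 s) * d1 + pder D2 f (p1 s, p2 s) (p3 s) * d2
     + pder Dt f (p1 s, p2 s) (p3 s) * d3).
Proof.
move=> fd fc pd1 pd2 pd3.
have sd d x t : is_derive (Defs.coord d x t) (1 : R) (slice d f x t) (pder d f x t).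
  by rewrite /pder derive1E; apply/derivableP.
have cp (p : R -> R) (dp : R) : is_derive s (1 : R) p dp -> {for s, continuous p}.
  by case=> /derivable1_diffP/differentiable_continuous.
have c2 := cp _ _ pd2; have c3 := cp _ _ pd3.
have h1 := @cvg_slice_quotient R (fun u s => f (u, p2 s) (p3 s))
  (fun u s => pder D1 f (u, p2 s) (p3 s)) p1 d1 s (fun u s => sd D1 (u, p2 s) (p3 s)).
have h2 := @cvg_slice_quotient R (fun u z => f (p1 s, u) (p3 z))
  (fun u z => pder D2 f (p1 s, u) (p3 z)) p2 d2 s (fun u z => sd D2 (p1 s, u) (p3 z)).
have h3 := @cvg_slice_quotient R (fun u z => f (p1 s, p2 s) u)
  (fun u z => pder Dt f (p1 s, p2 s) u) p3 d3 s (fun u z => sd Dt (p1 s, p2 s) u).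
have ccmp (d : dir) (a b c : R * R -> R) (q : R * R) :
    {for q, continuous a} -> {for q, continuous b} -> {for q, continuous c} ->
    {for q, continuous (fun q => pder d f (a q, b q) (c q))}.
  move=> ca cb cc0.
  apply: (@cvg_comp _ _ _ (fun x => ((a x, b x), c x))
    (fun q : (R * R) * R => pder d f q.1 q.2) _ (nbhs ((a q, b q), c q))).
    apply: (cvg_pair (G := nbhs (a q, b q)) (H := nbhs (c q))) => //.
    exact: (cvg_pair (G := nbhs (a q)) (H := nbhs (b q))).
  exact: (fc d ((a q, b q), c q)).
have k1 : {for (p1 s, s), continuous (fun q : R * R => q.1)} by exact: cvg_fst.
have csnd u (p : R -> R) : {for s, continuous p} -> {for (u, s), continuous (fun q : R * R => p q.2)}.
  move=> c0; apply: (@cvg_comp _ _ _ (fun q : R * R => q.2) p _ (nbhs s)) => //.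
  exact: cvg_snd.
have {}h1 := h1 (ccmp D1 _ _ _ _ k1 (csnd _ _ c2) (csnd _ _ c3)) pd1.
have k2 : {for (p2 s, s), continuous (fun q : R * R => q.1)} by exact: cvg_fst.
have kc (c : R) (q : R * R) : {for q, continuous (fun _ : R * R => c)} by exact: cvg_cst.
have {}h2 := h2 (ccmp D2 _ _ _ _ (kc (p1 s) _) k2 (csnd _ _ c3)) pd2.
have k3 : {for (p3 s, s), continuous (fun q : R * R => q.1)} by exact: cvg_fst.
have {}h3 := h3 (ccmp Dt _ _ _ _ (kc (p1 s) _) (kc (p2 s) _) k3) pd3.
have l : h^-1 *: (f (p1 (h *: 1 + s), p2 (h *: 1 + s)) (p3 (h *: 1 + s)) - f (p1 s, p2 s) (p3 s))
     @[h --> (0:R)^'] --> (pder D1 f (p1 s, p2 s) (p3 s) * d1 + pder D2 f (p1 s, p2 s) (p3 s) * d2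
     + pder Dt f (p1 s, p2 s) (p3 s) * d3).
  rewrite (_ : (fun h => _) = (fun h =>
    h^-1 * (f (p1 (h + s), p2 (h + s)) (p3 (h + s)) - f (p1 s, p2 (h + s)) (p3 (h + s))) +
    h^-1 * (f (p1 s, p2 (h + s)) (p3 (h + s)) - f (p1 s, p2 s) (p3 (h + s))) +
    h^-1 * (f (p1 s, p2 s) (p3 (h + s)) - f (p1 s, p2 s) (p3 s)))).
    exact: (cvgD (cvgD h1 h2) h3).
  by apply/funext => h; rewrite -[h%:A]/(h * 1) mulr1 /GRing.scale /=; ring.
split; first by apply/cvg_ex; eexists; exact: l.
exact: (cvg_lim _ l).
Qed.

Section derivative_rules.
Variables (R : realType) (s : R).
Implicit Types f g : R -> R.

Lemma isdD f g df dg : is_derive s (1 : R) f df -> is_derive s (1 : R) g dg ->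
  is_derive s (1 : R) (fun x => f x + g x) (df + dg).
Proof. by move=> hf hg; exact: is_deriveD. Qed.

Lemma isdN f df : is_derive s (1 : R) f df ->
  is_derive s (1 : R) (fun x => - f x) (- df).
Proof. by move=> hf; exact: is_deriveN. Qed.

Lemma isdM f g df dg : is_derive s (1 : R) f df -> is_derive s (1 : R) g dg ->
  is_derive s (1 : R) (fun x => f x * g x) (f s * dg + g s * df).
Proof. by move=> hf hg; exact: is_deriveM. Qed.

Lemma isd_cst (c : R) : is_derive s (1 : R) (fun _ => c) 0.
Proof. exact: is_derive_cst. Qed.

Lemma isd_id : is_derive s (1 : R) (fun x => x) 1.
Proof. exact: is_derive_id. Qed.

Lemma isd_cos : is_derive s (1 : R) (fun x => cos x) (- sin s).
Proof. exact: is_derive_cos. Qed.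

Lemma isd_sin : is_derive s (1 : R) (fun x => sin x) (cos s).
Proof. exact: is_derive_sin. Qed.

Lemma isd_eq f df df' : is_derive s (1 : R) f df -> df = df' ->
  is_derive s (1 : R) f df'.
Proof. by move=> h <-. Qed.

End derivative_rules.

Ltac isd := repeat first
  [ exact: isd_cst | exact: isd_id | exact: isd_cos | exact: isd_sin | eassumption
  | apply: isdD | apply: isdN | apply: isdM ].

Ltac gen_pd := repeat match goal with |- context [iter_pder ?l ?f ?x ?t] =>
  let h := fresh "h" in set h := iter_pder l f x t; clearbody h end.

(** * Smooth functions and their fluxes on the light cone *)

Section smooth_functions.
Variables (R : realType) (th : R * R -> R -> R).
Hypothesis sth : smooth th.
Local Notation D l := (iter_pder l th).

Lemma smooth_continuous l : continuous (fun q : (R * R) * R => iter_pder l th q.1 q.2).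
Proof. by have [] := sth l. Qed.

Lemma smooth_curve l (p1 p2 p3 : R -> R) (s d1 d2 d3 : R) :
  is_derive s (1 : R) p1 d1 -> is_derive s (1 : R) p2 d2 -> is_derive s (1 : R) p3 d3 ->
  is_derive s (1 : R) (fun s => D l (p1 s, p2 s) (p3 s))
    (D (D1 :: l) (p1 s, p2 s) (p3 s) * d1 + D (D2 :: l) (p1 s, p2 s) (p3 s) * d2
     + D (Dt :: l) (p1 s, p2 s) (p3 s) * d3).
Proof.
apply: is_derive_curve => [d x t|d]; first by have [_] := sth l; apply.
have := @smooth_continuous (d :: l).
exact.
Qed.

Lemma smooth_slice l d x t :
  is_derive (Defs.coord d x t) (1 : R) (slice d (iter_pder l th) x t) (D (d :: l) x t).
Proof.
by rewrite /= /pder derive1E; apply/derivableP; have [_] := sth l; apply.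
Qed.

(** The time derivative of the radial flux below produces [Dt] of [D1] from one term and [D1] of
    [Dt] from another; they cancel once identified. *)
Lemma smooth_comm_t1 x t : D [:: Dt; D1] x t = D [:: D1; Dt] x t.
Proof.
case: x => x1 x2.
apply: (@schwarz_symmetry R (fun u v => th (u, x2) v) (fun u v => D [:: D1] (u, x2) v)
  (fun u v => D [:: Dt] (u, x2) v) (fun u v => D [:: Dt; D1] (u, x2) v)
  (fun u v => D [:: D1; Dt] (u, x2) v)) => [u v|u v|u v|u v||].
- exact: (smooth_slice [::] Dt (u, x2) v).
- exact: (smooth_slice [::] D1 (u, x2) v).
- exact: (smooth_slice [:: Dt] D1 (u, x2) v).
- exact: (smooth_slice [:: D1] Dt (u, x2) v).
- exact: (@ct_comp3 R _ _ _ _ _ (@smooth_continuous [:: Dt; D1]) (@ct_fst _ _ R _ (@ct_id R))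
    (@ct_cst _ _ x2) (@ct_snd _ R _ _ (@ct_id R)) (x1, t)).
- exact: (@ct_comp3 R _ _ _ _ _ (@smooth_continuous [:: D1; Dt]) (@ct_fst _ _ R _ (@ct_id R))
    (@ct_cst _ _ x2) (@ct_snd _ R _ _ (@ct_id R)) (x1, t)).
Qed.

Lemma smooth_comm_t2 x t : D [:: Dt; D2] x t = D [:: D2; Dt] x t.
Proof.
case: x => x1 x2.
apply: (@schwarz_symmetry R (fun u v => th (x1, u) v) (fun u v => D [:: D2] (x1, u) v)
  (fun u v => D [:: Dt] (x1, u) v) (fun u v => D [:: Dt; D2] (x1, u) v)
  (fun u v => D [:: D2; Dt] (x1, u) v)) => [u v|u v|u v|u v||].
- exact: (smooth_slice [::] Dt (x1, u) v).
- exact: (smooth_slice [::] D2 (x1, u) v).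
- exact: (smooth_slice [:: Dt] D2 (x1, u) v).
- exact: (smooth_slice [:: D2] Dt (x1, u) v).
- exact: (@ct_comp3 R _ _ _ _ _ (@smooth_continuous [:: Dt; D2]) (@ct_cst _ _ x1)
    (@ct_fst _ _ R _ (@ct_id R)) (@ct_snd _ R _ _ (@ct_id R)) (x2, t)).
- exact: (@ct_comp3 R _ _ _ _ _ (@smooth_continuous [:: D2; Dt]) (@ct_cst _ _ x1)
    (@ct_fst _ _ R _ (@ct_id R)) (@ct_snd _ R _ _ (@ct_id R)) (x2, t)).
Qed.

Variables (a : R) (y : R * R) (tau : R).

Definition wx (c b t : R) := y.1 + a * (t - tau) * (cos c * sin b).
Definition wy (c t : R) := y.2 + a * (t - tau) * sin c.

(** With s = t - tau as radial variable, this is cos c times (d_t - d_s) applied to s th.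
    Differentiation in t along the cone applies d_t + d_s, which yields the one-dimensional wave
    operator of s th: the radial part of s times the wave operator in space. *)
Definition flux_t (c b t : R) := cos c * ((t - tau) * D [:: Dt] (wx c b t, wy c t) t
  - th (wx c b t, wy c t) t - (t - tau) * a * (cos c * sin b * D [:: D1] (wx c b t, wy c t) t
     + sin c * D [:: D2] (wx c b t, wy c t) t)).
(** [flux_c] is cos c / s times the c-derivative of th on the sphere, and [flux_b] is 1 / (s cos c)
    times its b-derivative: the spherical gradient, written with the factors s and cos c already
    cancelled, so that nothing is singular at s = 0 or at the poles. *)
Definition flux_c (c b t : R) := cos c * a *
  (cos c * D [:: D2] (wx c b t, wy c t) t - sin c * sin b * D [:: D1] (wx c b t, wy c t) t).
Definition flux_b (c b t : R) := a * cos b * D [:: D1] (wx c b t, wy c t) t.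

Definition dflux_t (c b t : R) :=
  let H l := D l (wx c b t, wy c t) t in
  cos c * ((t - tau) * H [:: Dt; Dt]
   - 2 * a * (cos c * sin b * H [:: D1] + sin c * H [:: D2])
   - (t - tau) * a ^+ 2 * (cos c * sin b * (cos c * sin b * H [:: D1; D1] + sin c * H [:: D2; D1])
      + sin c * (cos c * sin b * H [:: D1; D2] + sin c * H [:: D2; D2]))).
Definition dflux_c (c b t : R) :=
  let H l := D l (wx c b t, wy c t) t in
  let s := t - tau in
  - (cos c ^+ 2 - sin c ^+ 2) * a * sin b * H [:: D1] - 2 * a * cos c * sin c * H [:: D2]
  + a ^+ 2 * s * (cos c ^+ 2 * (cos c * H [:: D2; D2] - sin c * sin b * H [:: D1; D2])
     - cos c * sin c * sin b * (cos c * H [:: D2; D1] - sin c * sin b * H [:: D1; D1])).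
Definition dflux_b (c b t : R) :=
  let H l := D l (wx c b t, wy c t) t in
  - a * sin b * H [:: D1] + a ^+ 2 * (t - tau) * cos b ^+ 2 * cos c * H [:: D1; D1].

Lemma is_derive_flux_t c b t : is_derive t (1 : R) (flux_t c b) (dflux_t c b t).
Proof.
have w1 : is_derive t (1 : R) (wx c b) (a * (cos c * sin b)).
  by eapply isd_eq; [rewrite /wx /wy; isd|rewrite /GRing.scale /=; ring].
have w2 : is_derive t (1 : R) (wy c) (a * sin c).
  by eapply isd_eq; [rewrite /wx /wy; isd|rewrite /GRing.scale /=; ring].
have h0 := smooth_curve [::] w1 w2 (isd_id t).
have ht := smooth_curve [:: Dt] w1 w2 (isd_id t).
have h1 := smooth_curve [:: D1] w1 w2 (isd_id t).
have h2 := smooth_curve [:: D2] w1 w2 (isd_id t).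
eapply isd_eq; first by rewrite /flux_t; isd.
rewrite /dflux_t -!smooth_comm_t1 -!smooth_comm_t2; cbn beta zeta; gen_pd; rewrite /GRing.scale /=; ring.
Qed.

Lemma is_derive_flux_c c b t : is_derive c (1 : R) (fun c => flux_c c b t) (dflux_c c b t).
Proof.
have w1 : is_derive c (1 : R) (fun c => wx c b t) (- a * (t - tau) * (sin c * sin b)).
  by eapply isd_eq; [rewrite /wx /wy; isd|rewrite /GRing.scale /=; ring].
have w2 : is_derive c (1 : R) (fun c => wy c t) (a * (t - tau) * cos c).
  by eapply isd_eq; [rewrite /wx /wy; isd|rewrite /GRing.scale /=; ring].
have h1 := smooth_curve [:: D1] w1 w2 (isd_cst c t).
have h2 := smooth_curve [:: D2] w1 w2 (isd_cst c t).
eapply isd_eq; first by rewrite /flux_c; isd.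
rewrite /dflux_c; cbn beta zeta; gen_pd; rewrite /GRing.scale /=; ring.
Qed.

Lemma is_derive_flux_b c b t : is_derive b (1 : R) (fun b => flux_b c b t) (dflux_b c b t).
Proof.
have w1 : is_derive b (1 : R) (fun b => wx c b t) (a * (t - tau) * (cos c * cos b)).
  by eapply isd_eq; [rewrite /wx /wy; isd|rewrite /GRing.scale /=; ring].
have w2 := isd_cst b (wy c t).
have h1 := smooth_curve [:: D1] w1 w2 (isd_cst b t).
eapply isd_eq; first by rewrite /flux_b; isd.
rewrite /dflux_b; cbn beta zeta; gen_pd; rewrite /GRing.scale /=; ring.
Qed.

(* The angular part of the Laplacian on the unit sphere, written in the
   coordinates (c, b), is an exact divergence. *)
Lemma flux_divergence c b t : dflux_t c b t - dflux_c c b t - dflux_b c b t =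
  (t - tau) * cos c * wave_op a th (wx c b t, wy c t) t.
Proof.
have e1 : 1 - cos c ^+ 2 - sin c ^+ 2 = 0 by rewrite -addrA -opprD cos2Dsin2 subrr.
have e2 : cos b ^+ 2 = 1 - sin b ^+ 2 by rewrite -(cos2Dsin2 b) addrK.
rewrite /dflux_t /dflux_c /dflux_b /wave_op /= e2.
move: (pder Dt (pder Dt th) _ _) (pder D1 (pder D1 th) _ _) (pder D2 (pder D2 th) _ _)
  (pder D1 (pder D2 th) _ _) (pder D2 (pder D1 th) _ _) (pder D1 th _ _) (pder D2 th _ _).
move: (cos c) (sin c) (sin b) (t - tau) e1 {e2} => C S B s e1 htt h11 h22 h12 h21 h1 h2.
apply/eqP; rewrite -subr_eq0; apply/eqP.
transitivity ((1 - C ^+ 2 - S ^+ 2) * (a * B * h1 + s * a ^+ 2 * C * (h22 + B ^+ 2 * h11))).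
  by ring.
by rewrite e1 mul0r.
Qed.

Lemma continuous_dflux (T : topologicalType) (c b t : T -> R) :
  continuous c -> continuous b -> continuous t ->
  [/\ continuous (fun q => dflux_t (c q) (b q) (t q)),
     continuous (fun q => dflux_c (c q) (b q) (t q)) &
     continuous (fun q => dflux_b (c q) (b q) (t q))].
Proof.
move=> cc cb ctt.
have cw l : continuous (fun q => D l (wx (c q) (b q) (t q), wy (c q) (t q)) (t q)).
  by apply: (ct_comp3 (@smooth_continuous l)) => //; rewrite /wx /wy; ct.
split; rewrite /dflux_t /dflux_c /dflux_b; cbn beta zeta; ct; exact: cw.
Qed.

End smooth_functions.

(** * Compactness, Caratheodory functions and product measures *)

Lemma compact_bound (R : realType) (T : topologicalType) (A : set T) (F : T -> R) :
  compact A -> continuous F -> exists M, forall x, A x -> `|F x| <= M.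
Proof.
move=> cA cF.
have : compact (F @` A) by apply: continuous_compact => //; exact: continuous_subspaceT.
move=> /compact_bounded[M [Mr MP]]; exists (M + 1) => x Ax.
by apply: (MP (M + 1)); [rewrite ltrDl|exists x].
Qed.

Lemma FTC_global (R : realType) (F f : R -> R) (a b : R) : a <= b ->
  (forall x, is_derive x (1 : R) F (f x)) -> continuous f ->
  (\int[lebesgue_measure]_(x in `[a, b]) (f x)%:E)%E = (F b - F a)%:E.
Proof.
rewrite le_eqVlt => /predU1P[-> _ _|ab dF cf].
  by rewrite set_itv1 integral_set1 subrr.
have cF : continuous F.
  by move=> x; have /derivable1_diffP/differentiable_continuous := (ex_derive (is_derive := dF x)).
rewrite (continuous_FTC2 ab (F := F)) //.
- exact: continuous_subspaceT.
- split=> [x _||]; first exact: ex_derive.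
  + exact/cvg_at_right_filter/cF.
  + exact/cvg_at_left_filter/cF.
- by move=> x _; rewrite derive1E derive_val.
Qed.

(** Rounding the first variable down to the grid of step 1 / (n + 1) gives functions that are
    measurable cell by cell and converge pointwise by continuity in that variable. *)
Lemma measurable_caratheodory (R : realType) d (T : measurableType d) (f : R -> T -> R) :
  (forall t, continuous (f^~ t)) -> (forall x, measurable_fun setT (f x)) ->
  measurable_fun setT (fun p : R * T => f p.1 p.2).
Proof.
move=> cf mf.
pose r n (x : R) : R := (Num.floor (n.+1%:R * x))%:~R / n.+1%:R.
apply: (@measurable_realfun.measurable_fun_cvg _ _ _ _ (fun n p => f (r n p.1) p.2)) => [n|[x t] _] /=.
  move=> _ B mB; rewrite setTI.
  pose S (z : int) : set (R * T) := ((fun x : R => n.+1%:R * x) @^-1` `[z%:~R, (z + 1)%:~R[)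
     `*` (f (z%:~R / n.+1%:R) @^-1` B).
  have mS z : measurable (S z).
    apply: measurableX.
      rewrite -[X in measurable X]setTI; apply: measurable_funM => //.
    by rewrite -[X in measurable X]setTI; exact: mf.
  rewrite (_ : _ @^-1` _ = \bigcup_k (S (Posz k) `|` S (Negz k))).
    by apply: bigcup_measurable => k _; exact: measurableU.
  apply/seteqP; split=> [[x t] /= Bx|[x t] [k _] /= [] [/=]].
  - have h : S (Num.floor (n.+1%:R * x)) (x, t).
      by split => //=; rewrite in_itv /= floor_le floorD1_gt.
    by case: (Num.floor _) h => k hk; exists k => //; [left|right].
  - by rewrite in_itv /r => /floor_def ->.
  - by rewrite in_itv /r => /floor_def ->.
apply: (@cvg_comp _ _ _ (fun n => r n x) (fun u => f u t) \oo (nbhs x) _ _ (cf t x)).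
apply/cvgrPdist_lt => e e0; near=> n.
have n0 : (0 : R) < n.+1%:R by rewrite ltr0n.
have ne : n.+1%:R^-1 < e by near: n; exact: near_infty_natSinv_lt (PosNum e0).
have /andP[h1 h2] := floor_itv (n.+1%:R * x).
rewrite /r; set z := (Num.floor _)%:~R in h1 *.
rewrite ger0_norm ?subr_ge0 ?ler_pdivrMr 1?[x * _]mulrC//.
apply: le_lt_trans ne.
rewrite -(ler_pM2l n0) mulrBr divff ?gt_eqF// [X in _ - X]mulrC divfK ?gt_eqF//.
by move: h2; rewrite intrD -/z; lra.
Unshelve. all: by end_near. Qed.

Section product_measure_sigma_finite.
Context d1 d2 (T1 : measurableType d1) (T2 : measurableType d2) (R : realType).
Variables (m1 : {sigma_finite_measure set T1 -> \bar R})
  (m2 : {sigma_finite_measure set T2 -> \bar R}).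

(* [m1 \x m2] with its structure of sigma-finite measure, which is not
   inferred from the library for iterated products. *)
Definition pmeasure : set (T1 * T2) -> \bar R := (m1 \x m2)%E.

HB.instance Definition _ := Measure.copy pmeasure (m1 \x m2)%E.

Lemma pmeasure_sigma_finite : sigma_finite setT pmeasure.
Proof.
have /sigma_finiteP[F [TF ndF Foo]] := sigma_finiteT m1.
have /sigma_finiteP[G [TG ndG Goo]] := sigma_finiteT m2.
exists (fun n => F n `*` G n).
  rewrite -setXTT TF TG predeqE => -[x y]; split=> [[/= [n _ Fnx] [k _ Gky]]|].
    exists (maxn n k) => //; split; last exact: (subsetPset _ _ (ndG _ _ (leq_maxr _ _))).
    exact: (subsetPset _ _ (ndF _ _ (leq_maxl _ _))).
  by move=> [n _ []/= ? ?]; split; exists n.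
move=> k; have [mF Fy] := Foo k; have [mG Gy] := Goo k.
split; first exact: measurableX.
by rewrite /pmeasure product_measure1E// lte_mul_pinfty// ge0_fin_numE.
Qed.

HB.instance Definition _ := Measure_isSigmaFinite.Build _ _ _ pmeasure
  pmeasure_sigma_finite.

End product_measure_sigma_finite.

Lemma pmeasureE (R : realType) d1 d2 (T1 : measurableType d1) (T2 : measurableType d2)
  (m1 : {sigma_finite_measure set T1 -> \bar R}) (m2 : {sigma_finite_measure set T2 -> \bar R})
  (A : set T1) (B : set T2) : measurable A -> measurable B ->
  (pmeasure m1 m2 (A `*` B) = m1 A * m2 B)%E.
Proof. exact: product_measure1E. Qed.

Lemma fubini_on (R : realType) d1 d2 (T1 : measurableType d1) (T2 : measurableType d2)
  (m1 : {sigma_finite_measure set T1 -> \bar R}) (m2 : {sigma_finite_measure set T2 -> \bar R})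
  (A : set T1) (B : set T2) (f : T1 * T2 -> \bar R) :
  (pmeasure m1 m2).-integrable (A `*` B) f -> measurable A -> measurable B ->
  (\int[(pmeasure m1 m2)]_(z in A `*` B) f z = \int[m1]_(x in A) \int[m2]_(y in B) f (x, y))%E /\
  (\int[(pmeasure m1 m2)]_(z in A `*` B) f z = \int[m2]_(y in B) \int[m1]_(x in A) f (x, y))%E.
Proof.
move=> fi0 mA mB; have mAB := measurableX mA mB.
move: fi0 => /(integrable_mkcond _ mAB) fi.
split; rewrite [in LHS]integral_mkcond [RHS]integral_mkcond.
  rewrite -(integral12_prod_meas1 fi).
  apply: eq_integral => x _; rewrite /fubini_F /patch; case: ifPn => xA.
    by rewrite [RHS]integral_mkcond; apply: eq_integral => y _; rewrite /patch in_setX xA.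
  by apply: integral0_eq => y _; rewrite in_setX (negbTE xA).
rewrite -(integral21_prod_meas1 fi).
apply: eq_integral => x _; rewrite /fubini_G /patch; case: ifPn => xA.
  by rewrite [RHS]integral_mkcond; apply: eq_integral => y _; rewrite /patch in_setX xA andbT.
by apply: integral0_eq => y _; rewrite in_setX (negbTE xA) andbF.
Qed.

Lemma tonelli (R : realType) d1 d2 (T1 : measurableType d1) (T2 : measurableType d2)
  (m1 : {sigma_finite_measure set T1 -> \bar R}) (m2 : {sigma_finite_measure set T2 -> \bar R})
  (f : T1 * T2 -> \bar R) : measurable_fun setT f -> (forall z, 0 <= f z)%E ->
  (\int[pmeasure m1 m2]_z f z = \int[m1]_x \int[m2]_y f (x, y))%E /\
  (\int[pmeasure m1 m2]_z f z = \int[m2]_y \int[m1]_x f (x, y))%E.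
Proof. by move=> mf f0; split; [exact: fubini_tonelli1|exact: fubini_tonelli2]. Qed.

Lemma measurable_fun_integral_snd (R : realType) d1 d2 (T1 : measurableType d1)
  (T2 : measurableType d2) (m2 : {sigma_finite_measure set T2 -> \bar R})
  (B : set T2) (f : T1 * T2 -> \bar R) :
  measurable_fun setT f -> (forall z, 0 <= f z)%E -> measurable B ->
  measurable_fun setT (fun x => \int[m2]_(y in B) f (x, y))%E.
Proof.
move=> mf f0 mB.
rewrite (_ : (fun x => _) = fubini_F m2 (f \_ (setT `*` B))).
  apply: measurable_fun_fubini_tonelli_F; last by move=> z; rewrite /patch; case: ifPn.
  by apply/(measurable_restrictT f (measurableX measurableT mB)); exact: measurable_funTS.
apply/funext => x; rewrite /fubini_F [LHS]integral_mkcond; apply: eq_integral => y _.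
by rewrite /patch in_setX in_setT.
Qed.

(** Lebesgue measure bundled with its sigma-finite structure, so that [pmeasure] can be iterated
    over it. *)
Definition lm1 (R : realType) : {sigma_finite_measure set (measurableTypeR R) -> \bar R} :=
  @lebesgue_measure R.

Definition lm2 (R : realType) :
    {sigma_finite_measure set (measurableTypeR R * measurableTypeR R)%type -> \bar R} :=
  pmeasure (lm1 R) (lm1 R).

Lemma lm1_itv (R : realType) (a b : R) : a <= b -> lm1 R `[a, b]%classic = (b - a)%:E.
Proof.
move=> ab; have -> : lm1 R `[a, b]%classic = @lebesgue_measure R `[a, b]%classic by [].
rewrite lebesgue_measure_itv /= lte_fin; case: ltgtP ab => // -> _.
by rewrite subrr.
Qed.

Lemma lm2E (R : realType) (A B : set R) : measurable A -> measurable B ->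
  (lm2 R (A `*` B) = lm1 R A * lm1 R B)%E.
Proof.
move=> mA mB.
exact: (@pmeasureE _ _ _ (measurableTypeR R) (measurableTypeR R) (lm1 R) (lm1 R) A B mA mB).
Qed.

Lemma measurable_ct2 (R : realType) (f : R * R -> R) :
  continuous f -> measurable_fun setT f.
Proof.
move=> cf; rewrite (_ : f = fun p => f (p.1, p.2)); last by apply/funext => -[].
apply: (@measurable_caratheodory R _ R (fun x y => f (x, y))) => [t|x].
  by apply: ct_comp2 => //; ct.
by apply: continuous_measurable_fun; apply: ct_comp2 => //; ct.
Qed.

Lemma integrable_box (R : realType) (S I J : set R) (F : R -> R -> R -> R) :
  compact S -> compact I -> compact J ->
  continuous (fun q : R * (R * R) => F q.1 q.2.1 q.2.2) ->
  (pmeasure (lm1 R) (lm2 R)).-integrable (S `*` (I `*` J))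
    (fun q : R * (R * R) => (F q.1 q.2.1 q.2.2)%:E).
Proof.
move=> cS cI cJ cF.
have mS := compact_measurable cS; have mI := compact_measurable cI; have mJ := compact_measurable cJ.
apply: (@measurable_bounded_integrable _ _ _ (pmeasure (lm1 R) (lm2 R))
  (fun q => F q.1 q.2.1 q.2.2) (S `*` (I `*` J))).
- by apply: measurableX => //; exact: measurableX.
- have e := @pmeasureE _ _ _ (measurableTypeR R) _ (lm1 R) (lm2 R) S (I `*` J) mS (measurableX mI mJ).
  apply: (eq_ind_r (fun u => (u < +oo)%E) _ e); rewrite lm2E//.
  have fS : (lm1 R S < +oo)%E by exact: (@compact_finite_measure R S).
  have fI : (lm1 R I < +oo)%E by exact: (@compact_finite_measure R I).
  have fJ : (lm1 R J < +oo)%E by exact: (@compact_finite_measure R J).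
  by rewrite lte_mul_pinfty// ?ge0_fin_numE// lte_mul_pinfty// ge0_fin_numE.
- apply: measurable_funTS.
  apply: (@measurable_caratheodory _ _ _ (fun t (q : R * R) => F t q.1 q.2)).
    by move=> [b c]; exact: (@ct_pairl R R (R * R)%type (fun q => F q.1 q.2.1 q.2.2) (b, c) cF).
  by move=> t; exact: (@measurable_ct2 _ _ (@ct_pairr R R (R * R)%type (fun q => F q.1 q.2.1 q.2.2) t cF)).
- have [M hM] := compact_bound (compact_setX cS (compact_setX cI cJ)) cF.
  exists M; split; first exact: num_real.
  by move=> x Mx q Qq; apply: le_trans (hM _ Qq) _; exact: ltW.
Qed.

Lemma integrable_box2 (R : realType) (I J : set R) (F : R * R -> R) :
  compact I -> compact J -> continuous F ->
  (lm2 R).-integrable (I `*` J) (fun q : R * R => (F q)%:E).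
Proof.
move=> cI cJ cF.
have mI := compact_measurable cI; have mJ := compact_measurable cJ.
apply: (@measurable_bounded_integrable _ _ _ (lm2 R) F (I `*` J)).
- exact: measurableX.
- apply: (eq_ind_r (fun u => (u < +oo)%E) _ (@lm2E R I J mI mJ)).
  have fI : (lm1 R I < +oo)%E by exact: (@compact_finite_measure R I).
  have fJ : (lm1 R J < +oo)%E by exact: (@compact_finite_measure R J).
  by rewrite lte_mul_pinfty// ge0_fin_numE.
- by apply: measurable_funTS; exact: measurable_ct2.
- have [M hM] := compact_bound (compact_setX cI cJ) cF.
  exists M; split; first exact: num_real.
  by move=> x Mx q Qq; apply: le_trans (hM _ Qq) _; exact: ltW.
Qed.

(** * Integration of the divergence over the light cone *)

Section angular_integral.
Variables (R : realType) (th : R * R -> R -> R) (a : R) (y : R * R) (tau T : R).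
Hypothesis sth : smooth th.
Hypothesis tauT : tau <= T.
Local Notation I := (`[- (pi / 2), pi / 2]%classic : set R).

Let hp : - (pi / 2) <= pi / 2 :> R.
Proof. by have := pi_gt0 R; lra. Qed.

Let tct (F : R -> R -> R -> R) :
  continuous (fun q : R * (R * R) => F q.2.1 q.2.2 q.1) ->
  (pmeasure (lm1 R) (lm2 R)).-integrable (`[tau, T] `*` (I `*` I))
    (fun q : R * (R * R) => (F q.2.1 q.2.2 q.1)%:E).
Proof.
move=> cF; apply: (@integrable_box _ _ _ _ (fun t c b => F c b t)) => //; exact: segment_compact.
Qed.

Let mI : measurable I. Proof. exact: measurable_itv. Qed.
Let mII : measurable (I `*` I). Proof. exact: measurableX. Qed.
Let mS : measurable (`[tau, T]%classic : set R). Proof. exact: measurable_itv. Qed.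

Let cvars : [/\ continuous (fun q : R * (R * R) => dflux_t th a y tau q.2.1 q.2.2 q.1),
     continuous (fun q : R * (R * R) => dflux_c th a y tau q.2.1 q.2.2 q.1) &
     continuous (fun q : R * (R * R) => dflux_b th a y tau q.2.1 q.2.2 q.1)].
Proof.
have c1 : continuous (fun q : R * (R * R) => q.1) by ct.
have c21 : continuous (fun q : R * (R * R) => q.2.1) by ct.
have c22 : continuous (fun q : R * (R * R) => q.2.2) by ct.
exact: (continuous_dflux sth a y tau c21 c22 c1).
Qed.

(** At t = tau the sphere shrinks to the point y and [flux_t] reduces to - cos c * th y tau; the
    factor 2 pi is the integral of cos c over the square, that is, the area of the hemisphere. *)
Lemma integral_dflux_t : (forall c b, flux_t th a y tau c b T = 0) ->
  (\int[pmeasure (lm1 R) (lm2 R)]_(q in `[tau, T] `*` (I `*` I))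
    (dflux_t th a y tau q.2.1 q.2.2 q.1)%:E = (2 * pi * th y tau)%:E)%E.
Proof.
move=> f0; have [ct1 _ _] := cvars.
have [_ ->] := fubini_on (tct ct1) mS mII.
transitivity (\int[lm2 R]_(q in I `*` I) (cos q.1 * th y tau)%:E)%E.
  apply: eq_integral => -[c b] _ /=.
  have cd : continuous (dflux_t th a y tau c b).
    by have [] := @continuous_dflux R th sth a y tau R (fun=> c) (fun=> b) (fun t => t);
       [ct|ct|ct|].
  have -> := FTC_global tauT (is_derive_flux_t sth a y tau c b) cd.
  rewrite f0 sub0r /flux_t /wx /wy subrr !mulr0 !mul0r !addr0 subr0 sub0r; congr EFin.
  by rewrite mulrN opprK; case: y.
have int2 : (lm2 R).-integrable (I `*` I) (fun q : R * R => (cos q.1 * th y tau)%:E).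
  by apply: (@integrable_box2 _ _ _ (fun q => cos q.1 * th y tau)); [exact: segment_compact|exact: segment_compact|ct].
have [-> _] := fubini_on int2 mI mI.
transitivity (\int[lebesgue_measure]_(c in I) (pi * th y tau * cos c)%:E)%E.
  apply: eq_integral => c _ /=.
  apply: etrans (integral_cst (lm1 R) mI (cos c * th y tau)%:E) _.
  apply: etrans (f_equal (fun u => (cos c * th y tau)%:E * u)%E (lm1_itv hp)) _.
  rewrite -EFinM; congr EFin.
  have -> : pi / 2 - - (pi / 2) = pi :> R by lra.
  by ring.
have -> := @FTC_global R (fun c => pi * th y tau * sin c) (fun c => pi * th y tau * cos c) _ _ hp.
- by rewrite sin_pihalf sinN sin_pihalf; congr EFin; ring.
- by ct.
Qed.

(** [flux_c] carries a factor cos c, which vanishes at the poles c = pi/2 and c = - pi/2. *)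
Lemma integral_dflux_c :
  (\int[pmeasure (lm1 R) (lm2 R)]_(q in `[tau, T] `*` (I `*` I))
    (dflux_c th a y tau q.2.1 q.2.2 q.1)%:E = 0)%E.
Proof.
have [_ ct1 _] := cvars.
have [-> _] := fubini_on (tct ct1) mS mII.
apply: integral0_eq => t _ /=.
have ct2 : continuous (fun q : R * R => dflux_c th a y tau q.1 q.2 t).
  by have [] := @continuous_dflux R th sth a y tau (R * R)%type (fun q => q.1) (fun q => q.2) (fun=> t);
       [ct|ct|ct|].
have int2 := integrable_box2 (@segment_compact R (-(pi/2)) (pi/2)) (@segment_compact R (-(pi/2)) (pi/2)) ct2.
have [_ ->] := fubini_on int2 mI mI.
apply: integral0_eq => b _ /=.
have cd : continuous (fun c => dflux_c th a y tau c b t).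
  by have [] := @continuous_dflux R th sth a y tau R (fun c => c) (fun=> b) (fun=> t);
       [ct|ct|ct|].
have -> := FTC_global hp (fun c => is_derive_flux_c sth a y tau c b t) cd.
by rewrite /flux_c cosN cos_pihalf !mul0r subrr.
Qed.

(** [flux_b] carries a factor cos b, which vanishes on the rim of the hemisphere: nothing flows out
    in the third direction, on which th does not depend. *)
Lemma integral_dflux_b :
  (\int[pmeasure (lm1 R) (lm2 R)]_(q in `[tau, T] `*` (I `*` I))
    (dflux_b th a y tau q.2.1 q.2.2 q.1)%:E = 0)%E.
Proof.
have [_ _ ct1] := cvars.
have [-> _] := fubini_on (tct ct1) mS mII.
apply: integral0_eq => t _ /=.
have ct2 : continuous (fun q : R * R => dflux_b th a y tau q.1 q.2 t).
  by have [] := @continuous_dflux R th sth a y tau (R * R)%type (fun q => q.1) (fun q => q.2) (fun=> t);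
       [ct|ct|ct|].
have int2 := integrable_box2 (@segment_compact R (-(pi/2)) (pi/2)) (@segment_compact R (-(pi/2)) (pi/2)) ct2.
have [-> _] := fubini_on int2 mI mI.
apply: integral0_eq => c _ /=.
have cd : continuous (fun b => dflux_b th a y tau c b t).
  by have [] := @continuous_dflux R th sth a y tau R (fun=> c) (fun b => b) (fun=> t);
       [ct|ct|ct|].
have -> := FTC_global hp (fun b => is_derive_flux_b sth a y tau c b t) cd.
by rewrite /flux_b cosN cos_pihalf !mulr0 !mul0r subrr.
Qed.

Lemma angular_wave_integral : (forall c b, flux_t th a y tau c b T = 0) ->
  (\int[lm1 R]_(t in `[tau, T]) \int[lm2 R]_(q in I `*` I)
    ((t - tau) * cos q.1 * wave_op a th (wx a y tau q.1 q.2 t, wy a y tau q.1 t) t)%:E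
   = (2 * pi * th y tau)%:E)%E.
Proof.
move=> f0; have [ct1 ct2 ct3] := cvars.
have i1 := tct ct1; have i2 := tct ct2; have i3 := tct ct3.
have mQ : measurable (`[tau, T] `*` (I `*` I)) by apply: measurableX.
have ct12 : continuous (fun q : R * (R * R) => dflux_t th a y tau q.2.1 q.2.2 q.1
   - dflux_c th a y tau q.2.1 q.2.2 q.1 - dflux_b th a y tau q.2.1 q.2.2 q.1).
  by ct.
have [h _] := fubini_on (@tct (fun c b t => dflux_t th a y tau c b t - dflux_c th a y tau c b t
   - dflux_b th a y tau c b t) ct12) mS mII.
transitivity (\int[lm1 R]_(x in `[tau, T]) \int[lm2 R]_(y0 in I `*` I)
  (dflux_t th a y tau y0.1 y0.2 x - dflux_c th a y tau y0.1 y0.2 x - dflux_b th a y tau y0.1 y0.2 x)%:E)%E.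
  by apply: eq_integral => t _; apply: eq_integral => q _; rewrite flux_divergence.
rewrite -{}h.
have ct4 : continuous (fun q : R * (R * R) => dflux_t th a y tau q.2.1 q.2.2 q.1
   - dflux_c th a y tau q.2.1 q.2.2 q.1) by ct.
have i4 := @tct (fun c b t => dflux_t th a y tau c b t - dflux_c th a y tau c b t) ct4.
have e1 := @integralB_EFin _ _ R (pmeasure (lm1 R) (lm2 R)) _ _ _ mQ i4 i3.
have e2 := @integralB_EFin _ _ R (pmeasure (lm1 R) (lm2 R)) _ _ _ mQ i1 i2.
apply: etrans e1 _; rewrite [X in (X - _)%E]e2.
by rewrite integral_dflux_t// integral_dflux_c integral_dflux_b !sube0.
Qed.

(** After division by 2 pi the weight is exactly the density of the planar wave kernel in the
    coordinates (c, b). *)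
Lemma angular_wave_mean : (forall c b, flux_t th a y tau c b T = 0) ->
  continuous (fun q : (R * R) * R => wave_op a th q.1 q.2) ->
  (\int[lm1 R]_(t in `[tau, T]) \int[lm2 R]_(q in I `*` I)
    ((t - tau) / (2 * pi) * cos q.1 * wave_op a th (wx a y tau q.1 q.2 t, wy a y tau q.1 t) t)%:E
   = (th y tau)%:E)%E.
Proof.
move=> f0 cw; have E := angular_wave_integral f0.
have cF : continuous (fun q : R * (R * R) =>
    (q.1 - tau) * cos q.2.1 * wave_op a th (wx a y tau q.2.1 q.2.2 q.1, wy a y tau q.2.1 q.1) q.1).
  by ct; apply: (ct_comp3 cw); rewrite /wx /wy; ct.
have iF := @tct (fun c b t => (t - tau) * cos c * wave_op a th (wx a y tau c b t, wy a y tau c t) t) cF.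
have cG : continuous (fun q : R * (R * R) =>
    (q.1 - tau) / (2 * pi) * cos q.2.1 * wave_op a th (wx a y tau q.2.1 q.2.2 q.1, wy a y tau q.2.1 q.1) q.1).
  by ct; apply: (ct_comp3 cw); rewrite /wx /wy; ct.
have iG := @tct (fun c b t => (t - tau) / (2 * pi) * cos c * wave_op a th (wx a y tau c b t, wy a y tau c t) t) cG.
have [h _] := fubini_on iF mS mII.
have [h' _] := fubini_on iG mS mII.
rewrite -h' {h'}; rewrite -h {h} in E.
have mQ : measurable (`[tau, T] `*` (I `*` I)) by apply: measurableX.
have e1 := @integralZl _ _ R (pmeasure (lm1 R) (lm2 R)) _ mQ _ iF (2 * pi)^-1.
have pi0 : pi != 0 :> R by rewrite gt_eqF ?pi_gt0.
transitivity ((2 * pi)^-1%:E * (2 * pi * th y tau)%:E)%E.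
  rewrite -E -e1; apply: eq_integral => q _; rewrite -EFinM; congr EFin.
  by rewrite !mulrA [_ / (2 * pi)]mulrC.
by rewrite -EFinM; congr EFin; move: (pi : R) pi0 => p p0; field.
Qed.

End angular_integral.

(** * The planar wave kernel *)

Lemma substitution_C1 (R : realType) (F F' G : R -> R) (a b : R) : a <= b ->
  (forall x, is_derive x (1 : R) F (F' x)) -> continuous F' ->
  {in `[a, b] &, {homo F : x y / x < y}} ->
  {within `[F a, F b], continuous G} ->
  (\int[lebesgue_measure]_(x in `[F a, F b]) (G x)%:E =
   \int[lebesgue_measure]_(x in `[a, b]) (G (F x) * F' x)%:E)%E.
Proof.
move=> ab dF cF' hF cG.
have F1 : F^`()%classic = F'.
  by apply/funext => x; rewrite derive1E derive_val.
have cF : continuous F.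
  by move=> x; have /derivable1_diffP/differentiable_continuous := (ex_derive (is_derive := dF x)).
rewrite (@integration_by_substitution_increasing _ F G a b) ?F1//.
- by apply/cvg_ex; exists (F' a); exact/cvg_at_right_filter/cF'.
- by apply/cvg_ex; exists (F' b); exact/cvg_at_left_filter/cF'.
- split=> [x _||]; first exact: ex_derive.
  + exact/cvg_at_right_filter/cF.
  + exact/cvg_at_left_filter/cF.
Qed.

Lemma sqr_itv_gt0 (R : realType) (y rho x : R) : y - rho < x < y + rho ->
  0 < rho ^+ 2 - (x - y) ^+ 2.
Proof. by move=> /andP[h1 h2]; rewrite subr_sqr mulr_gt0//; lra. Qed.

Lemma sqr_itv_le0 (R : realType) (y rho x : R) : 0 < rho ->
  ~ y - rho < x < y + rho -> rho ^+ 2 - (x - y) ^+ 2 <= 0.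
Proof.
move=> r0 hx.
have e : rho ^+ 2 - (x - y) ^+ 2 = (rho - (x - y)) * (rho + (x - y)) by ring.
have [h|h] := leP x (y - rho).
  have a1 : 0 <= rho - (x - y) by lra.
  have a2 : rho + (x - y) <= 0 by lra.
  by rewrite e mulr_ge0_le0.
have [h'|h'] := leP (y + rho) x; last by rewrite h h' in hx.
have a1 : rho - (x - y) <= 0 by lra.
have a2 : 0 <= rho + (x - y) by lra.
by rewrite e mulr_le0_ge0.
Qed.

Section arcsine_substitution.
Variables (R : realType) (y rho : R).
Hypothesis rho0 : 0 < rho.

Let F (b : R) := y + rho * sin b.

Let dF x : is_derive x (1 : R) F (rho * cos x).
Proof. by eapply isd_eq; [rewrite /F; isd|rewrite /GRing.scale /=; ring]. Qed.

Let hF : {in `[- (pi / 2), pi / 2] &, {homo F : x y / x < y}}.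
Proof. by move=> b c hb hc bc; rewrite /F ltrD2l ltr_pM2l// ltr_sin. Qed.

Lemma sin_substitution (m : R -> R) : {within `[y - rho, y + rho], continuous m} ->
  (\int[lebesgue_measure]_(x in `[(y - rho)%R, (y + rho)%R]) (m x)%:E =
   \int[lebesgue_measure]_(c in `[(- (pi / 2))%R, (pi / 2)%R]) (m (y + rho * sin c) * (rho * cos c))%:E)%E.
Proof.
move=> cm; have h : - (pi / 2) <= pi / 2 :> R by have := pi_gt0 R; lra.
have E1 : F (- (pi / 2)) = y - rho by rewrite /F sinN sin_pihalf mulrN mulr1.
have E2 : F (pi / 2) = y + rho by rewrite /F sin_pihalf mulr1.
have cc : continuous (fun c => rho * cos c) by ct.
have := @substitution_C1 R F (fun c => rho * cos c) m _ _ h dF cc hF.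
by rewrite E1 E2; apply.
Qed.

(** The integrand of the arcsine substitution is unbounded at both ends, so the open interval is
    exhausted by closed ones; [n.+2] keeps every [bn n] positive. *)
Let bn (n : nat) : R := pi / 2 * (1 - n.+2%:R^-1).

Let bn_ge0 n : 0 < bn n.
Proof.
rewrite /bn mulr_gt0 ?divr_gt0 ?pi_gt0// subr_gt0 invf_lt1 ?ltr0n//.
by rewrite ltr1n.
Qed.

Let bn_lt n : bn n < pi / 2.
Proof.
have p0 : 0 < pi / 2 :> R by rewrite divr_gt0 ?pi_gt0.
by rewrite /bn -[ltRHS]mulr1 ltr_pM2l// ltrBlDr ltrDl invr_gt0.
Qed.

Let bn_homo n m : (n <= m)%N -> bn n <= bn m.
Proof.
have p0 : 0 < pi / 2 :> R by rewrite divr_gt0 ?pi_gt0.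
by move=> nm; rewrite /bn ler_pM2l// lerB// lef_pV2 ?posrE ?ltr0n// ler_nat !ltnS.
Qed.

Let bn_sup b : b < pi / 2 -> exists n, b <= bn n.
Proof.
move=> bp; have p0 : 0 < pi / 2 :> R by rewrite divr_gt0 ?pi_gt0.
have e0 : 0 < (pi / 2 - b) / (pi / 2) by rewrite divr_gt0// subr_gt0.
have [n _ hn] := near_infty_natSinv_lt (PosNum e0).
exists n; have := hn n (leqnn n); rewrite /= => h.
have h2 : n.+2%:R^-1 <= n.+1%:R^-1 :> R by rewrite lef_pV2 ?posrE ?ltr0n// ler_nat.
have h3 : n.+2%:R^-1 * (pi / 2) <= pi / 2 - b.
  by rewrite -ler_pdivlMr// (le_trans h2)// ltW.
by move: h3; rewrite /bn; set q := pi / 2; set v := _.+2%:R^-1 => h3; lra.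
Qed.

Let cover_open : \bigcup_n `[- bn n, bn n]%classic = `]- (pi / 2), pi / 2[%classic :> set R.
Proof.
apply/seteqP; split=> [b [n _]|b] /=; rewrite !in_itv /=.
  by move=> /andP[h1 h2]; have h3 := bn_lt n; apply/andP; split; lra.
move=> /andP[h1 h2].
have [n1 hn1] := bn_sup h2.
have [n2 hn2] : exists n, - b <= bn n by apply: bn_sup; lra.
exists (maxn n1 n2) => //=; rewrite in_itv /=; have k1 := bn_homo (leq_maxl n1 n2).
have k2 := bn_homo (leq_maxr n1 n2); apply/andP; split; lra.
Qed.

Let bn_in n b : b \in `[- bn n, bn n] -> b \in `[- (pi / 2), pi / 2].
Proof. by rewrite !in_itv /= => /andP[h1 h2]; have h3 := bn_lt n; apply/andP; split; lra. Qed.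

Let cover_F : \bigcup_n `[F (- bn n), F (bn n)]%classic = `]y - rho, y + rho[%classic :> set R.
Proof.
have sin_lt n : sin (bn n) < 1.
  rewrite -sin_pihalf ltr_sin ?bn_lt//; rewrite in_itv /=; have := bn_lt n; have := bn_ge0 n;
    have := pi_gt0 R => h1 h2 h3; apply/andP; split; lra.
apply/seteqP; split=> [x [n _]|x] /=; rewrite !in_itv /= /F.
  rewrite sinN; have := sin_lt n => h /andP[h1 h2].
  have : rho * sin (bn n) < rho by rewrite -[ltRHS]mulr1 ltr_pM2l.
  by move=> h4; apply/andP; split; lra.
move=> /andP[h1 h2].
pose u := (x - y) / rho.
have u1 : u < 1 by rewrite /u ltr_pdivrMr//; lra.
have u2 : -1 < u by rewrite /u ltr_pdivlMr//; lra.
have hu : -1 <= u <= 1 by rewrite !ltW.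
have [n _] : (\bigcup_n `[- bn n, bn n]%classic) (asin u).
  by rewrite cover_open /= in_itv /= asin_gtNpi2 ?asin_ltpi2// ?u1 ?u2 ltW.
rewrite /= => hn; exists n => //; rewrite /= in_itv /=.
have hn' := hn; rewrite in_itv /= in hn'; case/andP: hn' => k1 k2.
have sx : x = y + rho * sin (asin u).
  by rewrite asinK ?in_itv//= /u mulrC divfK ?gt_eqF// addrC subrK.
have b0 := bn_ge0 n.
have i1 : - bn n \in `[- (pi/2), pi/2] by apply: (@bn_in n); rewrite in_itv /= lexx /=; lra.
have i2 : bn n \in `[- (pi/2), pi/2] by apply: (@bn_in n); rewrite in_itv /= lexx andbT; lra.
have i3 := bn_in hn.
have ms : {in `[- (pi / 2), pi / 2] &, {mono (@sin R) : x y / x <= y}}.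
  by apply: le_mono_in => c d hc hd cd; rewrite ltr_sin.
apply/andP; split; [rewrite [leRHS]sx|rewrite [leLHS]sx]; by rewrite !lerD2l !ler_pM2l// !ms.
Qed.

(** With x = y + rho sin b the square root is rho cos b and cancels the Jacobian. The substitution
    is made on closed subintervals, where the integrand is continuous, and both sides pass to the
    limit by monotone convergence. Outside the interval the radicand is nonpositive and the quotient
    is 0 by the conventions for [Num.sqrt] and the inverse. *)
Lemma arcsine_substitution (k : R -> R) : continuous k -> (forall x, 0 <= k x) ->
  (\int[lebesgue_measure]_x (k x / Num.sqrt (rho ^+ 2 - (x - y) ^+ 2))%:E =
   \int[lebesgue_measure]_(b in `[(- (pi / 2))%R, (pi / 2)%R]) (k (y + rho * sin b))%:E)%E.
Proof.
move=> ck k0.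
pose G x := k x / Num.sqrt (rho ^+ 2 - (x - y) ^+ 2).
have G0 x : 0 <= G x by rewrite divr_ge0// sqrtr_ge0.
have cin (x : R) := @sqr_itv_gt0 R y rho x.
have cout (x : R) := @sqr_itv_le0 R y rho x rho0.
have cGx (x : R) : y - rho < x < y + rho -> {for x, continuous G}.
  move=> hx; apply: cvgM; first exact: ck.
  apply: cvgV; first by rewrite gt_eqF// sqrtr_gt0 cin.
  apply: (@cvg_comp _ _ _ (fun x => rho ^+ 2 - (x - y) ^+ 2) Num.sqrt _ (nbhs (rho ^+ 2 - (x - y) ^+ 2))).
    by have h : continuous (fun x : R => rho ^+ 2 - (x - y) ^+ 2); [ct|exact: h].
  exact: sqrt_continuous.
have mopen (S : set R) : measurable S -> S `<=` `]y - rho, y + rho[ -> measurable_fun S (EFin \o G).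
  move=> mS SI; apply/measurable_EFinP; apply: (measurable_funS _ SI); first exact: measurable_itv.
  by apply: open_continuous_measurable_fun; [exact: interval_open|move=> x; rewrite inE /= in_itv; exact: cGx].
have sub n : `[F (- bn n), F (bn n)] `<=` `]y - rho, y + rho[.
  by move=> x hx; rewrite -cover_F; exists n.
transitivity (\int[lebesgue_measure]_(x in `](y - rho)%R, (y + rho)%R[) (G x)%:E)%E.
  rewrite [RHS]integral_mkcond; apply: eq_integral => x _; rewrite /patch.
  case: ifPn => //; rewrite notin_setE /= in_itv /= => hx.
  by congr EFin; rewrite ler0_sqrtr ?invr0 ?mulr0// cout.
have e1 : (\int[lebesgue_measure]_(x in `[F (- bn n)%R, F (bn n)]) (G x)%:E @[n --> \oo] -->
    \int[lebesgue_measure]_(x in `](y - rho)%R, (y + rho)%R[) (G x)%:E)%E.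
  rewrite -cover_F; apply: ge0_nondecreasing_set_cvg_integral.
  - move=> n m nm; apply/subsetPset => x /=; rewrite !in_itv /= => /andP[h1 h2].
    have ms : {in `[- (pi / 2), pi / 2] &, {homo F : x y / x <= y}} by exact: ltW_homo_in.
    have b0 := bn_ge0 n; have b1 := bn_ge0 m; have b2 := bn_homo nm; have b3 := bn_lt m; have b4 := bn_lt n.
    apply/andP; split.
      by apply: le_trans h1; apply: ms; rewrite ?in_itv /=; try (apply/andP; split); lra.
    by apply: (le_trans h2); apply: ms; rewrite ?in_itv /=; try (apply/andP; split); lra.
  - by move=> n; exact: measurable_itv.
  - by move=> n; apply: mopen; [exact: measurable_itv|exact: sub].
  - by move=> n x _; rewrite lee_fin.
have e2 : (\int[lebesgue_measure]_(b in `[(- bn n)%R, bn n]) (k (y + rho * sin b))%:E @[n --> \oo] -->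
    \int[lebesgue_measure]_(b in `](- (pi / 2))%R, (pi / 2)%R[) (k (y + rho * sin b))%:E)%E.
  rewrite -cover_open; apply: ge0_nondecreasing_set_cvg_integral.
  - move=> n m nm; apply/subsetPset => x /=; rewrite !in_itv /= => /andP[h1 h2].
    by have := bn_homo nm => h; apply/andP; split; lra.
  - by move=> n; exact: measurable_itv.
  - move=> n; apply/measurable_EFinP; apply: measurable_funTS; apply: continuous_measurable_fun.
    by apply: (@ct_comp _ _ k) => //; ct.
  - by move=> n x _; rewrite lee_fin.
have e12 n : (\int[lebesgue_measure]_(x in `[F (- bn n)%R, F (bn n)]) (G x)%:E =
    \int[lebesgue_measure]_(b in `[(- bn n)%R, bn n]) (k (y + rho * sin b))%:E)%E.
  have b0 := bn_ge0 n.
  have cc : continuous (fun c => rho * cos c) by ct.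
  have hn : - bn n <= bn n by move: b0; set u := bn n => b0; lra.
  have hFn : {in `[- bn n, bn n] &, {homo F : x y / x < y}}.
    by move=> b c hb hc; apply: hF; exact: (@bn_in n).
  have cGn : {within `[F (- bn n), F (bn n)], continuous G}.
    by apply: continuous_in_subspaceT => x; rewrite inE => /sub /=; rewrite in_itv; exact: cGx.
  rewrite (@substitution_C1 R F _ G _ _ hn dF cc hFn cGn).
  apply: eq_integral => b; rewrite inE /= => hb; congr EFin.
  have cb : 0 < cos b.
    apply: cos_gt0_pihalf; move: hb; rewrite in_itv /= => /andP[h1 h2]; have h3 := bn_lt n.
    by apply/andP; split; lra.
  rewrite /G /F (_ : rho ^+ 2 - _ = (rho * cos b) ^+ 2).
    by rewrite sqrtr_sqr ger0_norm ?mulr_ge0 ?ltW// divfK// gt_eqF// mulr_gt0.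
  by rewrite [y + _]addrC addrK !exprMn cos2sin2; ring.
rewrite [RHS]integral_itv_bndoo; last first.
  apply/measurable_EFinP; apply: measurable_funTS; apply: continuous_measurable_fun.
  by apply: (@ct_comp _ _ k) => //; ct.
rewrite (_ : (fun n => _) = (fun n => (\int[lebesgue_measure]_(b in `[(- bn n)%R, bn n])
    (k (y + rho * sin b))%:E)%E)) in e1; last by apply/funext => n; exact: e12.
exact: (cvg_unique _ e1 e2).
Qed.

End arcsine_substitution.

Section measurability_rules.
Context d (T : measurableType d) (R : realType).
Implicit Types f g : T -> R.

Lemma mt_cst (c : R) : measurable_fun setT (fun _ : T => c).
Proof. exact: measurable_cst. Qed.

Lemma mtD f g : measurable_fun setT f -> measurable_fun setT g ->
  measurable_fun setT (fun x => f x + g x).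
Proof. exact: measurable_funD. Qed.

Lemma mtN f : measurable_fun setT f -> measurable_fun setT (fun x => - f x).
Proof. exact: measurable_funN. Qed.

Lemma mtM f g : measurable_fun setT f -> measurable_fun setT g ->
  measurable_fun setT (fun x => f x * g x).
Proof. exact: measurable_funM. Qed.

Lemma mtX f n : measurable_fun setT f -> measurable_fun setT (fun x => f x ^+ n).
Proof. exact: measurable_funX. Qed.

Lemma mt_comp (h : R -> R) f : measurable_fun setT h -> measurable_fun setT f ->
  measurable_fun setT (fun x => h (f x)).
Proof. by move=> mh mf; apply: (measurableT_comp mh mf). Qed.

Lemma mt_norm f : measurable_fun setT f -> measurable_fun setT (fun x => `|f x|).
Proof. by apply: mt_comp; exact: normr_measurable. Qed.

Lemma mt_sqrt f : measurable_fun setT f -> measurable_fun setT (fun x => Num.sqrt (f x)).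
Proof. by apply: mt_comp; apply: continuous_measurable_fun; exact: sqrt_continuous. Qed.

Lemma mtV f : measurable_fun setT f -> measurable_fun setT (fun x => (f x)^-1).
Proof.
move=> mf; rewrite (_ : (fun x => _) = (fun x => f x * (f x ^+ 2) `^ (-1))).
  apply: mtM => //; apply: (@mt_comp (fun u => u `^ (-1))); first exact: measurable_powR.
  exact: mtX.
apply/funext => x; have [->|n0] := eqVneq (f x) 0; first by rewrite invr0 mul0r.
by rewrite powR_inv1 ?sqr_ge0// expr2 invfM mulrA divff// mul1r.
Qed.

End measurability_rules.

Lemma mt_fst (R : realType) d1 d2 (T : measurableType d1) (U : measurableType d2) (h : T -> R) :
  measurable_fun setT h -> measurable_fun setT (fun q : T * U => h q.1).
Proof. by move=> mh; apply: (measurableT_comp mh measurable_fst). Qed.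

Lemma mt_snd (R : realType) d1 d2 (T : measurableType d1) (U : measurableType d2) (h : U -> R) :
  measurable_fun setT h -> measurable_fun setT (fun q : T * U => h q.2).
Proof. by move=> mh; apply: (measurableT_comp mh measurable_snd). Qed.

Lemma mt_id (R : realType) : measurable_fun setT (fun x : measurableTypeR R => (x : R)).
Proof. exact: measurable_id. Qed.

Ltac mt := lazymatch goal with
  | |- measurable_fun _ (fun x => @?f x + @?g x) => refine (@mtD _ _ _ f g _ _); mt
  | |- measurable_fun _ (fun x => @?f x * @?g x) => refine (@mtM _ _ _ f g _ _); mt
  | |- measurable_fun _ (fun x => - @?f x) => refine (@mtN _ _ _ f _); mt
  | |- measurable_fun _ (fun x => @?f x ^+ ?n) => refine (@mtX _ _ _ f n _); mt
  | |- measurable_fun _ (fun x => (@?f x)^-1) => refine (@mtV _ _ _ f _); mt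
  | |- measurable_fun _ (fun x => Num.sqrt (@?f x)) => refine (@mt_sqrt _ _ _ f _); mt
  | |- measurable_fun _ (fun x => `|@?f x|) => refine (@mt_norm _ _ _ f _); mt
  | |- measurable_fun _ (fun x => x) => exact: mt_id
  | |- measurable_fun _ (fun x => x.1) => refine (@mt_fst _ _ _ _ _ (fun x => x) _); exact: mt_id
  | |- measurable_fun _ (fun x => x.2) => refine (@mt_snd _ _ _ _ _ (fun x => x) _); exact: mt_id
  | |- measurable_fun _ (fun x => x.1.1) =>
      refine (@mt_fst _ _ _ _ _ (fun q => q.1) _); refine (@mt_fst _ _ _ _ _ (fun x => x) _); exact: mt_id
  | |- measurable_fun _ (fun x => x.1.2) =>
      refine (@mt_fst _ _ _ _ _ (fun q => q.2) _); refine (@mt_snd _ _ _ _ _ (fun x => x) _); exact: mt_id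
  | |- measurable_fun _ (fun x => x.2.1) =>
      refine (@mt_snd _ _ _ _ _ (fun q => q.1) _); refine (@mt_fst _ _ _ _ _ (fun x => x) _); exact: mt_id
  | |- measurable_fun _ (fun x => x.2.2) =>
      refine (@mt_snd _ _ _ _ _ (fun q => q.2) _); refine (@mt_snd _ _ _ _ _ (fun x => x) _); exact: mt_id
  | |- measurable_fun _ (fun _ => ?c) => exact: mt_cst
  | _ => try assumption
  end.

(** Outside the disc |x - y| < a s the radicand is nonpositive, so the square root, its inverse and
    the kernel are 0 and no indicator is written. The formula is even in s; causality is imposed
    separately. *)
Definition wave_kernel (R : realType) (a : R) (x y : R * R) (s : R) : R :=
  (2 * pi * a)^-1 / Num.sqrt ((a * s) ^+ 2 - (x.2 - y.2) ^+ 2 - (x.1 - y.1) ^+ 2).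

(** The disc is cut into chords of constant second coordinate v: along a chord the arcsine
    substitution introduces b, and then v = y.2 + a s sin c introduces c. *)
Lemma integral_wave_kernel (R : realType) (a s : R) (y : R * R) (h : R * R -> R)
    (I := `[- (pi / 2), pi / 2]%classic : set R) :
  0 < a -> 0 < s -> continuous h -> (forall x, 0 <= h x) ->
  (\int[lm2 R]_x (wave_kernel a x y s * h x)%:E =
   \int[lm2 R]_(q in I `*` I) (s / (2 * pi) * cos q.1 *
      h (y.1 + a * s * (cos q.1 * sin q.2), y.2 + a * s * sin q.1)%R)%:E)%E.
Proof.
move=> a0 s0 ch h0.
have as0 : 0 < a * s by exact: mulr_gt0.
have c0 : 0 <= (2 * pi * a)^-1 by rewrite invr_ge0 mulr_ge0 ?mulr_ge0 ?pi_ge0// ltW.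
have mk : measurable_fun setT (fun x : measurableTypeR R * measurableTypeR R => wave_kernel a x y s * h x).
  by rewrite /wave_kernel; mt; exact: (measurable_ct2 ch).
have k0 x : 0 <= wave_kernel a x y s * h x.
  by rewrite mulr_ge0// mulr_ge0// invr_ge0 sqrtr_ge0.
have mk' : measurable_fun setT (fun x : measurableTypeR R * measurableTypeR R => (wave_kernel a x y s * h x)%:E).
  exact/measurable_EFinP.
have k0' (x : measurableTypeR R * measurableTypeR R) : (0 <= (wave_kernel a x y s * h x)%:E)%E by rewrite lee_fin.
have [_ E] := tonelli (lm1 R) (lm1 R) mk' k0'.
apply: (etrans E) => {E}.
(* [r2 v] is the squared half-length of the chord at height v. *)
pose r2 (v : R) := (a * s) ^+ 2 - (v - y.2) ^+ 2.
pose H v b := (2 * pi * a)^-1 * h (y.1 + Num.sqrt (r2 v) * sin b, v).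
have H0 v b : 0 <= H v b by rewrite mulr_ge0.
have cr2 : continuous r2 by rewrite /r2; ct.
have cH : continuous (fun q : R * R => H q.1 q.2).
  rewrite /H; ct.
  apply: ct_comp2 => //; ct.
  apply: (@ct_comp _ _ Num.sqrt (fun q : R * R => r2 q.1)); first exact: sqrt_continuous.
  by rewrite /r2; ct.
pose J := `[y.2 - a * s, y.2 + a * s]%classic : set R.
have mI : measurable I by exact: measurable_itv.
have mJ : measurable J by exact: measurable_itv.
have intH : (lm2 R).-integrable (J `*` I) (fun q : R * R => (H q.1 q.2)%:E).
  apply: (@integrable_box2 _ _ _ (fun q => H q.1 q.2)) => //; apply: segment_compact.
have mH : measurable_fun setT (fun v : measurableTypeR R => \int[lm1 R]_(b in I) (H v b)%:E)%E.
  apply: (@measurable_fun_integral_snd _ _ _ (measurableTypeR R) _ (lm1 R) I (fun q => (H q.1 q.2)%:E)) => //.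
    by apply/measurable_EFinP; exact: measurable_ct2.
  by move=> z; rewrite lee_fin.
transitivity (\int[lm1 R]_(v in J) \int[lm1 R]_(b in I) (H v b)%:E)%E.
  (* Passing to the open interval makes the half-length of every chord positive, as the arcsine
     substitution requires. *)
  have -> := @integral_itv_bndoo R (y.2 - a * s) (y.2 + a * s)
    (fun v => \int[lm1 R]_(b in I) (H v b)%:E)%E true false (measurable_funTS mH).
  rewrite [RHS]integral_mkcond; apply: eq_integral => v _; rewrite /patch.
  case: ifPn; rewrite ?inE ?notin_setE /= in_itv /= => hv.
    have r2v : 0 < r2 v := sqr_itv_gt0 hv.
    have cu : continuous (fun u => (2 * pi * a)^-1 * h (u, v)).
      by ct; apply: ct_comp2 => //; ct.
    have hu u : 0 <= (2 * pi * a)^-1 * h (u, v) by rewrite mulr_ge0.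
    have sr0 : 0 < Num.sqrt (r2 v) by rewrite sqrtr_gt0.
    rewrite -(@arcsine_substitution R y.1 (Num.sqrt (r2 v)) sr0 (fun u => (2 * pi * a)^-1 * h (u, v)) cu hu).
    apply: eq_integral => u _; rewrite sqr_sqrtr ?ltW// /wave_kernel /=; congr EFin.
    by rewrite /r2; ring.
  apply: integral0_eq => u _; rewrite /wave_kernel /= -/(r2 v).
  have r2v : r2 v <= 0 := sqr_itv_le0 as0 hv.
  by rewrite ler0_sqrtr ?invr0 ?mulr0 ?mul0r// subr_le0 (le_trans r2v)// sqr_ge0.
have [E1 E2] := fubini_on intH mJ mI.
apply: (etrans (esym E1)); apply: (etrans E2) => {E1 E2}.
have cF : continuous (fun q : R * R => s / (2 * pi) * cos q.1 *
      h (y.1 + a * s * (cos q.1 * sin q.2), y.2 + a * s * sin q.1)).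
  by ct; apply: ct_comp2 => //; ct.
have sI := @segment_compact R (- (pi / 2)) (pi / 2).
have intF := integrable_box2 sI sI cF.
have [_ ->] := fubini_on intF mI mI.
apply: eq_integral => b _ /=.
have cHb : {within J, continuous (fun v => H v b)}.
  by apply: continuous_subspaceT; exact: (@ct_pairl R R R (fun q => H q.1 q.2) b cH).
have -> := @sin_substitution R y.2 (a * s) as0 (fun v => H v b) cHb.
apply: eq_integral => c; rewrite inE /= in_itv /= => hc; congr EFin.
rewrite /H (_ : r2 _ = (a * s * cos c) ^+ 2); last first.
  by rewrite /r2 [y.2 + _]addrC addrK !exprMn cos2sin2; ring.
rewrite sqrtr_sqr ger0_norm; last by rewrite mulr_ge0 ?cos_ge0_pihalf// ltW.
have -> : a * s * cos c * sin b = a * s * (cos c * sin b) by rewrite mulrA.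
have pi0 : pi != 0 :> R by rewrite gt_eqF ?pi_gt0.
have an0 : a != 0 by rewrite gt_eqF.
set w := h _; move: (cos c : R) w (pi : R) pi0 => u w p p0; field; exact/andP.
Qed.

Lemma wave_kernel_ge0 (R : realType) (a s : R) (x y : R * R) : 0 < a ->
  0 <= wave_kernel a x y s.
Proof.
by move=> a0; rewrite divr_ge0 ?sqrtr_ge0// invr_ge0 !mulr_ge0 ?pi_ge0// ltW.
Qed.

Lemma wave_kernel0 (R : realType) (a : R) (x y : R * R) : wave_kernel a x y 0 = 0.
Proof.
rewrite /wave_kernel mulr0 expr0n /= ler0_sqrtr ?invr0 ?mulr0//.
by rewrite sub0r subr_le0 (@le_trans _ _ 0) ?sqr_ge0// oppr_le0 sqr_ge0.
Qed.

Lemma measurable_wave_kernel (R : realType) d (T : measurableType d) (a : R)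
    (x1 x2 y1 y2 s : T -> R) :
  measurable_fun setT x1 -> measurable_fun setT x2 -> measurable_fun setT y1 ->
  measurable_fun setT y2 -> measurable_fun setT s ->
  measurable_fun setT (fun w => wave_kernel a (x1 w, x2 w) (y1 w, y2 w) (s w)).
Proof. by move=> m1 m2 m3 m4 m5; rewrite /wave_kernel /=; mt. Qed.

Lemma wave_kernel_mass (R : realType) (a s : R) (y : R * R) : 0 < a -> 0 <= s ->
  (\int[lm2 R]_x (wave_kernel a x y s)%:E = s%:E)%E.
Proof.
move=> a0; rewrite le_eqVlt => /predU1P[<-|s0].
  by apply: integral0_eq => x _; rewrite wave_kernel0.
transitivity (\int[lm2 R]_x (wave_kernel a x y s * cst 1 x)%:E)%E.
  by apply: eq_integral => x _; rewrite mulr1.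
have c1 : continuous (cst 1 : R * R -> R) by exact: ct_cst.
rewrite (integral_wave_kernel y a0 s0 c1) //.
have hp : - (pi / 2) <= pi / 2 :> R by have := pi_gt0 R; lra.
have sI := @segment_compact R (- (pi / 2)) (pi / 2).
have mI : measurable (`[- (pi / 2), pi / 2]%classic : set R) by exact: measurable_itv.
have cF : continuous (fun q : R * R => s / (2 * pi) * cos q.1 * 1) by ct.
have intF := integrable_box2 sI sI cF.
have [-> _] := fubini_on intF mI mI.
transitivity (\int[lebesgue_measure]_(c in `[(- (pi / 2))%R, (pi / 2)%R]) (s / 2 * cos c)%:E)%E.
  apply: eq_integral => c _ /=.
  apply: etrans (integral_cst (lm1 R) mI (s / (2 * pi) * cos c * 1)%:E) _.
  apply: etrans (f_equal (fun u => (s / (2 * pi) * cos c * 1)%:E * u)%E (lm1_itv hp)) _.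
  rewrite -EFinM; congr EFin.
  have pi0 : pi != 0 :> R by rewrite gt_eqF ?pi_gt0.
  by move: (cos c : R) (pi : R) pi0 => u p p0; field.
have cc : continuous (fun c : R => s / 2 * cos c) by ct.
have dF c : is_derive c (1 : R) (fun c => s / 2 * sin c) (s / 2 * cos c).
  by eapply isd_eq; [isd|rewrite /GRing.scale /=; ring].
by rewrite (FTC_global hp dF cc) sin_pihalf sinN sin_pihalf; congr EFin; field.
Qed.

Lemma integrable_wave_kernel (R : realType) (a s : R) (y : R * R) (h : R * R -> R) (M : R) :
  0 < a -> 0 <= s -> measurable_fun setT h -> (forall x, `|h x| <= M) ->
  (lm2 R).-integrable setT (fun x => (wave_kernel a x y s * h x)%:E).
Proof.
move=> a0 s0 mh hM.
have mK : measurable_fun setT (fun x : measurableTypeR R * measurableTypeR R => wave_kernel a x y s).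
  by rewrite /wave_kernel; mt.
have M0 : 0 <= M := le_trans (normr_ge0 _) (hM (0, 0)).
apply/integrableP; split; first by apply/measurable_EFinP; mt.
apply: (@le_lt_trans _ _ (\int[lm2 R]_x (M%:E * (wave_kernel a x y s)%:E))%E).
  apply: ge0_le_integral => //.
  - by apply/measurable_EFinP; mt.
  - by apply/measurable_EFinP; mt.
  - move=> x _; rewrite -EFinM /= lee_fin normrM mulrC ler_pM// ger0_norm// wave_kernel_ge0//.
rewrite ge0_integralZl//; last by move=> x _; rewrite lee_fin wave_kernel_ge0.
  by rewrite wave_kernel_mass// -EFinM ltry.
by apply/measurable_EFinP.
Qed.

(** The nonnegative case is applied to [h + M] and to the constant [M]; the contribution of [M] is
    finite and can be subtracted. *)
Lemma integral_wave_kernel_bounded (R : realType) (a s : R) (y : R * R) (h : R * R -> R) (M : R)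
    (I := `[- (pi / 2), pi / 2]%classic : set R) :
  0 < a -> 0 <= s -> continuous h -> (forall x, `|h x| <= M) ->
  (\int[lm2 R]_x (wave_kernel a x y s * h x)%:E =
   \int[lm2 R]_(q in I `*` I) (s / (2 * pi) * cos q.1 *
      h (y.1 + a * s * (cos q.1 * sin q.2), y.2 + a * s * sin q.1)%R)%:E)%E.
Proof.
move=> a0; rewrite le_eqVlt => /predU1P[<- _ _|s0 ch hM].
  rewrite integral0_eq; last by move=> x _; rewrite wave_kernel0 mul0r.
  by rewrite integral0_eq// => q _; rewrite !mul0r.
have hM' : forall x : R * R, `|cst M x| <= M.
  by move=> x; rewrite ger0_norm// (le_trans _ (hM x)).
have mh := measurable_ct2 ch.
have i1 := integrable_wave_kernel y a0 (ltW s0) mh hM.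
have i2 := integrable_wave_kernel y a0 (ltW s0) (@mt_cst _ _ R M) hM'.
have cM : continuous (fun x => h x + M) by ct.
have cM' : continuous (cst M : R * R -> R) by exact: ct_cst.
have e1 := @integral_wave_kernel R a s y (fun x => h x + M) a0 s0 cM.
have e2 := @integral_wave_kernel R a s y (cst M) a0 s0 cM'.
have sI := @segment_compact R (- (pi / 2)) (pi / 2).
have cF (k : R * R -> R) : continuous k -> continuous (fun q : R * R => s / (2 * pi) * cos q.1 *
      k (y.1 + a * s * (cos q.1 * sin q.2), y.2 + a * s * sin q.1)).
  by move=> ck; ct; apply: ct_comp2 => //; ct.
have j1 := integrable_box2 sI sI (cF _ ch).
have j2 := integrable_box2 sI sI (cF _ cM').
have mI : measurable (I `*` I) by apply: measurableX; exact: measurable_itv.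
have l1 := @integralD_EFin _ _ R (lm2 R) _ measurableT _ _ i1 i2.
have r1 := @integralD_EFin _ _ R (lm2 R) _ mI _ _ j1 j2.
have E : (\int[lm2 R]_x (wave_kernel a x y s * h x)%:E + \int[lm2 R]_x (wave_kernel a x y s * cst M x)%:E =
  \int[lm2 R]_(q in I `*` I) (s / (2 * pi) * cos q.1 *
      h (y.1 + a * s * (cos q.1 * sin q.2), y.2 + a * s * sin q.1)%R)%:E +
  \int[lm2 R]_(q in I `*` I) (s / (2 * pi) * cos q.1 * M)%:E)%E.
  rewrite -[LHS]l1 -[RHS]r1.
  transitivity (\int[lm2 R]_x (wave_kernel a x y s * (h x + M))%:E)%E.
    by apply: eq_integral => x _; rewrite -EFinD mulrDr.
  rewrite e1; last by move=> x; have := hM x; rewrite ler_norml => /andP[+ _]; rewrite -subr_ge0 opprK.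
  by apply: eq_integral => q _; rewrite -EFinD mulrDr.
have M0 : 0 <= M := le_trans (normr_ge0 _) (hM (0, 0)).
rewrite [X in (_ + X)%E]e2 in E; last by move=> x.
have fin : (\int[lm2 R]_(q in I `*` I) (s / (2 * pi) * cos q.1 * M)%:E)%E \is a fin_num.
  exact: (integrable_fin_num _ j2).
by rewrite -(addeK (\int[lm2 R]_x _)%E fin) E addeK.

Qed.

Lemma mt_le (R : realType) d (T : measurableType d) (f g : T -> R) :
  measurable_fun setT f -> measurable_fun setT g ->
  measurable_fun setT (fun x => (f x <= g x)%R%:R : R).
Proof.
move=> mf mg; apply: (@measurableT_comp _ _ _ _ _ _ (fun b : bool => b%:R : R)) => //.
exact: measurable_fun_ler.
Qed.

(** * Supports and bounds of test functions *)

Section test_functions.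
Variables (R : realType) (th : R * R -> R -> R) (r : R).
Hypothesis sth : smooth th.
Hypothesis th0 : forall x t, r < `|x.1| + `|x.2| + `|t| -> th x t = 0.

(** The region is open, so each coordinate slice of the inner derivative vanishes near the point,
    and so does its derivative there. *)
Lemma iter_pder_vanish l x t : r < `|x.1| + `|x.2| + `|t| -> iter_pder l th x t = 0.
Proof.
elim: l x t => [|d l ih] x t hr; first exact: th0.
rewrite /= /pder derive1E.
pose N (s : R) : R := match d with D1 => `|s| + `|x.2| + `|t| | D2 => `|x.1| + `|s| + `|t|
  | Dt => `|x.1| + `|x.2| + `|s| end.
have cn : continuous (fun s : R => `|s|) by move=> s; exact: norm_continuous.
have cN : continuous N by rewrite /N; case: d {N} hr => hr; ct; exact: cn.
have Nc : r < N (Defs.coord d x t) by rewrite /N; case: d {N cN}.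
have e : {near Defs.coord d x t, slice d (iter_pder l th) x t =1 cst 0}.
  near=> s; have : r < N s by near: s; have := cN (Defs.coord d x t);
    move/cvgrPdist_lt => /(_ _ (eq_ind_r (fun u => is_true u) Nc (subr_gt0 _ _)));
    apply: filterS => s; rewrite ltr_norml => /andP[_]; lra.
  by rewrite /N /cst; clear -ih; case: d => hs /=; apply: ih.
by rewrite (near_eq_derive _ e) ?derive_cst// oner_neq0.
Unshelve. all: by end_near. Qed.

Lemma wave_op_vanish a x t : r < `|x.1| + `|x.2| + `|t| -> wave_op a th x t = 0.
Proof.
move=> h; have v l := iter_pder_vanish l h.
have e1 : pder Dt (pder Dt th) x t = 0 := v [:: Dt; Dt].
have e2 : pder D1 (pder D1 th) x t = 0 := v [:: D1; D1].
have e3 : pder D2 (pder D2 th) x t = 0 := v [:: D2; D2].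
by rewrite /wave_op e1 e2 e3 addr0 mulr0 subr0.
Qed.

Lemma wave_op_continuous a : continuous (fun q : (R * R) * R => wave_op a th q.1 q.2).
Proof.
rewrite /wave_op; apply: ctD; first exact: (smooth_continuous sth (l := [:: Dt; Dt])).
apply: ctN; apply: ctM; first exact: ct_cst.
apply: ctD; first exact: (smooth_continuous sth (l := [:: D1; D1])).
exact: (smooth_continuous sth (l := [:: D2; D2])).
Qed.

Lemma vanish_bound (f : R * R -> R -> R) :
  continuous (fun q : (R * R) * R => f q.1 q.2) ->
  (forall x t, r < `|x.1| + `|x.2| + `|t| -> f x t = 0) ->
  exists2 M : R, 0 <= M & forall x t, `|f x t| <= M.
Proof.
move=> cf f0; have sc := @segment_compact R (- r) r.
have [M hM] := compact_bound (compact_setX (compact_setX sc sc) sc) cf.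
exists `|M| => // -[x1 x2] t.
have [h|h] := ltP r (`|x1| + `|x2| + `|t|); first by rewrite f0 ?normr0.
apply: le_trans (ler_norm M); apply: (hM ((x1, x2), t)).
have h1 := normr_ge0 x1; have h2 := normr_ge0 x2; have h3 := normr_ge0 t.
by split => /=; [split|]; rewrite /= in_itv /= -ler_norml; lra.
Qed.

End test_functions.


Lemma integral_vanish (R : realType) d (T : measurableType d) (mu : {measure set T -> \bar R})
    (D : set T) (f : T -> \bar R) : (forall x, ~ D x -> f x = 0)%E ->
  (\int[mu]_(x in D) f x = \int[mu]_x f x)%E.
Proof.
move=> f0; rewrite integral_mkcond; apply: eq_integral => x _.
by rewrite /patch; case: ifPn => //; rewrite notin_setE => /f0.
Qed.

(** * The kernel of a source switched on at time tau *)

Section retarded_kernel.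
Variables (R : realType) (a rho : R).
Hypotheses (a0 : 0 < a) (rho0 : 0 <= rho).
Local Notation TR := (measurableTypeR R).

(* [z = (t, x)]: time comes first. *)
Definition retarded (y : R * R) (z : R * (R * R)) (tau : R) : R :=
  (0 <= tau)%R%:R * (tau <= z.1)%R%:R * (z.1 <= rho)%R%:R * wave_kernel a z.2 y (z.1 - tau).

Lemma measurable_retarded d (T : measurableType d) (y1 y2 t x1 x2 tau : T -> R) :
  measurable_fun setT y1 -> measurable_fun setT y2 -> measurable_fun setT t ->
  measurable_fun setT x1 -> measurable_fun setT x2 -> measurable_fun setT tau ->
  measurable_fun setT (fun w => retarded (y1 w, y2 w) (t w, (x1 w, x2 w)) (tau w)).
Proof.
move=> m1 m2 m3 m4 m5 m6; rewrite /retarded /=; mt; try by apply: mt_le; mt.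
by apply: measurable_wave_kernel => //; mt.
Qed.

Lemma retarded_ge0 y z tau : 0 <= retarded y z tau.
Proof. by rewrite /retarded mulr_ge0 ?wave_kernel_ge0. Qed.

Lemma retarded_le y z tau :
  retarded y z tau = (0 <= tau <= z.1)%R%:R * (z.1 <= rho)%R%:R * wave_kernel a z.2 y (z.1 - tau).
Proof. by rewrite /retarded; do 3 case: (_ <= _)%R; rewrite ?mulr1 ?mulr0 ?mul0r ?mul1r. Qed.

Let mrz y (tau : R) : measurable_fun setT (fun z : TR * (TR * TR) => (retarded y z tau)%:E).
Proof.
apply/measurable_EFinP.
by apply: (@measurable_retarded _ _ (fun=> y.1) (fun=> y.2) (fun z : TR * (TR * TR) => z.1)
  (fun z => z.2.1) (fun z => z.2.2) (fun=> tau)); mt.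
Qed.

(** At time t the kernel has mass t - tau, at most rho, and t ranges over an interval of length at
    most rho. *)
Lemma retarded_mass y (tau : R) :
  (\int[pmeasure (lm1 R) (lm2 R)]_z (retarded y z tau)%:E
   <= (cst (rho * rho)%:E \_ `[0%R, rho]%classic) tau)%E.
Proof.
rewrite /patch; case: ifPn; rewrite ?inE ?notin_setE /= in_itv /= => tau0; last first.
  rewrite integral0_eq// => z _; rewrite retarded_le.
  case: (boolP (0 <= tau <= z.1)) => [|_]; last by rewrite !mul0r.
  case: (boolP (z.1 <= rho)) => [h1 /andP[h2 h3]|_]; last by rewrite mulr0 mul0r.
  by exfalso; apply: tau0; rewrite h2 (le_trans h3).
have /andP[t0 _] := tau0.
have [-> _] := @tonelli _ _ _ TR _ (lm1 R) (lm2 R)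
  (fun z => (retarded y z tau)%:E) (mrz y tau) (fun z => retarded_ge0 y z tau).
have mI : measurable (`[0, rho]%classic : set TR) by exact: measurable_itv.
have m1 := @measurable_fun_integral_snd R _ _ TR (TR * TR)%type (lm2 R) setT
  (fun z => (retarded y z tau)%:E) (mrz y tau) (fun z => retarded_ge0 y z tau) measurableT.
apply: (@le_trans _ _ (\int[lm1 R]_(t in `[0%R, rho]) rho%:E)%E); last first.
  rewrite (_ : (\int[lm1 R]_(t in _) _)%E = (rho%:E * lm1 R `[0%R, rho]%classic)%E); last exact: integral_cst.
  have e := lm1_itv rho0; apply: (eq_ind_r (fun u => (rho%:E * u <= _)%E) _ e).
  by rewrite -EFinM subr0.
rewrite [leRHS]integral_mkcond.
apply: ge0_le_integral => //.
- by move=> t _; apply: integral_ge0 => x _; rewrite lee_fin retarded_ge0.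
- apply/(measurable_restrictT _ mI); exact: measurable_cst.
move=> t _.
have h : (\int[lm2 R]_x (retarded y (t, x) tau)%:E =
    if (tau <= t <= rho)%R then (t - tau)%:E else 0)%E.
  case: ifPn => [/andP[h1 h2]|h].
    rewrite -(wave_kernel_mass y a0 (s := t - tau)) ?subr_ge0//.
    by apply: eq_integral => x _; rewrite /retarded /= t0 h1 h2 !mul1r.
  apply: integral0_eq => x _; rewrite /retarded /= t0 mul1r -natrM mulnb.
  by rewrite (negbTE h) mul0r.
rewrite [leLHS]h /patch; case: ifPn => [/andP[h1 h2]|_]; last by case: ifP; rewrite ?lee_fin.
by rewrite mem_set ?lee_fin /= ?in_itv/= ?h2 ?andbT; lra.
Qed.

End retarded_kernel.

(** * Response to a single source *)

Lemma measurable_ct3 (R : realType) d (T : measurableType d) (h : R * R -> R -> R)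
    (x : T -> measurableTypeR R * measurableTypeR R) (t : T -> measurableTypeR R) :
  continuous (fun q : (R * R) * R => h q.1 q.2) ->
  measurable_fun setT x -> measurable_fun setT t ->
  measurable_fun setT (fun w => h (x w) (t w)).
Proof.
move=> ch mx mt.
have mh : measurable_fun setT
    (fun z : measurableTypeR R * (measurableTypeR R * measurableTypeR R) => h z.2 z.1).
  apply: (@measurable_caratheodory R _ _ (fun t x => h x t)) => [u|s].
    exact: (@ct_pairr R _ _ (fun q : (R * R) * R => h q.1 q.2) u ch).
  apply: measurable_ct2.
  exact: (@ct_pairl R _ _ (fun q : (R * R) * R => h q.1 q.2) s ch).
exact: (measurableT_comp mh (measurable_fun_pair mt mx)).
Qed.

Section single_source.
Variables (R : realType) (th : R * R -> R -> R) (r a rho : R).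
Hypothesis sth : smooth th.
Hypothesis th0 : forall x t, r < `|x.1| + `|x.2| + `|t| -> th x t = 0.
Hypotheses (a0 : 0 < a) (rho0 : 0 <= rho) (rrho : r < rho).
Local Notation TR := (measurableTypeR R).
Local Notation L := (wave_op a th).

Lemma wave_op_bound : exists2 M : R, 0 <= M & forall x t, `|L x t| <= M.
Proof.
apply: (@vanish_bound _ r); first exact: wave_op_continuous.
by move=> x t; exact: wave_op_vanish.
Qed.

Let mz (y : R * R) (tau : R) : measurable_fun setT
  (fun z : TR * (TR * TR) => retarded a rho y z tau * L z.2 z.1).
Proof.
mt.
- by apply: (@measurable_retarded _ _ _ _ _ (fun=> y.1) (fun=> y.2) (fun z : TR * (TR * TR) => z.1)
    (fun z => z.2.1) (fun z => z.2.2) (fun=> tau)); mt.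
- exact: (measurable_ct3 (wave_op_continuous sth (a := a)) measurable_snd measurable_fst).
Qed.

Lemma integrable_retarded_pairing (y : R * R) (tau : R) :
  (pmeasure (lm1 R) (lm2 R)).-integrable setT
   (fun z => (retarded a rho y z tau * L z.2 z.1)%:E).
Proof.
have [M M0 LM] := wave_op_bound.
apply/integrableP; split; first by apply/measurable_EFinP; exact: (mz y tau).
have mr : measurable_fun setT (fun z : TR * (TR * TR) => retarded a rho y z tau).
  by apply: (@measurable_retarded _ _ _ _ _ (fun=> y.1) (fun=> y.2) (fun z : TR * (TR * TR) => z.1)
    (fun z => z.2.1) (fun z => z.2.2) (fun=> tau)); mt.
apply: (@le_lt_trans _ _ (\int[pmeasure (lm1 R) (lm2 R)]_z (M%:E * (retarded a rho y z tau)%:E))%E).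
  apply: ge0_le_integral => //.
  - by apply/measurable_EFinP; apply: mt_norm; exact: mz.
  - by apply/measurable_EFinP; apply: mtM => //; exact: mt_cst.
  - by move=> z _; rewrite -EFinM /= lee_fin normrM ger0_norm ?retarded_ge0// mulrC ler_wpM2r ?retarded_ge0.
rewrite ge0_integralZl//; last by move=> z _; rewrite lee_fin retarded_ge0.
  apply: lte_mul_pinfty; rewrite ?lee_fin//.
  apply: le_lt_trans (retarded_mass a0 rho0 y tau) _.
  by rewrite /patch; case: ifP; rewrite ?ltry.
exact/measurable_EFinP.
Qed.

(** For each t the spatial integral is rewritten over the hemisphere, and the divergence is
    integrated up to the horizon T = rho. A source born after rho contributes nothing, in agreement
    with the vanishing of th there. *)
Lemma retarded_pairing (y : R * R) (tau : R) : 0 <= tau ->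
  (\int[pmeasure (lm1 R) (lm2 R)]_z (retarded a rho y z tau * L z.2 z.1)%:E = (th y tau)%:E)%E.
Proof.
move=> t0; have [M M0 LM] := wave_op_bound.
have cw := wave_op_continuous sth (a := a).
have iz := integrable_retarded_pairing y tau.
move: iz; rewrite -setXTT => iz.
have [E _] := fubini_on iz measurableT measurableT.
apply: (etrans E) => {E}.
pose I := `[- (pi / 2), pi / 2]%classic : set R.
have h (t : R) : (\int[lm2 R]_x (retarded a rho y (t, x) tau * L x t)%:E =
    if (tau <= t <= rho)%R then \int[lm2 R]_(q in I `*` I)
    ((t - tau) / (2 * pi) * cos q.1 * L (wx a y tau q.1 q.2 t, wy a y tau q.1 t) t)%:E else 0)%E.
  case: ifPn => [/andP[h1 h2]|h].
    rewrite -(@integral_wave_kernel_bounded R a (t - tau) y (fun x => L x t) M) ?subr_ge0//.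
      by apply: eq_integral => x _; rewrite /retarded /= t0 h1 h2 !mul1r.
    exact: (@ct_pairl R _ _ (fun q : (R * R) * R => L q.1 q.2) t cw).
  apply: integral0_eq => x _; rewrite /retarded /= t0 mul1r -natrM mulnb.
  by rewrite (negbTE h) !mul0r.
have [tr|tr] := leP tau rho; last first.
  rewrite integral0_eq => [|t _].
    rewrite th0//; have := normr_ge0 y.1; have := normr_ge0 y.2; have := ler_norm tau; have := rrho; move: tr; lra.
  rewrite [LHS]h; case: ifPn => // /andP[h1 h2].
  by have := le_lt_trans (le_trans h1 h2) tr; rewrite ltxx.
rewrite -(angular_wave_mean (a := a) sth tr _ cw).
  rewrite [RHS]integral_mkcond; apply: eq_integral => t _.
  by rewrite [LHS]h /patch mem_setE in_itv.
(* Since rho > r, th and its derivatives vanish at time rho, so there is no flux through the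
   horizon. *)
move=> c b; have v l := iter_pder_vanish th0 l.
have vx x l : iter_pder l th x rho = 0.
  by rewrite v// (lt_le_trans rrho)// (ger0_norm rho0) lerDr addr_ge0.
have v0 x : th x rho = 0 := vx x [::].
by rewrite /flux_t v0 (vx _ [:: Dt]) (vx _ [:: D1]) (vx _ [:: D2]) !(mulr0, addr0, subr0).
Qed.

Variables (sg : R * R -> R -> R) (C : R).
Hypothesis csg : continuous (fun q : (R * R) * R => sg q.1 q.2).
Hypothesis sgC : forall x t, `|sg x t| <= C.

(** Duhamel superposition over tau. The mass bound on the retarded kernel gives absolute
    integrability in (t, x, tau), so tau can be integrated last, where the pairing with one impulse
    is known. *)
Lemma source_pairing (y : R * R)
  (Psi := fun q : (TR * (TR * TR)) * TR =>
     (retarded a rho y q.1 q.2 * (sg y q.2 * L q.1.2 q.1.1))%:E) :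
  (pmeasure (pmeasure (lm1 R) (lm2 R)) (lm1 R)).-integrable setT Psi /\
  (\int[pmeasure (pmeasure (lm1 R) (lm2 R)) (lm1 R)]_q Psi q =
   \int[lm1 R]_(t in (`[0%R, +oo[%classic : set R)) (sg y t * th y t)%:E)%E.
Proof.
have [M M0 LM] := wave_op_bound.
have C0 : 0 <= C := le_trans (normr_ge0 _) (sgC (0, 0) 0).
have mr : measurable_fun setT (fun q : (TR * (TR * TR)) * TR => retarded a rho y q.1 q.2).
  apply: (@measurable_retarded _ _ _ _ _ (fun=> y.1) (fun=> y.2)
    (fun q : (TR * (TR * TR)) * TR => q.1.1) (fun q => q.1.2.1) (fun q => q.1.2.2) (fun q => q.2)); mt.
  - by apply: (@mt_fst _ _ _ (TR * (TR * TR))%type _ (fun z => z.2.1)); mt.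
  - by apply: (@mt_fst _ _ _ (TR * (TR * TR))%type _ (fun z => z.2.2)); mt.
have mP : measurable_fun setT Psi.
  apply/measurable_EFinP; mt => //.
  - exact: (measurable_ct3 (x := fun=> y) csg (@measurable_cst _ _ _ _ _ _) measurable_snd).
  - exact: (measurableT_comp
      (measurable_ct3 (wave_op_continuous sth (a := a)) measurable_snd measurable_fst)
      measurable_fst).
have iP : (pmeasure (pmeasure (lm1 R) (lm2 R)) (lm1 R)).-integrable setT Psi.
  apply/integrableP; split => //.
  apply: (@le_lt_trans _ _ (\int[pmeasure (pmeasure (lm1 R) (lm2 R)) (lm1 R)]_q
      ((C * M)%:E * (retarded a rho y q.1 q.2)%:E))%E).
    apply: ge0_le_integral => //.
    - exact: measurableT_comp.
    - by apply/measurable_EFinP; apply: mtM => //; exact: mt_cst.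
    - move=> q _; rewrite -EFinM /Psi /= lee_fin normrM ger0_norm ?retarded_ge0// mulrC.
      by rewrite ler_wpM2r ?retarded_ge0// normrM ler_pM.
  rewrite ge0_integralZl//; first last.
  - by rewrite lee_fin mulr_ge0.
  - by move=> q _; rewrite lee_fin retarded_ge0.
  - exact/measurable_EFinP.
  apply: lte_mul_pinfty; rewrite ?lee_fin ?mulr_ge0//.
  have [_ E] := @tonelli _ _ _ (TR * (TR * TR))%type TR (pmeasure (lm1 R) (lm2 R)) (lm1 R)
    (fun q => (retarded a rho y q.1 q.2)%:E) (measurableT_comp (@EFin_measurable _ _) mr)
    (fun q => retarded_ge0 rho a0 y q.1 q.2).
  apply: (eq_ind_r (fun u => (u < +oo)%E) _ E).
  have mI : measurable (`[0, rho]%classic : set TR) by exact: measurable_itv.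
  apply: (@le_lt_trans _ _ (\int[lm1 R]_tau (cst (rho * rho)%:E \_ `[0%R, rho]%classic) tau)%E).
    apply: ge0_le_integral => //.
    - by move=> t _; apply: integral_ge0 => x _; rewrite lee_fin retarded_ge0.
    - by have := @measurable_fun_fubini_tonelli_G _ _ (TR * (TR * TR))%type TR R (pmeasure (lm1 R) (lm2 R))
        (fun q => (retarded a rho y q.1 q.2)%:E) (measurableT_comp (@EFin_measurable _ _) mr)
        (fun q => retarded_ge0 rho a0 y q.1 q.2).
    - by apply/(measurable_restrictT _ mI); exact: measurable_cst.
    - by move=> tau _; exact: retarded_mass.
  rewrite -integral_mkcond.
  rewrite (_ : (\int[lm1 R]_(t in _) _)%E = ((rho * rho)%:E * lm1 R `[0%R, rho]%classic)%E); last exact: integral_cst.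
  have e := lm1_itv rho0; apply: (eq_ind_r (fun u => (_ * u < +oo)%E) _ e).
  by rewrite -EFinM ltry.
split => //.
move: iP; rewrite -setXTT => iP.
have [_ E] := fubini_on iP measurableT measurableT.
apply: (etrans E) => {E}.
rewrite [RHS]integral_mkcond; apply: eq_integral => tau _.
rewrite /patch mem_setE in_itv /= andbT; case: ifPn => tau0; last first.
  by apply: integral0_eq => z _; rewrite /Psi /retarded /= (negbTE tau0) !mul0r.
rewrite EFinM -(retarded_pairing y tau0).
rewrite -integralZl//; last exact: integrable_retarded_pairing.
by apply: eq_integral => z _; rewrite /Psi -EFinM mulrCA.
Qed.

End single_source.

(** True also for divergent integrals, since [fine] sends both infinities to 0. This covers [Gfun]
    at x = y, where its integral may diverge. *)
Lemma fine_integralZl (R : realType) d (T : measurableType d) (mu : {measure set T -> \bar R})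
    (c : R) (f : T -> \bar R) : 0 <= c -> measurable_fun setT f ->
  fine (\int[mu]_x (c%:E * f x))%E = c * fine (\int[mu]_x f x)%E.
Proof.
rewrite le_eqVlt => /predU1P[<- _|c0 mf].
  by rewrite integral0_eq ?mul0r// => x _; rewrite mul0e.
rewrite integralE [in RHS]integralE.
have e1 : (\int[mu]_x ((fun x => c%:E * f x)^\+ x) = c%:E * \int[mu]_x (f^\+ x))%E.
  rewrite -ge0_integralZl//; [|exact: measurable_funepos|by rewrite lee_fin ltW].
  by apply: eq_integral => x _; rewrite ge0_funeposM// ltW.
have e2 : (\int[mu]_x ((fun x => c%:E * f x)^\- x) = c%:E * \int[mu]_x (f^\- x))%E.
  rewrite -ge0_integralZl//; [|exact: measurable_funeneg|by rewrite lee_fin ltW].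
  by apply: eq_integral => x _; rewrite ge0_funenegM// ltW.
rewrite e1 e2.
have : (0 <= \int[mu]_x (f^\+ x))%E by apply: integral_ge0.
have : (0 <= \int[mu]_x (f^\- x))%E by apply: integral_ge0.
case: (\int[mu]_x (f^\- x))%E => [v| |]; case: (\int[mu]_x (f^\+ x))%E => [u| |]//= _ _.
- by rewrite mulrBr.
- by rewrite gt0_muley ?lte_fin//= ?mulr0.
- by rewrite gt0_muley ?lte_fin//= ?mulr0.
- by rewrite gt0_muley ?lte_fin//= ?mulr0.
Qed.

Lemma arcsine_mass (R : realType) (b y : R) : 0 < b ->
  (\int[lm1 R]_x ((Num.sqrt (b ^+ 2 - (x - y) ^+ 2))^-1)%:E = pi%:E)%E.
Proof.
move=> b0.
have e := @arcsine_substitution R y b b0 (cst 1) (@ct_cst _ _ 1) (fun=> ler01).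
transitivity (\int[lebesgue_measure]_x (cst 1 x / Num.sqrt (b ^+ 2 - (x - y) ^+ 2))%:E)%E.
  by apply: eq_integral => x _; rewrite /cst mul1r.
have hp : - (pi / 2) <= pi / 2 :> R by have := pi_gt0 R; lra.
have mI : measurable (`[(- (pi / 2))%R, (pi / 2)%R]%classic : set (measurableTypeR R)) by exact: measurable_itv.
apply: etrans e _; apply: etrans (integral_cst (lm1 R) mI 1%:E) _.
apply: etrans (f_equal (fun u => 1%:E * u)%E (lm1_itv hp)) _.
by rewrite mul1e; congr EFin; lra.
Qed.

(** * The singularity of the kernel after integration in time *)

Section time_bound.
Variables (R : realType) (a rho : R).
Hypotheses (a0 : 0 < a) (rho0 : 0 <= rho).
Local Notation TR := (measurableTypeR R).

(** The prefactor (2 pi a)^-1 times the arcsine mass pi, times sqrt (b / a) with the retarded time b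
    bounded by rho. *)
Definition kernel_cst : R := (2 * a)^-1 * Num.sqrt (rho / a).

Lemma kernel_cst_ge0 : 0 <= kernel_cst.
Proof. by rewrite mulr_ge0 ?sqrtr_ge0// invr_ge0 mulr_ge0// ltW. Qed.

Lemma measurable_retarded_time (y : R * R) (z : R * (R * R)) :
  measurable_fun setT (fun tau : TR => retarded a rho y z tau).
Proof.
case: z => t [x1 x2].
by apply: (@measurable_retarded _ _ _ _ _ (fun=> y.1) (fun=> y.2) (fun=> t) (fun=> x1) (fun=> x2) (fun tau => tau)); mt.
Qed.

(** With r = |x - y| and retarded time b = t - r / a, the radicand factors as a (b - tau) (a (b -
    tau) + 2 r). It is at least 2 a r (b - tau), hence at least (a r / b) (b^2 - tau^2) because b +
    tau <= 2 b; what remains is an arcsine integral in tau. *)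
Lemma retarded_time_bound (y : R * R) (z : R * (R * R)) : z.2 != y ->
  (\int[lm1 R]_tau (retarded a rho y z tau)%:E
    <= (kernel_cst / Num.sqrt (Defs.edist z.2 y))%:E)%E.
Proof.
case: z => t x /= xy; set r := Defs.edist x y.
have r2E : r ^+ 2 = (x.1 - y.1) ^+ 2 + (x.2 - y.2) ^+ 2.
  by rewrite sqr_sqrtr// addr_ge0 ?sqr_ge0.
have r0 : 0 < r.
  rewrite lt_neqAle sqrtr_ge0 andbT eq_sym; apply: contra xy => /eqP r0.
  move: r2E; rewrite r0 expr0n /= => /esym/eqP.
  rewrite paddr_eq0 ?sqr_ge0// !sqrf_eq0 !subr_eq0 => /andP[/eqP e1 /eqP e2].
  by apply/eqP; rewrite (surjective_pairing x) (surjective_pairing y) e1 e2.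
have B0 : 0 <= kernel_cst / Num.sqrt r by rewrite divr_ge0 ?kernel_cst_ge0 ?sqrtr_ge0.
have p0 : 0 < 2 * pi * a by rewrite !mulr_gt0// pi_gt0.
pose b := t - r / a.
have KE tau : wave_kernel a x y (t - tau) = (2 * pi * a)^-1 / Num.sqrt ((a * (t - tau)) ^+ 2 - r ^+ 2).
  by rewrite /wave_kernel; congr (_ / Num.sqrt _); rewrite r2E; ring.
have [b0|b0] := leP b 0.
  rewrite integral0_eq ?lee_fin// => tau _.
  rewrite retarded_le /=; case: (boolP (0 <= tau <= t)) => [/andP[h1 h2]|_]; last by rewrite !mul0r.
  rewrite KE ler0_sqrtr ?invr0 ?mulr0// subr_le0 ler_sqr ?nnegrE ?mulr_ge0 ?subr_ge0 ?(ltW a0) ?(ltW r0)//.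
  have : a * b <= 0 by rewrite pmulr_rle0.
  rewrite /b mulrBr mulrCA divff ?gt_eqF// mulr1 mulrBr.
  have : 0 <= a * tau by rewrite mulr_ge0// ltW.
  lra.
have [tr|tr] := leP t rho; last first.
  rewrite integral0_eq ?lee_fin// => tau _.
  by rewrite /retarded /= (leNgt t) tr !(mulr0, mul0r).
have br : b <= rho by rewrite (le_trans _ tr)// lerBlDr lerDl divr_ge0 ?ltW.
pose c := (2 * pi * a)^-1 * Num.sqrt (b / (a * r)).
have c0 : 0 <= c by rewrite mulr_ge0 ?sqrtr_ge0// invr_ge0 ltW.
have mb : measurable_fun setT (fun tau : TR => (Num.sqrt (b ^+ 2 - tau ^+ 2))^-1) by mt.
apply: (@le_trans _ _ (\int[lm1 R]_tau (c%:E * ((Num.sqrt (b ^+ 2 - tau ^+ 2))^-1)%:E))%E).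
  apply: ge0_le_integral => //.
  - by move=> tau _; rewrite lee_fin retarded_ge0.
  - by apply/measurable_EFinP; exact: (measurable_retarded_time y (t, x)).
  - by apply/measurable_EFinP; apply: mtM => //; exact: mt_cst.
  move=> tau _; rewrite -EFinM lee_fin retarded_le /=.
  have P0 : 0 <= c * (Num.sqrt (b ^+ 2 - tau ^+ 2))^-1 by rewrite mulr_ge0// invr_ge0 sqrtr_ge0.
  case: (boolP (0 <= tau <= t)) => [/andP[h1 h2]|_]; last by rewrite !mul0r.
  rewrite tr !mul1r KE.
  have e1 : (a * (t - tau)) ^+ 2 - r ^+ 2 = (a * (b - tau)) * (a * (b - tau) + 2 * r).
    rewrite /b; field; by rewrite gt_eqF.
  have [tb|tb] := leP b tau.
    rewrite ler0_sqrtr ?invr0 ?mulr0// subr_le0 ler_sqr ?nnegrE ?mulr_ge0 ?subr_ge0 ?(ltW a0) ?(ltW r0)//.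
    move: tb; rewrite /b lerBlDr -lerBlDl => tb.
    by rewrite mulrC -ler_pdivlMr.
  have bt0 : 0 < b - tau by rewrite subr_gt0.
  have q0 : 0 < b ^+ 2 - tau ^+ 2 by rewrite subr_sqr mulr_gt0// ltr_wpDr.
  have d0 : 0 < a * r / b by rewrite divr_gt0// mulr_gt0.
  (* The factor a r / b is where the singularity r^(-1/2) of the final bound originates. *)
  have le2 : (a * r / b) * (b ^+ 2 - tau ^+ 2) <= (a * (t - tau)) ^+ 2 - r ^+ 2.
    rewrite e1 subr_sqr.
    apply: (@le_trans _ _ (a * (b - tau) * (2 * r))); last first.
      by rewrite ler_wpM2l ?lerDr ?mulr_ge0 ?(ltW a0) ?(ltW bt0).
    rewrite (_ : a * r / b * _ = a * (b - tau) * (r * ((b + tau) / b))); last by field; rewrite gt_eqF.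
    rewrite ler_pM2l ?mulr_gt0// mulrC ler_pM2r// ler_pdivrMr//; lra.
  rewrite /c -[leRHS]mulrA ler_pM2l ?invr_gt0//.
  have -> : Num.sqrt (b / (a * r)) * (Num.sqrt (b ^+ 2 - tau ^+ 2))^-1 =
      (Num.sqrt (a * r / b * (b ^+ 2 - tau ^+ 2)))^-1.
    by rewrite [X in _ = X^-1](sqrtrM _ (ltW d0)) [RHS]invfM -(sqrtrV (ltW d0)) invf_div.
  rewrite lef_pV2 ?posrE ?sqrtr_gt0 ?(mulr_gt0 d0 q0)//; last first.
    exact: (lt_le_trans (mulr_gt0 d0 q0) le2).
  by rewrite ler_wsqrtr.
rewrite ge0_integralZl//; first last.
  exact/measurable_EFinP.
have -> : (\int[lm1 R]_x ((Num.sqrt (b ^+ 2 - x ^+ 2))^-1)%:E = pi%:E)%E.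
  by rewrite -(arcsine_mass 0 b0); apply: eq_integral => v _; rewrite subr0.
rewrite -EFinM lee_fin /c /kernel_cst.
have pi0 := pi_gt0 R.
rewrite mulrAC (_ : (2 * pi * a)^-1 * pi = (2 * a)^-1); last first.
  by rewrite [2 * pi]mulrC -mulrA invfM mulrAC mulVf ?mul1r// gt_eqF.
rewrite -mulrA ler_pM2l ?invr_gt0 ?mulr_gt0//.
have ra0 : 0 <= rho / a by rewrite divr_ge0// ltW.
rewrite -(sqrtrV (ltW r0)) -(sqrtrM _ ra0) ler_wsqrtr// invfM mulrA.
by rewrite ler_wpM2r ?invr_ge0 ?(ltW r0)// ler_wpM2r ?invr_ge0 ?(ltW a0).
Qed.

End time_bound.

(** * The potential of a single source *)

Section potential.
Variables (R : realType) (a rho C : R) (sg : R * R -> R -> R).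
Hypotheses (a0 : 0 < a) (rho0 : 0 <= rho).
Hypothesis csg : continuous (fun q : (R * R) * R => sg q.1 q.2).
Hypothesis sgC : forall x t, `|sg x t| <= C.
Local Notation TR := (measurableTypeR R).

(** [Gfun] as an integral over the whole time line; [fine] mirrors [Rintegral], so that the two
    agree also where the integral diverges. *)
Definition potential (y : R * R) (z : R * (R * R)) : R :=
  fine (\int[lm1 R]_tau (retarded a rho y z tau * sg y tau)%:E)%E.

(** Positive and negative parts are integrated separately, because at z.2 = y the integrand may fail
    to be integrable. *)
Lemma measurable_potential :
  measurable_fun setT (fun p : (TR * TR) * (TR * (TR * TR)) => potential p.1 p.2).
Proof.
pose f (q : ((TR * TR) * (TR * (TR * TR))) * TR) := (retarded a rho q.1.1 q.1.2 q.2 * sg q.1.1 q.2)%:E.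
have mf : measurable_fun setT f.
  apply/measurable_EFinP; mt.
  - have m1 : measurable_fun setT (fun q : ((TR * TR) * (TR * (TR * TR))) * TR => q.1.1).
      exact: (measurableT_comp measurable_fst measurable_fst).
    have m2 : measurable_fun setT (fun q : ((TR * TR) * (TR * (TR * TR))) * TR => q.1.2).
      exact: (measurableT_comp measurable_snd measurable_fst).
    have m22 := measurableT_comp measurable_snd m2.
    apply: (@measurable_retarded _ _ _ _ _
      (fun q : ((TR * TR) * (TR * (TR * TR))) * TR => q.1.1.1) (fun q => q.1.1.2)
      (fun q => q.1.2.1) (fun q => q.1.2.2.1) (fun q => q.1.2.2.2) (fun q => q.2)).
    + exact: (measurableT_comp measurable_fst m1).
    + exact: (measurableT_comp measurable_snd m1).
    + exact: (measurableT_comp measurable_fst m2).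
    + exact: (measurableT_comp measurable_fst m22).
    + exact: (measurableT_comp measurable_snd m22).
    + exact: measurable_snd.
  - apply: (measurable_ct3 csg) => //.
    exact: (measurableT_comp measurable_fst measurable_fst).
apply: (measurableT_comp (fine_measurable measurableT)) => //.
rewrite (_ : (fun p => _) = (fun p => \int[lm1 R]_tau (f^\+ (p, tau)) - \int[lm1 R]_tau (f^\- (p, tau)))%E).
  apply: emeasurable_funB.
  - have m := @measurable_fun_integral_snd R _ _ ((TR * TR) * (TR * (TR * TR)))%type TR (lm1 R) setT (f^\+)%E
      (measurable_funepos mf) (funepos_ge0 f) measurableT.
    exact: m.
  - have m := @measurable_fun_integral_snd R _ _ ((TR * TR) * (TR * (TR * TR)))%type TR (lm1 R) setT (f^\-)%E
      (measurable_funeneg mf) (funeneg_ge0 f) measurableT.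
    exact: m.
apply/funext => p; rewrite integralE; congr (_ - _)%E; apply: eq_integral => tau _.
  by rewrite !funeposE.
by rewrite !funenegE.
Qed.

Lemma integrable_retarded_time (y : R * R) (z : R * (R * R)) : z.2 != y ->
  (lm1 R).-integrable setT (fun tau => (retarded a rho y z tau * sg y tau)%:E).
Proof.
move=> zy; have C0 : 0 <= C := le_trans (normr_ge0 _) (sgC (0, 0) 0).
have mr := measurable_retarded_time a rho y z.
have msg : measurable_fun setT (fun tau : TR => sg y tau).
  exact: (measurable_ct3 (x := fun=> y) csg (@measurable_cst _ _ _ _ _ _) (@measurable_id _ _ _)).
apply/integrableP; split; first by apply/measurable_EFinP; exact: mtM.
apply: (@le_lt_trans _ _ (\int[lm1 R]_tau (C%:E * (retarded a rho y z tau)%:E))%E).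
  apply: ge0_le_integral => //.
  - by apply/measurable_EFinP; apply: mt_norm; exact: mtM.
  - by apply/measurable_EFinP; apply: mtM => //; exact: mt_cst.
  - move=> q _; rewrite -EFinM /= lee_fin normrM ger0_norm ?retarded_ge0// mulrC.
    by rewrite ler_wpM2r ?retarded_ge0.
rewrite ge0_integralZl//; first last.
- by move=> q _; rewrite lee_fin retarded_ge0.
- exact/measurable_EFinP.
apply: lte_mul_pinfty; rewrite ?lee_fin//.
exact: le_lt_trans (retarded_time_bound a0 rho0 zy) (ltry _).
Qed.

Lemma potential_le (y : R * R) (z : R * (R * R)) : z.2 != y ->
  `|potential y z| <= C * (kernel_cst a rho / Num.sqrt (Defs.edist z.2 y)).
Proof.
move=> zy; have C0 : 0 <= C := le_trans (normr_ge0 _) (sgC (0, 0) 0).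
have ir := integrable_retarded_time zy.
have fin := integrable_fin_num _ ir.
rewrite -lee_fin -abse_EFin /potential fineK ?fin//.
have mr := measurable_retarded_time a rho y z.
apply: le_trans (le_abse_integral _ _ _) _ => //; first exact: measurable_int ir.
apply: (@le_trans _ _ (\int[lm1 R]_tau (C%:E * (retarded a rho y z tau)%:E))%E).
  apply: ge0_le_integral => //.
  - apply: measurableT_comp => //; exact: measurable_int ir.
  - by apply/measurable_EFinP; apply: mtM => //; exact: mt_cst.
  - move=> q _; rewrite -EFinM /= lee_fin normrM ger0_norm ?retarded_ge0// mulrC.
    by rewrite ler_wpM2r ?retarded_ge0.
rewrite ge0_integralZl//; first last.
- by move=> q _; rewrite lee_fin retarded_ge0.
- exact/measurable_EFinP.
rewrite EFinM; apply: lee_wpmul2l; rewrite ?lee_fin//.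
exact: retarded_time_bound.
Qed.

(** The bound by 1 / |x - y| is weakened through |u v| <= u^2 + v^2, which separates the two
    coordinates: local integrability is then a product of two integrals of |v|^(-1/2) on the
    line. *)
Lemma potential_sqr_le (y : R * R) (z : R * (R * R)) : z.2.1 != y.1 -> z.2.2 != y.2 ->
  potential y z ^+ 2 <= (C * kernel_cst a rho) ^+ 2
    * ((Num.sqrt `|z.2.1 - y.1|)^-1 * (Num.sqrt `|z.2.2 - y.2|)^-1).
Proof.
move=> n1 n2; have C0 : 0 <= C := le_trans (normr_ge0 _) (sgC (0, 0) 0).
have zy : z.2 != y by apply: contra n1 => /eqP ->.
have k0 := kernel_cst_ge0 rho a0.
rewrite -(ger0_norm (sqr_ge0 _)) normrX.
apply: (@le_trans _ _ ((C * (kernel_cst a rho / Num.sqrt (Defs.edist z.2 y))) ^+ 2)).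
  by rewrite ler_sqr ?nnegrE ?potential_le// mulr_ge0 ?divr_ge0 ?sqrtr_ge0.
have [u0 v0] : 0 < `|z.2.1 - y.1| /\ 0 < `|z.2.2 - y.2| by rewrite !normr_gt0 !subr_eq0.
rewrite mulrA exprMn ler_wpM2l ?sqr_ge0// exprVn sqr_sqrtr ?sqrtr_ge0//.
rewrite -invfM lef_pV2 ?posrE ?mulr_gt0 ?sqrtr_gt0 ?addr_gt0 ?exprn_even_gt0 ?subr_eq0//.
rewrite -sqrtrM ?normr_ge0// ler_wsqrtr// -normrM ler_norml.
have h (u v : R) : - (u ^+ 2 + v ^+ 2) <= u * v <= u ^+ 2 + v ^+ 2 by apply/andP; split; nra.
exact: h.
Qed.

Variables (th : R * R -> R -> R) (r : R).
Hypothesis sth : smooth th.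
Hypothesis th0 : forall x t, r < `|x.1| + `|x.2| + `|t| -> th x t = 0.
Hypothesis rrho : r < rho.
Local Notation L := (wave_op a th).

Lemma integral_potential_wave_op (y : R * R) :
  (\int[pmeasure (lm1 R) (lm2 R)]_z (potential y z * L z.2 z.1)%:E =
   \int[lm1 R]_(t in (`[0%R, +oo[%classic : set R)) (sg y t * th y t)%:E)%E.
Proof.
have [iP <-] := source_pairing sth th0 a0 rho0 rrho csg sgC y.
have mp : measurable_fun setT (fun z => potential y z).
  exact: (measurableT_comp measurable_potential (measurable_pair1 y)).
have mL := measurable_ct3 (wave_op_continuous sth (a := a)) measurable_snd measurable_fst.
have iP2 := iP; rewrite -setXTT in iP2.
have [E _] := fubini_on iP2 measurableT measurableT.
rewrite setXTT in E; apply: etrans (esym E).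
apply: ae_eq_integral => //.
- by apply/measurable_EFinP; apply: mtM.
- exact: (measurable_int _ (integrable_fubini_F iP)).
have m1 (u : R) : measurable [set u : TR] by exact: measurable_set1.
(* The exceptional set is the time axis above the source, of measure zero: off it the integrand in
   tau is integrable and the factor [L] can be taken out of the integral. *)
exists (setT `*` ([set y.1] `*` [set y.2])); split.
- by apply: measurableX => //; exact: measurableX.
- have e := pmeasureE (lm1 R) (lm2 R) measurableT (measurableX (m1 y.1) (m1 y.2)).
  apply: (etrans e).
  have e0 := lm2E (m1 y.1) (m1 y.2); apply: (eq_ind_r (fun u => _ * u = _)%E _ e0).
  have e1 : (lm1 R [set y.1] = 0)%E := lebesgue_measure_set1 _.
  by rewrite e1 mul0e mule0.
move=> [t x] /= ne; split => //; apply: contra_notP ne => xy _.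
have {}xy : x != y by apply/negP => /eqP e; apply: xy; rewrite e.
have ir := @integrable_retarded_time y (t, x) xy.
rewrite EFinM /potential fineK; last exact: (integrable_fin_num _ ir).
rewrite muleC -integralZl//.
by apply: eq_integral => tau _; rewrite -EFinM; congr EFin; rewrite [LHS]mulrC mulrA.
Qed.

End potential.

(** Past the retarded time t - |x - y| / a the radicand is nonpositive, so the cut-off in [Gfun] may
    be traded for the indicator of 0 <= tau <= t. Clamping tau at 0 extends sigma continuously to
    negative times, where only its values for tau >= 0 enter. *)
Lemma Gfun_potential (R : realType) (a rho : R) (sigma : R * R -> R -> R) (x y : R * R) (t : R) :
  0 < a -> continuous (fun q : (R * R) * R => sigma q.1 (Num.max q.2 0)) -> t <= rho ->
  Gfun a sigma x y t = potential a rho (fun y tau => sigma y (Num.max tau 0)) y (t, x).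
Proof.
move=> a0 cs tr; rewrite /Gfun /potential.
have dyx : Defs.edist y x = Defs.edist x y.
  by rewrite /Defs.edist; congr (Num.sqrt (_ + _)); rewrite -sqrrN opprB.
have r2E : Defs.edist x y ^+ 2 = (x.1 - y.1) ^+ 2 + (x.2 - y.2) ^+ 2.
  by rewrite sqr_sqrtr// addr_ge0 ?sqr_ge0.
have r0 : 0 <= Defs.edist x y by exact: sqrtr_ge0.
rewrite dyx; set r := Defs.edist x y in r2E r0 *.
have p0 : 0 < 2 * pi * a by rewrite !mulr_gt0// pi_gt0.
have KE tau : wave_kernel a x y (t - tau) = (2 * pi * a)^-1 / Num.sqrt (a ^+ 2 * (t - tau) ^+ 2 - r ^+ 2).
  by rewrite /wave_kernel exprMn; congr (_ / Num.sqrt _); rewrite r2E; ring.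
have K0 tau : 0 <= tau -> t - r / a <= tau -> (0 <= tau <= t)%R%:R * wave_kernel a x y (t - tau) = 0.
  move=> h1 h2; case: (boolP (0 <= tau <= t)) => [/andP[_ h3]|_]; last by rewrite !mul0r.
  rewrite KE ler0_sqrtr ?invr0 ?mulr0// subr_le0 -exprMn ler_sqr ?nnegrE ?mulr_ge0 ?subr_ge0 ?(ltW a0)//.
  by rewrite mulrC -ler_pdivlMr// lerBlDr addrC -lerBlDr.
have RE tau : retarded a rho y (t, x) tau = (0 <= tau <= t)%R%:R * wave_kernel a x y (t - tau).
  by rewrite retarded_le /= tr mulr1.
case: ifPn => [rat|]; last first.
  rewrite -leNgt => rat; rewrite integral0_eq// => tau _; rewrite RE.
  have [h0|h0] := leP 0 tau; last by rewrite !mul0r.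
  have := K0 _ h0; rewrite h0 /= => ->; rewrite ?mul0r//.
  by rewrite (le_trans _ h0)// subr_le0 ler_pdivlMr// mulrC.
set D := `[0, t - r / a]%classic.
have mD : measurable (D : set (measurableTypeR R)) by exact: measurable_itv.
pose g (tau : measurableTypeR R) := (sigma y (Num.max tau 0) / Num.sqrt (a ^+ 2 * (t - tau) ^+ 2 - r ^+ 2))%:E.
have mg : measurable_fun setT g.
  apply/measurable_EFinP; mt.
  apply: (measurable_ct3 (h := fun y tau => sigma y (Num.max tau 0)) (x := fun=> y) cs) => //.
transitivity ((2 * pi * a)^-1 * fine (\int[lm1 R]_tau ((g \_ D) tau))%E).
  congr (_ * fine _); rewrite -integral_mkcond; apply: eq_integral => tau.
  by rewrite inE /D /= in_itv /= => /andP[h1 h2]; rewrite /g max_l.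
rewrite -fine_integralZl ?invr_ge0 ?(ltW p0)//; last first.
  by apply/(measurable_restrictT _ mD); exact: measurable_funTS.
congr fine; apply: eq_integral => tau _; rewrite RE /patch.
case: ifPn; rewrite ?inE ?notin_setE /D /= in_itv /= => h.
  have /andP[h1 h2] := h.
  rewrite /g -EFinM KE h1 (le_trans h2) ?mul1r; last by rewrite lerBlDr lerDl divr_ge0 ?(ltW a0).
  by congr EFin; ring.
rewrite mule0; have [h0|h0] := leP 0 tau; last by rewrite !mul0r.
have := K0 _ h0; rewrite h0 /= => ->; rewrite ?mul0r//.
by move/negP: h; rewrite h0 /= -ltNge => /ltW.
Qed.

(** * Independence *)

Section independence.
Context d (Om : measurableType d) (R : realType) (P : probability Om R)
  (I : eqType) (F : I -> set (set Om)).
Hypothesis iF : mutual_indep P F.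
Hypothesis mF : forall i A, F i A -> measurable A.
Hypothesis FT : forall i, F i setT.
Hypothesis FI : forall i A B, F i A -> F i B -> F i (A `&` B).
Variable i0 : I.

(** The pi-system of finite intersections of events drawn from the sources other than [i0]. *)
Definition cylinders : set (set Om) := fun B => exists J (A : I -> set Om),
  [/\ uniq J, i0 \notin J, forall i, i \in J -> F i (A i) &
      B = \bigcap_(i in [set` J]) A i].

Let mcap (J : seq I) (A : I -> set Om) : (forall i, i \in J -> F i (A i)) ->
  measurable (\bigcap_(i in [set` J]) A i).
Proof. by move=> FA; apply: fin_bigcap_measurable => // i /FA /mF. Qed.

Lemma measurable_cylinders : <<s cylinders >> `<=` @measurable _ Om.
Proof.
apply: smallest_sub; first exact: sigma_algebra_measurable.
by move=> _ [J [A [_ _ FA ->]]]; exact: mcap.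
Qed.

Lemma cylinders_event i A : i != i0 -> F i A -> cylinders A.
Proof.
move=> ii0 FA; exists [:: i], (fun=> A); split => //.
- by rewrite inE eq_sym.
- by move=> j; rewrite inE => /eqP ->.
- apply/seteqP; split=> [w Aw j _ //|w h]; apply: (h i).
  by rewrite /= mem_head.
Qed.

Lemma cylindersT : cylinders setT.
Proof.
exists [::], (fun=> setT); split => //.
by rewrite bigcapT.
Qed.

Lemma cylindersI : setI_closed cylinders.
Proof.
move=> _ _ [J [A [uJ iJ FA ->]]] [K [B [uK iK FB ->]]].
exists (undup (J ++ K)), (fun i => (if i \in J then A i else setT) `&`
  (if i \in K then B i else setT)); split.
- exact: undup_uniq.
- by rewrite mem_undup mem_cat negb_or iJ.
- move=> i _; apply: FI.
    by case: ifPn => [/FA//|_]; exact: FT.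
  by case: ifPn => [/FB//|_]; exact: FT.
- apply/seteqP; split=> [w [Aw Bw] i /= _|w h].
    by split; case: ifPn => // ii; [exact: Aw|exact: Bw].
  split=> i /= ii.
    by have [] := h i; rewrite /= ?mem_undup ?mem_cat ?ii.
  by have [] := h i; rewrite /= ?mem_undup ?mem_cat ?ii ?orbT.
Qed.

Lemma cylinders_indep A B : cylinders A -> F i0 B -> (P (A `&` B) = P A * P B)%E.
Proof.
move=> [J [C [uJ iJ FC ->]]] FB.
pose D i := if i == i0 then B else C i.
have DC i : i \in J -> D i = C i.
  by rewrite /D; case: eqVneq => // -> ii; rewrite ii in iJ.
have Di0 : D i0 = B by rewrite /D eqxx.
have FD i : i \in i0 :: J -> F i (D i).
  rewrite inE => /predU1P[->|ii]; first by rewrite Di0.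
  by rewrite DC//; exact: FC.
have uD : uniq (i0 :: J) by rewrite /= iJ.
have := iF uD FD; rewrite big_cons Di0.
have -> : \bigcap_(i in [set` i0 :: J]) D i = (\bigcap_(i in [set` J]) C i) `&` B.
  apply/seteqP; split=> [w h|w [h Bw] i /=].
    split=> [i /= ii|]; last by rewrite -Di0; apply: (h i0); rewrite /= mem_head.
    by rewrite -DC//; apply: (h i); rewrite /= inE ii orbT.
  by rewrite inE => /predU1P[->|ii]; [rewrite Di0|rewrite DC//; exact: h].
move=> ->; rewrite (iF uJ FC) EFinM muleC fineK ?fin_num_measure//; last exact: mF FB.
by congr (_%:E * _)%E; apply: eq_big_seq => i ii; rewrite DC.
Qed.

(** For fixed [B], the maps sending [A] to P (A n B) and to P (B) P (A) are finite measures that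
    agree on a pi-system, hence on the sigma-algebra it generates. *)
Lemma sigma_cylinders_indep A B : <<s cylinders >> A -> F i0 B ->
  (P (A `&` B) = P A * P B)%E.
Proof.
move=> sA FB; have mB := mF FB.
have q0 : 0 <= fine (P B) by rewrite fine_ge0.
have fB : P B \is a fin_num by rewrite fin_num_measure.
rewrite muleC -(fineK fB).
apply: (@g_sigma_algebra_measure_unique _ R Om cylinders _ (fun=> setT) _ _
  (mrestr P mB) (mscale (NngNum q0) P) _ _ _ A sA).
- by move=> C [J [D [_ _ FD ->]]]; exact: mcap.
- by move=> _; exact: cylindersT.
- by rewrite bigcup_const//; exists 0%N.
- exact: cylindersI.
- by move=> C cC; rewrite /mrestr/= /mscale/= fineK// muleC; exact: cylinders_indep.
- by move=> _; apply: le_lt_trans (probability_le1 P (measurableI _ _ measurableT mB)) _; rewrite ltry.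
Qed.

(** The space [Om] with the smaller sigma-algebra generated by all sources but [i0]. Measurability
    of a map from [others] expresses that it is a function of those sources only. *)
Definition others := g_sigma_algebraType cylinders.

Lemma measurable_others d' (T : measurableType d') (f : Om -> T) i : i != i0 ->
  (forall B, measurable B -> F i (f @^-1` B)) ->
  measurable_fun setT (f : others -> T).
Proof.
move=> ii0 Ff _ B mB; rewrite setTI; apply: sub_gen_smallest.
exact: cylinders_event (Ff _ mB).
Qed.

Let mid : measurable_fun setT (id : Om -> others).
Proof. by move=> _ A mA; rewrite setTI; exact: measurable_cylinders. Qed.

(** The joint law of the identity into [others] and of [X] is a product measure, and Tonelli's
    theorem applies to it. *)
Theorem indep_integral d' (T : measurableType d') (X : Om -> T) (f : others * T -> \bar R) :
  (forall B, measurable B -> F i0 (X @^-1` B)) ->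
  measurable_fun setT f -> (forall q, 0 <= f q)%E ->
  (\int[P]_w f (w, X w) = \int[P]_w \int[P]_v f (w, X v))%E.
Proof.
move=> FX mf f0.
have mX : measurable_fun setT X by move=> _ B mB; rewrite setTI; exact: mF (FX _ mB).
pose mX' := isMeasurableFun.Build _ _ _ _ _ mX.
pose X' : {mfun Om >-> T} := HB.pack X mX'.
pose mid' := isMeasurableFun.Build _ _ _ _ _ mid.
pose id' : {mfun Om >-> others} := HB.pack (id : Om -> others) mid'.
have mp : measurable_fun setT (fun w : Om => (w : others, X w)).
  by apply: measurable_fun_pair.
pose mp' := isMeasurableFun.Build _ _ _ _ _ mp.
pose p' : {mfun Om >-> (others * T)%type} := HB.pack (fun w : Om => (w : others, X w)) mp'.
have E : forall A, measurable A ->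
    (distribution P id' \x distribution P X')%E A = distribution P p' A.
  apply: product_measure_unique => A B mA mB.
  exact: (sigma_cylinders_indep mA (FX _ mB)).
transitivity (\int[distribution P p']_q f q)%E.
  by rewrite ge0_integral_distribution.
rewrite -(@eq_measure_integral _ _ _ setT (distribution P p') (distribution P id' \x distribution P X')%E f); last first.
  by move=> A mA _; exact: E.
rewrite fubini_tonelli1// ge0_integral_distribution//; first last.
- by move=> w; apply: integral_ge0.
- exact: measurable_fun_fubini_tonelli_F.
apply: eq_integral => w _ /=.
rewrite /fubini_F ge0_integral_distribution//.
have m := measurableT_comp mf (measurable_fun_pair (@measurable_cst _ _ T others setT w) (@measurable_id _ T setT)).
exact: m.
Qed.

Lemma indep_integralM (U V : Om -> R) :
  measurable_fun setT (U : others -> R) -> (forall B, measurable B -> F i0 (V @^-1` B)) ->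
  (forall w, 0 <= U w) -> (forall w, 0 <= V w) ->
  (\int[P]_w (U w * V w)%:E = \int[P]_w (U w)%:E * \int[P]_w (V w)%:E)%E.
Proof.
move=> mU FV U0 V0.
have mV : measurable_fun setT V by move=> _ B mB; rewrite setTI; exact: mF (FV _ mB).
(* The positive part makes the integrand nonnegative on the whole product; on the range of [V] it
   changes nothing. *)
pose f (q : others * measurableTypeR R) : \bar R := (U q.1 * Num.max q.2 0)%:E.
have mf : measurable_fun setT f.
  apply/measurable_EFinP; apply: mtM; first exact: (measurableT_comp mU measurable_fst).
  by apply: measurable_maxr; [exact: measurable_snd|exact: mt_cst].
have f0 q : (0 <= f q)%E by rewrite lee_fin mulr_ge0// le_max lexx orbT.
have E := @indep_integral _ (measurableTypeR R) V f FV mf f0.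
transitivity (\int[P]_w f (w, V w))%E.
  by apply: eq_integral => w _; rewrite /f /= max_l.
rewrite E; transitivity (\int[P]_w ((U w)%:E * \int[P]_v (V v)%:E))%E.
  apply: eq_integral => w _; rewrite -ge0_integralZl//.
  - by apply: eq_integral => v _; rewrite /f /= max_l// EFinM.
  - exact/measurable_EFinP.
  - by move=> v _; rewrite lee_fin.
  - by rewrite lee_fin.
rewrite ge0_integralZr//.
- by apply/measurable_EFinP; exact: (measurableT_comp mU mid).
- by move=> w _; rewrite lee_fin.
- by apply: integral_ge0 => w _; rewrite lee_fin.
Qed.

(** Integrability is assumed for the product alone, so everything goes through nonnegative parts:
    (UV)^+ = U^+ V^+ + U^- V^- and (UV)^- = U^+ V^- + U^- V^+. After factorization the two integrals
    coincide because V^+ and V^- have the same integral. *)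
Lemma indep_mean0 (U V : Om -> R) :
  measurable_fun setT (U : others -> R) -> (forall B, measurable B -> F i0 (V @^-1` B)) ->
  (\int[P]_w (Num.max (V w) 0)%:E = \int[P]_w (Num.max (- V w) 0)%:E)%E ->
  P.-integrable setT (fun w => (U w * V w)%:E) ->
  (\int[P]_w (U w * V w)%:E = 0)%E.
Proof.
move=> mU FV V0 iUV.
pose p (x : R) := Num.max x 0; pose n (x : R) := Num.max (- x) 0.
have mp : measurable_fun setT p by apply: measurable_maxr; [exact: measurable_id|exact: mt_cst].
have mn : measurable_fun setT n.
  by apply: measurable_maxr; [apply: mtN; exact: measurable_id|exact: mt_cst].
have p0 x : 0 <= p x by rewrite le_max lexx orbT.
have n0 x : 0 <= n x by rewrite le_max lexx orbT.
have mV : measurable_fun setT V by move=> _ B mB; rewrite setTI; exact: mF (FV _ mB).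
have mU' : measurable_fun setT U by exact: (measurableT_comp mU mid).
have Fp (h : R -> R) : measurable_fun setT h -> forall B, measurable B -> F i0 ((h \o V) @^-1` B).
  by move=> mh B mB; rewrite comp_preimage; apply: FV; rewrite -[X in measurable X]setTI; exact: mh.
have e (h k : R -> R) : measurable_fun setT h -> measurable_fun setT k ->
   (forall x, 0 <= h x) -> (forall x, 0 <= k x) ->
   (\int[P]_w (h (U w) * k (V w))%:E = \int[P]_w (h (U w))%:E * \int[P]_w (k (V w))%:E)%E.
  move=> mh mk h0 k0; apply: (@indep_integralM (h \o U) (k \o V)) => //=.
  - exact: (measurableT_comp mh mU).
  - exact: Fp.
have mh (h k : R -> R) : measurable_fun setT h -> measurable_fun setT k ->
  measurable_fun setT (fun w => (h (U w) * k (V w))%:E).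
  by move=> mh mk; apply/measurable_EFinP; apply: mtM; exact: measurableT_comp.
have pos x y : Num.max (x * y) 0 = p x * p y + n x * n y.
  rewrite /p /n; have [x0|x0] := leP 0 x; have [y0|y0] := leP 0 y.
  - by rewrite (@max_l _ _ (x * y)) ?mulr_ge0// (@max_r _ _ (- x)) ?oppr_le0// mul0r addr0.
  - by rewrite (@max_r _ _ (x * y)) ?mulr_ge0_le0 ?(ltW y0)// (@max_r _ _ (- x)) ?oppr_le0// mul0r mulr0 addr0.
  - by rewrite (@max_r _ _ (x * y)) ?mulr_le0_ge0 ?(ltW x0)// (@max_r _ _ (- y)) ?oppr_le0// mul0r mulr0 addr0.
  - rewrite (@max_l _ _ (x * y)) ?mulr_le0 ?(ltW x0) ?(ltW y0)//.
    by rewrite !max_l ?oppr_ge0 ?(ltW x0) ?(ltW y0)// mul0r add0r mulrNN.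
have neg x y : Num.max (- (x * y)) 0 = p x * n y + n x * p y.
  rewrite -mulrN pos; congr (_ * _ + _ * _); by rewrite /n /p ?opprK.
have Ep : (\int[P]_w (Num.max (U w * V w) 0)%:E = \int[P]_w (p (U w))%:E * \int[P]_w (p (V w))%:E
    + \int[P]_w (n (U w))%:E * \int[P]_w (n (V w))%:E)%E.
  rewrite -!e// -ge0_integralD//; first last.
  - exact: mh.
  - by move=> w _; rewrite lee_fin mulr_ge0.
  - exact: mh.
  - by move=> w _; rewrite lee_fin mulr_ge0.
  by apply: eq_integral => w _; rewrite pos EFinD.
have En : (\int[P]_w (Num.max (- (U w * V w)) 0)%:E = \int[P]_w (p (U w))%:E * \int[P]_w (n (V w))%:E
    + \int[P]_w (n (U w))%:E * \int[P]_w (p (V w))%:E)%E.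
  rewrite -!e// -ge0_integralD//; first last.
  - exact: mh.
  - by move=> w _; rewrite lee_fin mulr_ge0.
  - exact: mh.
  - by move=> w _; rewrite lee_fin mulr_ge0.
  by apply: eq_integral => w _; rewrite neg EFinD.
have fin : (\int[P]_w (Num.max (U w * V w) 0)%:E)%E \is a fin_num.
  have h := integral_fune_lt_pinfty measurableT (integrable_funepos measurableT iUV).
  rewrite ge0_fin_numE; last by apply: integral_ge0 => w _; rewrite lee_fin le_max lexx orbT.
  by apply: le_lt_trans h; rewrite le_eqVlt; apply/orP; left; apply/eqP;
    apply: eq_integral => w _; rewrite funeposE EFin_max.
rewrite integralE [X in (X - _)%E](_ : _ = \int[P]_w (Num.max (U w * V w) 0)%:E)%E; last first.
  by apply: eq_integral => w _; rewrite funeposE EFin_max.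
rewrite [X in (_ - X)%E](_ : _ = \int[P]_w (Num.max (- (U w * V w)) 0)%:E)%E; last first.
  by apply: eq_integral => w _; rewrite funenegE EFin_max.
rewrite (_ : \int[P]_w (Num.max (- (U w * V w)) 0)%:E = \int[P]_w (Num.max (U w * V w) 0)%:E)%E.
  by rewrite subee.
by rewrite Ep En -/(p _) V0.
Qed.

End independence.

(* Layer-cake decomposition of [h]. *)
Lemma law_integral d d' (Om : measurableType d) (T : measurableType d') (R : realType)
    (P : probability Om R) (mu : {sigma_finite_measure set T -> \bar R}) (X : Om -> T)
    (pdf h : T -> R) :
  measurable_fun setT X -> measurable_fun setT pdf -> (forall x, 0 <= pdf x) ->
  (forall B, measurable B -> P (X @^-1` B) = \int[mu]_(x in B) (pdf x)%:E)%E ->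
  measurable_fun setT h -> (forall x, 0 <= h x) ->
  (\int[P]_w (h (X w))%:E = \int[mu]_x (h x * pdf x)%:E)%E.
Proof.
move=> mX mpdf pdf0 lawX mh h0.
pose TR := measurableTypeR R.
pose ind (y u : R) : R := (0 <= y)%R%:R * (1 - (u <= y)%R%:R).
have indE y u : ind y u = ((0 <= y) && (y < u))%:R.
  by rewrite /ind ltNge; case: (0 <= y)%R; case: (u <= y)%R; rewrite /= ?mulr1n ?mulr0n ?mul0r ?mul1r ?subrr ?subr0.
have ind0 y u : 0 <= ind y u by rewrite indE.
have layer u : 0 <= u -> (\int[lm1 R]_y (ind y u)%:E = u%:E)%E.
  move=> u0; transitivity (\int[lm1 R]_y (\1_(`[0%R, u[%classic) y)%:E)%E.
    by apply: eq_integral => y _; rewrite indE indicE mem_setE in_itv.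
  have mI : measurable (`[0%R, u[%classic : set TR) by exact: measurable_itv.
  have e : (@lebesgue_measure R `[0%R, u[%classic = u%:E)%E.
    rewrite lebesgue_measure_itv /= lte_fin; case: ltgtP u0 => // [_|<-] _ //.
    by rewrite sube0.
  by apply: etrans (integral_indic (lm1 R) measurableT mI) _; rewrite setIT; exact: e.
have mind d2 (T2 : measurableType d2) (a b : T2 -> R) : measurable_fun setT a -> measurable_fun setT b ->
    measurable_fun setT (fun q => ind (a q) (b q)).
  by move=> ma mb; rewrite /ind; mt; apply: mt_le => //; mt.
have mhX : measurable_fun setT (fun w => h (X w)) by exact: measurableT_comp.
transitivity (\int[P]_w \int[lm1 R]_y (ind y (h (X w)))%:E)%E.
  by apply: eq_integral => w _; rewrite layer.
have m1 : measurable_fun setT (fun q : Om * TR => (ind q.2 (h (X q.1)))%:E).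
  by apply/measurable_EFinP; apply: mind; [exact: measurable_snd|exact: (measurableT_comp mhX measurable_fst)].
have m2 : measurable_fun setT (fun q : T * TR => (ind q.2 (h q.1) * pdf q.1)%:E).
  apply/measurable_EFinP; apply: mtM; last exact: (measurableT_comp mpdf measurable_fst).
  by apply: mind; [exact: measurable_snd|exact: (measurableT_comp mh measurable_fst)].
have g1 (q : Om * TR) : (0 <= (ind q.2 (h (X q.1)))%:E)%E by rewrite lee_fin.
have g2 (q : T * TR) : (0 <= (ind q.2 (h q.1) * pdf q.1)%:E)%E by rewrite lee_fin mulr_ge0.
have [e1 e2] := tonelli P (lm1 R) m1 g1.
have [e3 e4] := tonelli mu (lm1 R) m2 g2.
rewrite -[LHS]e1 e2.
transitivity (\int[mu]_x \int[lm1 R]_y (ind y (h x) * pdf x)%:E)%E; last first.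
  apply: eq_integral => x _.
  under eq_integral do rewrite EFinM.
  rewrite ge0_integralZr//; first by rewrite layer.
  - by apply/measurable_EFinP; apply: mind; [exact: measurable_id|exact: mt_cst].
  - by move=> y _; rewrite lee_fin.
  - by rewrite lee_fin.
rewrite -[RHS]e3 e4; apply: eq_integral => y _ /=.
have [y0|y0] := leP 0 y; last first.
  rewrite integral0_eq; last by move=> w _; rewrite indE leNgt y0.
  by rewrite integral0_eq// => x _; rewrite indE leNgt y0 mul0r.
have mB : measurable [set x | y < h x].
  rewrite -[X in measurable X]setTI (_ : [set x | _] = h @^-1` `]y, +oo[%classic).
    exact: mh.
  by apply/seteqP; split => x /=; rewrite in_itv /= andbT.
transitivity (P (X @^-1` [set x | y < h x])).
  rewrite -(setIT (_ @^-1` _)) -integral_indic//; last first.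
    by rewrite -[X in measurable X]setTI; exact: mX.
  apply: eq_integral => w _; rewrite indE y0 indicE; congr (_%:R)%:E.
  rewrite /=; case: (boolP (y < h (X w))) => yh; first by rewrite mem_set.
  by rewrite memNset//; exact/negP.
rewrite lawX// integral_mkcond; apply: eq_integral => x _.
rewrite /patch indE y0 /=; case: ifPn; rewrite ?inE ?notin_setE /=.
  by move=> ->; rewrite mul1r.
by move/negP/negbTE => ->; rewrite mul0r.
Qed.

(** * A maximal inequality of Rademacher-Menshov type *)

Lemma nneseries_geometric (R : realType) (c u : R) (f : nat -> \bar R) : 0 <= c -> 0 < u < 1 ->
  (forall j, 0 <= f j <= (c * u ^+ j)%:E)%E -> (\sum_(0 <= j <oo) f j < +oo)%E.
Proof.
move=> c0 /andP[u0 u1] fu; have v0 : 0 < 1 - u by rewrite subr_gt0.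
apply: (@le_lt_trans _ _ (c / (1 - u))%:E); last exact: ltry.
apply: lime_le; first by apply: is_cvg_nneseries => n _ _; have /andP[] := fu n.
near=> n; apply: (@le_trans _ _ (\sum_(0 <= j < n) c * u ^+ j)%:E).
  by rewrite -sumEFin; apply: lee_sum => j _; have /andP[] := fu j.
rewrite lee_fin ler_pdivlMr//.
have -> : (\sum_(0 <= j < n) c * u ^+ j) * (1 - u) = c * (1 - u ^+ n).
  elim: (n) => [|k ih]; first by rewrite big_geq// mul0r subrr mulr0.
  by rewrite big_nat_recr//= mulrDl ih exprS; ring.
by rewrite ler_piMr// gerBl exprn_ge0// ltW.
Unshelve. all: by end_near. Qed.

(** Each of the j + 1 terms u^i with i <= j of the geometric sum is at least u^j. This absorbs the
    logarithmic factor of the maximal inequality. *)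
Lemma succn_geometric_le (R : realType) (u : R) j : 0 < u < 1 ->
  j.+1%:R * u ^+ j <= (1 - u)^-1.
Proof.
move=> /andP[u0 u1]; have v0 : 0 < 1 - u by rewrite subr_gt0.
rewrite -(ler_pM2r v0) mulVf ?gt_eqF//.
suff : j.+1%:R * u ^+ j * (1 - u) <= 1 - u ^+ j.+1.
  by move/le_trans; apply; rewrite gerBl exprn_ge0// ltW.
elim: j => [|j ih]; first by rewrite mul1r expr0 expr1 mul1r.
have p0 : 0 <= u ^+ j.+1 by rewrite exprn_ge0// ltW.
have p1 : u ^+ j.+1 <= 1 by rewrite exprn_ile1// ltW.
have h : u * (j.+1%:R * u ^+ j * (1 - u)) <= u * (1 - u ^+ j.+1) by rewrite ler_pM2l.
rewrite -natr1 mulrDl mul1r mulrDl (_ : j.+1%:R * u ^+ j.+1 * (1 - u) = u * (j.+1%:R * u ^+ j * (1 - u))); last first.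
  by rewrite exprS; ring.
rewrite [u ^+ j.+2]exprS; move: (u ^+ j.+1) p0 p1 h => w p0 p1 h.
nra.
Qed.

Section dyadic_control.
Variables (R : realType) (x e : nat -> R).
Hypothesis e0 : forall j, 0 <= e j.
Hypothesis xe : forall j n, (n <= 2 ^ j)%N -> `|\sum_(i < n) x (2 ^ j + i)%N| <= e j.

Let tail_bound j k n : (n <= 2 ^ (j + k))%N ->
  `|series x (2 ^ (j + k) + n)%N - series x (2 ^ j)%N| <= \sum_(j <= i < (j + k).+1) e i.
Proof.
have step m l : series x (m + l)%N - series x m = \sum_(i < l) x (m + i)%N.
  rewrite /series /= (@big_cat_nat _ _ _ m 0 (m + l))//= ?leq_addr//.
  rewrite addrAC subrr add0r -{1}(add0n m) big_addn addKn big_mkord.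
  by apply: eq_bigr => i _; rewrite addnC.
elim: k n => [|k ih] n.
  by rewrite addn0 => nj; rewrite step big_nat1 xe.
rewrite addnS => nk.
rewrite big_nat_recr/=; last by rewrite -addnS leq_addr.
have := ih _ (leqnn _); rewrite addnn -mul2n -expnS => ih'.
rewrite (_ : series x _ - series x _ = (series x (2 ^ (j + k).+1 + n)%N - series x (2 ^ (j + k).+1)%N)
  + (series x (2 ^ (j + k).+1)%N - series x (2 ^ j)%N)); last by ring.
rewrite addrC; apply: (le_trans (ler_normD _ _)); rewrite lerD// step.
exact: xe.
Qed.

Hypothesis eoo : (\sum_(0 <= j <oo) (e j)%:E < +oo)%E.

Let log_split N : (0 < N)%N -> exists j n, N = (2 ^ j + n)%N /\ (n < 2 ^ j)%N.
Proof.
move=> N0; exists (trunc_log 2 N), (N - 2 ^ trunc_log 2 N)%N.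
have h1 := trunc_logP (isT : (1 < 2)%N) N0.
have h2 := trunc_log_ltn N (isT : (1 < 2)%N).
split; first by rewrite subnKC.
by rewrite ltn_subLR// addnn -mul2n -expnS.
Qed.

Let e0' j : (0 <= (e j)%:E)%E. Proof. by rewrite lee_fin. Qed.

(** Any N > 0 is 2^j + n with n < 2^j, so a partial sum consists of full dyadic blocks and one
    partial block, each bounded by its [e i]. The term [x 0] precedes the first block and is counted
    apart. *)
Lemma dyadic_series_bound N :
  (`|series x N|%:E <= `|x 0%N|%:E + \sum_(0 <= j <oo) (e j)%:E)%E.
Proof.
have S0 : (0 <= \sum_(0 <= j <oo) (e j)%:E)%E by apply: nneseries_ge0.
have [->|N0] := posnP N.
  by rewrite /series /= big_geq// normr0 adde_ge0// lee_fin.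
have [j [n [-> nj]]] := log_split N0.
have h := @tail_bound 0 j n (ltnW nj).
apply: (@le_trans _ _ (`|x 0%N|%:E + (\sum_(0 <= i < j.+1) e i)%:E)%E).
  rewrite -EFinD lee_fin -[series x _](subrK (series x (2 ^ 0)%N)) addrC.
  rewrite (le_trans (ler_normD _ _))// lerD//.
  by rewrite /series /= expn0 big_nat1.
by rewrite leeD2l// -sumEFin nneseries_lim_ge.
Qed.

(** Beyond 2^j all partial sums stay within the tail of [e] from [j] on, so they form a Cauchy
    sequence. *)
Lemma dyadic_series_cvg : cvgn (series x).
Proof.
apply: cauchy_cvg; apply: cauchy_exP => eps eps0.
have := nneseries_tail_cvg eoo (fun k _ => e0' k).
move=> /fine_cvgP[_ /cvgrPdist_lt/(_ _ eps0)[j _ /(_ j (leqnn j))]] /=.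
rewrite sub0r normrN => hj.
have toofin : (\sum_(j <= k <oo) (e k)%:E)%E \is a fin_num.
  rewrite ge0_fin_numE ?nneseries_ge0//; apply: le_lt_trans eoo.
  rewrite [leRHS](@nneseries_split _ _ 0%N j)// add0n leeDr// sume_ge0//.
exists (series x (2 ^ j)%N); near=> N.
have jN : (2 ^ j <= N)%N by near: N; exact: nbhs_infty_ge.
have N0 : (0 < N)%N by rewrite (leq_trans _ jN)// expn_gt0.
have [l [n [NE nl]]] := log_split N0.
have jl : (j <= l)%N.
  rewrite leqNgt; apply/negP => lj.
  have : (2 ^ l.+1 <= 2 ^ j)%N by rewrite leq_exp2l.
  rewrite leqNgt (leq_ltn_trans jN)// NE expnS mul2n -addnn ltn_add2l//.
have := @tail_bound j (l - j) n; rewrite subnKC// => /(_ (ltnW nl)) hN.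
rewrite /= -ball_normE /ball_ /= distrC NE; apply: le_lt_trans hj.
apply: le_trans (ler_norm _); rewrite -lee_fin fineK//.
rewrite (le_trans _ (nneseries_lim_ge l.+1 (fun i _ _ => e0' i)))// sumEFin lee_fin.
exact: hN.
Unshelve. all: by end_near. Qed.

End dyadic_control.

Section menshov.
Context d (Y : measurableType d) (R : realType) (nu : {measure set Y -> \bar R}).
Variables (D : set Y) (X : nat -> Y -> R) (b : nat -> R).
Hypothesis mD : measurable D.
Hypothesis mX : forall k, measurable_fun setT (X k).
Hypothesis Xb : forall k, (\int[nu]_(y in D) (X k y ^+ 2)%:E <= (b k)%:E)%E.
Hypothesis Xorth : forall j k, (j < k)%N -> (\int[nu]_(y in D) (X j y * X k y)%:E = 0)%E.

Let T m n y := \sum_(i < n) X (m + i)%N y.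

Let mT m n : measurable_fun setT (T m n).
Proof. by apply: measurable_sum. Qed.

Let sqi (f : Y -> R) := nu.-integrable D (fun y => (f y ^+ 2)%:E).

Let sqiX k : sqi (X k).
Proof.
apply/integrableP; split.
  by apply/measurable_EFinP; apply: measurable_funTS; apply: mtX.
apply: le_lt_trans (ltry (b k)); apply: le_trans (Xb k).
by apply: ge0_le_integral => //; [apply/measurable_EFinP; apply: measurable_funTS; mt|
  apply/measurable_EFinP; apply: measurable_funTS; mt|
  move=> y _; rewrite /= lee_fin ger0_norm ?sqr_ge0].
Qed.

Let sqi_mul f g : measurable_fun setT f -> measurable_fun setT g -> sqi f -> sqi g ->
  nu.-integrable D (fun y => (f y * g y)%:E).
Proof.
move=> mf mg sf sg.
apply: (le_integrable mD _ _ (integrableD mD sf sg)).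
  by apply/measurable_EFinP; apply: measurable_funTS; mt.
move=> y _; rewrite /= lee_fin [leRHS]ger0_norm ?addr_ge0 ?sqr_ge0// ler_norml.
by apply/andP; split; nra.
Qed.

(** Induction on the length. The cross term vanishes because a block sum stays orthogonal to every
    later term, which is why that clause is carried along. *)
Let block m n : [/\ sqi (T m n),
   forall k, (m + n <= k)%N -> (\int[nu]_(y in D) (T m n y * X k y)%:E = 0)%E &
   (\int[nu]_(y in D) (T m n y ^+ 2)%:E <= (\sum_(i < n) b (m + i)%N)%:E)%E].
Proof.
elim: n => [|n [s1 s2 s3]].
  have T0 : T m 0 = cst 0 by apply/funext => y; rewrite /T big_ord0.
  split.
  - rewrite /sqi T0 (_ : (fun y => _) = cst 0%E); first exact: integrable0.
    by apply/funext => y; rewrite /= expr0n.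
  - by move=> k _; rewrite T0 integral0_eq// => y _; rewrite mul0r.
  - by rewrite T0 big_ord0 integral0_eq// => y _; rewrite /= expr0n.
have TS y : T m n.+1 y = T m n y + X (m + n)%N y by rewrite /T big_ord_recr.
have i1 := sqi_mul (@mT m n) (mX (m + n)) s1 (sqiX (m + n)).
have i2 : nu.-integrable D (fun y => (2 * (T m n y * X (m + n)%N y))%:E).
  by have := integrableZl mD 2 i1.
have i3 : nu.-integrable D (fun y => (T m n y ^+ 2 + 2 * (T m n y * X (m + n)%N y))%:E).
  by have := integrableD mD s1 i2.
have sE y : T m n.+1 y ^+ 2 = T m n y ^+ 2 + 2 * (T m n y * X (m + n)%N y) + X (m + n)%N y ^+ 2.
  by rewrite TS; ring.
split.
- rewrite /sqi; under [X in integrable _ _ X]funext do rewrite sE.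
  by have := integrableD mD i3 (sqiX (m + n)).
- move=> k; rewrite addnS => mk.
  transitivity (\int[nu]_(y in D) ((T m n y * X k y)%:E + (X (m + n)%N y * X k y)%:E))%E.
    by apply: eq_integral => y _; rewrite TS mulrDl EFinD.
  rewrite integralD//; first by rewrite s2 ?(ltnW mk)// Xorth// adde0.
  + exact: sqi_mul.
  + exact: sqi_mul.
- rewrite big_ord_recr /= EFinD.
  apply: (@le_trans _ _ (\int[nu]_(y in D) (T m n y ^+ 2)%:E + \int[nu]_(y in D) (X (m + n)%N y ^+ 2)%:E)%E).
    under eq_integral do rewrite sE.
    rewrite integralD_EFin//; last exact: sqiX.
    rewrite integralD_EFin//.
    rewrite (_ : (\int[nu]_(y in D) (2 * _)%:E)%E = 0%E) ?adde0//.
    under eq_integral do rewrite EFinM.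
    by rewrite integralZl// s2// mule0.
  by rewrite leeD.
Qed.

(* Splitting a block of [2 ^ l] terms into halves: [maximal m l] dominates the
   squares of all partial sums started at [m], and for orthogonal terms its
   integral is at most [(l + 1) ^ 2] times the sum of their second moments. *)
Fixpoint maximal (m l : nat) (y : Y) : R :=
  if l is l'.+1 then
    l'.+2%:R * T m (2 ^ l') y ^+ 2 +
    l'.+2%:R / l'.+1%:R * (maximal m l' y + maximal (m + 2 ^ l') l' y)
  else X m y ^+ 2.

Lemma maximal_ge0 m l y : 0 <= maximal m l y.
Proof.
elim: l m => [|l ih] m /=; first exact: sqr_ge0.
have h : 0 <= maximal m l y + maximal (m + 2 ^ l) l y by rewrite addr_ge0.
by apply: addr_ge0; apply: mulr_ge0 => //; rewrite ?sqr_ge0// divr_ge0.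
Qed.

Lemma measurable_maximal m l : measurable_fun setT (maximal m l).
Proof.
elim: l m => [|l ih] m /=; first exact: mtX.
mt; [exact: mT|exact: ih|exact: ih].
Qed.

(* [(u + v) ^+ 2 <= (1 + c) * u ^+ 2 + (1 + c^-1) * v ^+ 2] with [c = l + 1] *)
Lemma block_le_maximal m l n y : (n <= 2 ^ l)%N -> T m n y ^+ 2 <= maximal m l y.
Proof.
elim: l m n => [|l ih] m n.
  case: n => [|[|//]] _; first by rewrite /T big_ord0 expr0n /= sqr_ge0.
  by rewrite /T big_ord1 addn0.
rewrite expnS mul2n -addnn => nl /=.
have c1 : 1 <= l.+2%:R / l.+1%:R :> R by rewrite ler_pdivlMr ?ltr0n// mul1r ler_nat.
have [nl'|nl'] := leqP n (2 ^ l).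
  apply: le_trans (ih m n nl') _.
  rewrite (@le_trans _ _ (maximal m l y + maximal (m + 2 ^ l) l y))//.
    by rewrite lerDl maximal_ge0.
  rewrite (@le_trans _ _ (l.+2%:R / l.+1%:R * (maximal m l y + maximal (m + 2 ^ l) l y)))//.
    by rewrite ler_peMl// addr_ge0 ?maximal_ge0.
  by rewrite lerDr mulr_ge0// sqr_ge0.
have -> : T m n y = T m (2 ^ l) y + T (m + 2 ^ l) (n - 2 ^ l) y.
  transitivity (T m (2 ^ l + (n - 2 ^ l)) y); first by rewrite subnKC// ltnW.
  rewrite /T big_split_ord /=; congr (_ + _).
  by apply: eq_bigr => i _; rewrite addnA.
have h : T (m + 2 ^ l) (n - 2 ^ l) y ^+ 2 <= maximal (m + 2 ^ l) l y.
  by apply: ih; rewrite leq_subLR.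
have c0 : 0 <= l.+2%:R / l.+1%:R :> R := le_trans ler01 c1.
apply: (@le_trans _ _ (l.+2%:R * T m (2 ^ l) y ^+ 2 +
    l.+2%:R / l.+1%:R * T (m + 2 ^ l) (n - 2 ^ l) y ^+ 2)); last first.
  by rewrite lerD2l ler_wpM2l// (le_trans h)// lerDr maximal_ge0.
have -> : l.+2%:R = l.+1%:R + 1 :> R by rewrite natr1.
have : (0 : R) < l.+1%:R by rewrite ltr0n.
move: (l.+1%:R : R) (T m (2 ^ l) y) (T (m + 2 ^ l) (n - 2 ^ l) y) => c u v c0'.
rewrite -subr_ge0 (_ : _ - _ = (c * u - v) ^+ 2 / c); last by field; rewrite gt_eqF.
by rewrite divr_ge0 ?sqr_ge0 ?ltW.
Qed.

(** The weights in [maximal] are tuned to this recursion: (l+2) + (l+2)/(l+1) * (l+1)^2 =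
    (l+2)^2. *)
Lemma integral_maximal m l :
  (\int[nu]_(y in D) (maximal m l y)%:E <= (l.+1%:R ^+ 2 * \sum_(i < 2 ^ l) b (m + i)%N)%:E)%E.
Proof.
have b0 k : 0 <= b k.
  by rewrite -lee_fin (le_trans _ (Xb k))// integral_ge0// => y _; rewrite lee_fin sqr_ge0.
elim: l m => [|l ih] m.
  by rewrite expr1n mul1r big_ord1 addn0; exact: Xb.
have mm n : measurable_fun D (fun y => (maximal n l y)%:E).
  by apply/measurable_EFinP; apply: measurable_funTS; exact: measurable_maximal.
have mTT : measurable_fun D (fun y => (T m (2 ^ l) y ^+ 2)%:E).
  by apply/measurable_EFinP; apply: measurable_funTS; apply: mtX.
have c0 : 0 <= l.+2%:R / l.+1%:R :> R by rewrite divr_ge0.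
have -> : (\int[nu]_(y in D) (maximal m l.+1 y)%:E =
  l.+2%:R%:E * \int[nu]_(y in D) (T m (2 ^ l) y ^+ 2)%:E + (l.+2%:R / l.+1%:R)%:E *
   (\int[nu]_(y in D) (maximal m l y)%:E + \int[nu]_(y in D) (maximal (m + 2 ^ l) l y)%:E))%E.
  transitivity (\int[nu]_(y in D) (l.+2%:R%:E * (T m (2 ^ l) y ^+ 2)%:E +
     (l.+2%:R / l.+1%:R)%:E * ((maximal m l y)%:E + (maximal (m + 2 ^ l) l y)%:E)))%E.
    exact: eq_integral.
  have p1 y : (0 <= (maximal m l y)%:E)%E by rewrite lee_fin maximal_ge0.
  have p2 y : (0 <= (maximal (m + 2 ^ l) l y)%:E)%E by rewrite lee_fin maximal_ge0.
  have p3 y : (0 <= (T m (2 ^ l) y ^+ 2)%:E)%E by rewrite lee_fin sqr_ge0.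
  have m12 := emeasurable_funD (mm m) (mm (m + 2 ^ l)%N).
  rewrite ge0_integralD//; first last.
  - exact: emeasurable_funM.
  - by move=> y _; apply: mule_ge0; [rewrite lee_fin|exact: adde_ge0].
  - exact: emeasurable_funM.
  - by move=> y _; apply: mule_ge0 => //; rewrite lee_fin.
  rewrite ge0_integralZl ?lee_fin//; congr (_ + _)%E.
  rewrite ge0_integralZl ?lee_fin//; last by move=> y _; rewrite adde_ge0.
  by rewrite ge0_integralD.
have [_ _ h3] := block m (2 ^ l).
set s1 := \sum_(i < 2 ^ l) b (m + i)%N in h3.
set s2 := \sum_(i < 2 ^ l) b (m + 2 ^ l + i)%N.
have -> : \sum_(i < 2 ^ l.+1) b (m + i)%N = s1 + s2.
  rewrite expnS mul2n -addnn big_split_ord /=; congr (_ + _).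
  by apply: eq_bigr => i _; rewrite addnA.
have s20 : 0 <= s2 by apply: sumr_ge0.
have n0 : 0 <= l.+2%:R :> R by [].
apply: (@le_trans _ _ ((l.+2%:R)%:E * s1%:E + (l.+2%:R / l.+1%:R)%:E *
    ((l.+1%:R ^+ 2 * s1)%:E + (l.+1%:R ^+ 2 * s2)%:E))%E).
  by apply: leeD; apply: lee_wpmul2l; rewrite ?lee_fin//; apply: leeD; exact: ih.
suff : l.+2%:R * s1 + l.+2%:R / l.+1%:R * (l.+1%:R ^+ 2 * s1 + l.+1%:R ^+ 2 * s2) <= l.+2%:R ^+ 2 * (s1 + s2).
  by rewrite -lee_fin.
have -> : l.+2%:R / l.+1%:R * (l.+1%:R ^+ 2 * s1 + l.+1%:R ^+ 2 * s2) = l.+2%:R * (l.+1%:R * (s1 + s2)) :> R.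
  have : l.+1%:R != 0 :> R by rewrite pnatr_eq0.
  by move: (l.+1%:R : R) (l.+2%:R : R) => c c' cn0; field.
rewrite -mulrDr expr2 -mulrA ler_wpM2l// -[l.+2%:R]natr1 mulrDl mul1r addrC lerD2l lerDl//.
Qed.

(** The decay u^(4j) of a block is spent in three places: u^j pays for the division by u^j in the
    majorant, u^(2j) absorbs (j+1)^2, and the last u^j makes the sum over blocks converge. *)
Lemma menshov (u K : R) : (nu D < +oo)%E -> 0 < u < 1 -> 0 <= K ->
  (forall j i, (i < 2 ^ j)%N -> (2 ^ j)%:R * b (2 ^ j + i)%N <= K * u ^+ (4 * j)) ->
  exists H : Y -> \bar R, [/\ measurable_fun setT H, forall y, (0 <= H y)%E,
    (\int[nu]_(y in D) H y < +oo)%E &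
    forall y, (H y < +oo)%E -> cvgn (series (X^~ y)) /\
      forall N, (`|series (X^~ y) N|%:E <= H y)%E].
Proof.
move=> nuD /andP[u0 u1] K0 bK.
have b0 k : 0 <= b k.
  by rewrite -lee_fin (le_trans _ (Xb k))// integral_ge0// => y _; rewrite lee_fin sqr_ge0.
(* As (v + M / v)^2 >= M, this dominates the square root of [maximal] while staying linear in it, so
   second moments suffice to integrate it; the scale u^j makes both terms summable. *)
pose e j y := u ^+ j + maximal (2 ^ j) j y / u ^+ j.
have uj j : 0 < u ^+ j by rewrite exprn_gt0.
have e0 j y : 0 <= e j y by rewrite addr_ge0 ?divr_ge0 ?maximal_ge0 ?(ltW (uj _)).
have me j : measurable_fun setT (fun y => (e j y)%:E).
  by apply/measurable_EFinP; rewrite /e; mt; exact: measurable_maximal.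
have xe y j n : (n <= 2 ^ j)%N -> `|\sum_(i < n) X (2 ^ j + i)%N y| <= e j y.
  move=> nj; rewrite -ler_sqr ?nnegrE ?e0// real_normK ?num_real//.
  apply: le_trans (block_le_maximal (2 ^ j) y nj) _.
  rewrite /e; have M0 := maximal_ge0 (2 ^ j) j y; have := uj j.
  move: (maximal _ _ _) (u ^+ j) M0 => M v M0 v0.
  rewrite (_ : (v + M / v) ^+ 2 = M + (v ^+ 2 + M + (M / v) ^+ 2)); last by field; rewrite gt_eqF.
  by rewrite lerDl !addr_ge0 ?sqr_ge0.
(* The summand 1 + X_0^2 dominates |X_0|, which lies outside the dyadic blocks. *)
pose H y := ((1 + X 0%N y ^+ 2)%:E + \sum_(0 <= j <oo) (e j y)%:E)%E.
have S0 y : (0 <= \sum_(0 <= j <oo) (e j y)%:E)%E by apply: nneseries_ge0 => j _ _; rewrite lee_fin.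
have m0 : measurable_fun setT (fun y => (1 + X 0%N y ^+ 2)%:E).
  by apply/measurable_EFinP; mt.
have mS : measurable_fun setT (fun y => \sum_(0 <= j <oo) (e j y)%:E)%E.
  by apply: ge0_emeasurable_sum => // j y _ _; rewrite lee_fin.
exists H; split.
- exact: emeasurable_funD.
- by move=> y; rewrite adde_ge0// lee_fin addr_ge0 ?sqr_ge0.
- rewrite ge0_integralD//; first last.
  + exact: measurable_funTS.
  + exact: measurable_funTS.
  + by move=> y _; rewrite lee_fin addr_ge0 ?sqr_ge0.
  apply: lte_add_pinfty.
    under eq_integral do rewrite EFinD.
    rewrite ge0_integralD//; first last.
    * by apply: measurable_funTS; apply/measurable_EFinP; mt.
    * by move=> y _; rewrite lee_fin sqr_ge0.
    apply: lte_add_pinfty; first by rewrite integral_cst// mul1e.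
    by rewrite (le_lt_trans (Xb 0%N)) ?ltry.
  rewrite integral_nneseries//; first last.
  + by move=> n y _; rewrite lee_fin.
  + by move=> n; exact: measurable_funTS.
  pose C := fine (nu D) + K * (1 - u)^-1 ^+ 2.
  have fD : nu D \is a fin_num by rewrite ge0_fin_numE.
  have C0 : 0 <= C by rewrite addr_ge0 ?fine_ge0// mulr_ge0// sqr_ge0.
  apply: (@nneseries_geometric _ C u) => //; first by rewrite u0.
  move=> j; apply/andP; split; first by apply: integral_ge0 => y _; rewrite lee_fin.
  have mm : measurable_fun D (fun y => (maximal (2 ^ j) j y)%:E).
    by apply/measurable_EFinP; apply: measurable_funTS; exact: measurable_maximal.
  have M0 y : (0 <= (maximal (2 ^ j) j y)%:E)%E by rewrite lee_fin maximal_ge0.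
  have -> : (\int[nu]_(y in D) (e j y)%:E = (u ^+ j)%:E * nu D +
      ((u ^+ j)^-1)%:E * \int[nu]_(y in D) (maximal (2 ^ j) j y)%:E)%E.
    transitivity (\int[nu]_(y in D) ((u ^+ j)%:E + ((u ^+ j)^-1)%:E * (maximal (2 ^ j) j y)%:E))%E.
      by apply: eq_integral => y _; rewrite -EFinM -EFinD mulrC.
    rewrite ge0_integralD//; first last.
    - exact: emeasurable_funM.
    - by move=> y _; apply: mule_ge0 => //; rewrite lee_fin invr_ge0 ltW.
    - by move=> y _; rewrite lee_fin ltW.
    rewrite integral_cst//; congr (_ + _)%E.
    by rewrite ge0_integralZl// lee_fin invr_ge0 ltW.
  have sb : \sum_(i < 2 ^ j) b (2 ^ j + i)%N <= K * u ^+ (4 * j).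
    have p0 : (0 : R) < (2 ^ j)%:R by rewrite ltr0n expn_gt0.
    rewrite -(ler_pM2l p0); apply: (@le_trans _ _ (\sum_(i < 2 ^ j) K * u ^+ (4 * j))).
      by rewrite mulr_sumr; apply: ler_sum => i _; exact: bK.
    by rewrite sumr_const card_ord mulr_natl.
  apply: (@le_trans _ _ ((u ^+ j)%:E * nu D + ((u ^+ j)^-1)%:E * (j.+1%:R ^+ 2 * (K * u ^+ (4 * j)))%:E)%E).
    apply: leeD => //; apply: lee_wpmul2l; first by rewrite lee_fin invr_ge0 ltW.
    apply: le_trans (integral_maximal _ _) _; rewrite lee_fin ler_wpM2l ?sqr_ge0//.
  rewrite -(fineK fD) -!EFinM -EFinD lee_fin /C mulrDl [_ * fine _]mulrC lerD2l.
  have -> : (u ^+ j)^-1 * (j.+1%:R ^+ 2 * (K * u ^+ (4 * j))) = K * (j.+1%:R * u ^+ j) ^+ 2 * u ^+ j.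
    by rewrite (_ : 4 * j = j + j + j + j)%N ?exprD; [field; rewrite gt_eqF|lia].
  rewrite ler_pM2r// ler_wpM2l// ler_sqr ?nnegrE; first by apply: succn_geometric_le; rewrite u0.
  + by rewrite mulr_ge0// ltW.
  + by rewrite invr_ge0 subr_ge0 ltW.
- move=> y Hy.
  have eoo : (\sum_(0 <= j <oo) (e j y)%:E < +oo)%E.
    by apply: le_lt_trans Hy; rewrite leeDr// lee_fin addr_ge0 ?sqr_ge0.
  split; first exact: (dyadic_series_cvg (e0^~ y) (xe y) eoo).
  move=> N; apply: le_trans (dyadic_series_bound (e0^~ y) (xe y) N) _.
  rewrite /H leeD2r// lee_fin; have := sqr_ge0 (`|X 0%N y| - 1).
  by rewrite sqrrB1 real_normK ?num_real//; have := sqr_ge0 (X 0%N y); lra.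
Qed.

End menshov.

(** * The LePage model *)

(** Cauchy condensation: 2^j terms, each at most 2^(-jq), weigh at most 2^(j(1-q)). *)
Lemma dyadic_powR (R : realType) (q : R) j i : 0 <= q ->
  (2 ^ j)%:R * (2 ^ j + i).+1%:R `^ (- q) <= (2 `^ (1 - q)) ^+ j :> R.
Proof.
move=> q0; have p0 : (0 : R) < (2 ^ j)%:R by rewrite ltr0n expn_gt0.
apply: (@le_trans _ _ ((2 ^ j)%:R * (2 ^ j)%:R `^ (- q))).
  rewrite ler_wpM2l ?(ltW p0)// !powRN lef_pV2 ?posrE ?powR_gt0 ?ltr0n ?expn_gt0//.
  by rewrite ge0_ler_powR ?nnegrE ?ler_nat// -addnS leq_addr.
rewrite powRD ?pnatr_eq0 ?implybT// powRr1// exprMn -natrX ler_wpM2l//.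
by rewrite natrX -!powR_mulrn ?powR_ge0// powRAC.
Qed.

Lemma powR2_lt1 (R : realType) (q : R) : 0 < q -> (0 : R) < 2 `^ (- q) < 1.
Proof.
move=> q0; rewrite powR_gt0//= powRN invf_lt1 ?powR_gt0//.
by have := gt0_ltr_powR q0 (x := 1) (y := 2); rewrite !nnegrE powR1 => -> //; rewrite ltr1n.
Qed.

Lemma nneseries_powR (R : realType) (q : R) : 1 < q ->
  (\sum_(0 <= k <oo) (k.+1%:R `^ (- q))%:E < +oo :> \bar R)%E.
Proof.
move=> q1; have q0 : 0 <= q by lra.
have v01 : (0 : R) < 2 `^ (1 - q) < 1 by rewrite -opprB powR2_lt1// subr_gt0.
have /andP[v0 v1] := v01.
pose x k : R := k.+1%:R `^ (- q).
pose e j : R := (2 `^ (1 - q)) ^+ j.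
have e0 j : 0 <= e j by rewrite exprn_ge0// ltW.
have xe j n : (n <= 2 ^ j)%N -> `|\sum_(i < n) x (2 ^ j + i)%N| <= e j.
  move=> nj; rewrite ger0_norm ?sumr_ge0// => [|i _]; last exact: powR_ge0.
  have p0 : (0 : R) < (2 ^ j)%:R by rewrite ltr0n expn_gt0.
  rewrite -(ler_pM2l p0) mulr_sumr.
  apply: (@le_trans _ _ (\sum_(i < n) e j)).
    by apply: ler_sum => i _; exact: dyadic_powR.
  by rewrite sumr_const card_ord -[leLHS]mulr_natl ler_wpM2r ?e0// ler_nat.
have eoo : (\sum_(0 <= j <oo) (e j)%:E < +oo)%E.
  apply: (@nneseries_geometric _ 1 (2 `^ (1 - q))) => // j.
  by rewrite mul1r lexx andbT lee_fin.
have x0 k : 0 <= x k by exact: powR_ge0.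
apply: (@le_lt_trans _ _ (`|x 0%N|%:E + \sum_(0 <= j <oo) (e j)%:E)%E); last first.
  by apply: lte_add_pinfty => //; exact: ltry.
apply: lime_le; first by apply: is_cvg_nneseries => n _ _; rewrite lee_fin.
near=> n; rewrite sumEFin; apply: le_trans (dyadic_series_bound e0 xe n).
by rewrite lee_fin ler_norm.
Unshelve. all: by end_near. Qed.

(** Taking logarithms gives gam k >= (k+1) ln (3/2) - ln S. From some index on, half of this linear
    growth survives; the finitely many earlier terms are added to the constant. The constant is a
    natural number so that only countably many truncation levels arise. *)
Lemma powR_le_of_exp_growth (R : realType) (gam : nat -> R) (S p : R) : 0 < p ->
  (forall k, (3 / 2) ^+ k.+1 * expR (- gam k) <= S) ->
  exists m : nat, forall k, gam k `^ (- p) <= m%:R * k.+1%:R `^ (- p).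
Proof.
move=> p0 gS.
have q0 : (0 : R) < 3 / 2 by lra.
have S0 : 0 < S by apply: lt_le_trans (gS 0%N); rewrite mulr_gt0 ?expR_gt0 ?exprn_gt0.
pose l : R := ln (3 / 2).
have l0 : 0 < l by rewrite ln_gt0; lra.
have gl k : k.+1%:R * l - ln S <= gam k.
  have : ln ((3 / 2) ^+ k.+1 * expR (- gam k)) <= ln S.
    by rewrite ler_ln ?posrE ?mulr_gt0 ?expR_gt0 ?exprn_gt0.
  by rewrite lnM ?posrE ?expR_gt0 ?exprn_gt0// lnXn// expRK -[ln _ *+ _]mulr_natl -/l; lra.
have [K hK] : exists K : nat, forall k, (K <= k)%N -> ln S <= k.+1%:R * l / 2.
  exists (Num.truncn (`|ln S| / (l / 2))).+1 => k Kk.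
  rewrite (le_trans (ler_norm _))// -mulrA -ler_pdivrMr ?divr_gt0//.
  rewrite (le_trans (ltW (truncnS_gt _)))// ler_nat; exact: leqW.
pose w k : R := gam k `^ (- p) * k.+1%:R `^ p.
have w0 k : 0 <= w k by rewrite mulr_ge0 ?powR_ge0.
pose M := (l / 2) `^ (- p) + \sum_(i < K) w i.
have M0 : 0 <= M by rewrite addr_ge0 ?powR_ge0 ?sumr_ge0.
exists (Num.truncn M).+1 => k.
have kp : (0 : R) < k.+1%:R `^ p by rewrite powR_gt0// ltr0n.
rewrite powRN (_ : k.+1%:R `^ (- p) = (k.+1%:R `^ p)^-1) ?powRN//.
rewrite ler_pdivlMr// -powRN -/(w k).
apply: le_trans (ltW (truncnS_gt M)).
have [kK|Kk] := ltnP k K.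
  rewrite /M (bigD1 (Ordinal kK))//= addrCA lerDl addr_ge0 ?powR_ge0//.
  by apply: sumr_ge0.
apply: (@le_trans _ _ ((l / 2) `^ (- p))); last by rewrite lerDl sumr_ge0.
have h : k.+1%:R * (l / 2) <= gam k by have := gl k; have := hK k Kk; lra.
have kl : 0 < k.+1%:R * (l / 2) by rewrite mulr_gt0 ?ltr0n ?divr_gt0.
rewrite /w !powRN ler_pdivrMl ?powR_gt0 ?(lt_le_trans kl)//.
rewrite ler_pdivlMr ?powR_gt0 ?divr_gt0// -powRM ?divr_ge0 ?(ltW l0)//.
by rewrite ge0_ler_powR ?nnegrE ?(ltW p0) ?(ltW kl)// (le_trans (ltW kl)).
Qed.

Lemma integral_oppr (R : realType) (f : R -> R) : continuous f -> (forall x, 0 <= f x) ->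
  (\int[lebesgue_measure]_x (f (- x))%:E = \int[lebesgue_measure]_x (f x)%:E)%E.
Proof.
move=> cf f0.
have split_int (h : R -> R) : continuous h -> (forall x, 0 <= h x) ->
  (\int[lebesgue_measure]_x (h x)%:E = \int[lebesgue_measure]_(x in `[0%R, +oo[) (h x)%:E +
     \int[lebesgue_measure]_(x in `[0%R, +oo[) (h (- x))%:E)%E.
  move=> ch h0; have mh := continuous_measurable_fun ch.
  rewrite -(setUv (`[0, +oo[%classic : set R)) ge0_integral_setU//= ; last 4 first.
  - exact: measurableC.
  - by apply/measurable_EFinP; rewrite setUv.
  - by move=> x _; rewrite lee_fin.
  - exact/disj_setPCl.
  congr (_ + _)%E.
  rewrite setCitvr integral_itv_bndo_bndc; last exact/measurable_EFinP/measurable_funTS.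
  rewrite -{1}oppr0 ge0_integration_by_substitutionNy//.
  exact: continuous_subspaceT.
rewrite (split_int f)// (split_int (fun x => f (- x)))//; last exact: (ct_comp cf (ctN (@ct_id R))).
by rewrite addeC; congr (_ + _)%E; apply: eq_integral => x _; rewrite opprK.
Qed.

(** * Exponential and Gaussian laws *)

Lemma exponential_laplace (R : realType) d (Om : measurableType d) (P : probability Om R)
    (X : Om -> R) : measurable_fun setT X ->
  (forall B : set R, measurable B -> P (X @^-1` B) = exponential_prob 1 B) ->
  (\int[P]_w (expR (- X w))%:E = (2^-1)%:E)%E.
Proof.
move=> mX lawX.
have mpdf (r : R) : measurable_fun setT (fun x : measurableTypeR R => exponential_pdf r x).
  exact: measurable_exponential_pdf.
have mh : measurable_fun setT (fun x : measurableTypeR R => expR (- x)).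
  by apply: (@mt_comp _ _ _ expR); [exact: measurable_expR|mt].
have e := @law_integral _ _ _ (measurableTypeR R) R P (lm1 R) X (exponential_pdf 1) (fun x => expR (- x))
  mX (mpdf 1) (exponential_pdf_ge0 ler01) lawX mh (fun x => expR_ge0 _).
apply: etrans e _.
transitivity (\int[lm1 R]_x ((2^-1)%:E * (exponential_pdf 2 x)%:E))%E.
  apply: eq_integral => x _; rewrite -EFinM; congr EFin.
  have [x0|x0] := leP 0 x; last by rewrite !lt0_exponential_pdf// !mulr0.
  rewrite !exponential_pdfE// mul1r -expRD mulrA mulVf// mul1r; congr expR; ring.
rewrite ge0_integralZl//.
- by rewrite (_ : (\int[lm1 R]_x _)%E = 1%E) ?mule1//; exact: integral_exponential_pdf.
- by apply/measurable_EFinP; exact: mpdf.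
- by move=> x _; rewrite lee_fin exponential_pdf_ge0.
Qed.

Section gaussian.
Context (R : realType) d (Om : measurableType d) (P : probability Om R) (X : Om -> R) (s : R).
Hypotheses (s0 : 0 < s) (mX : measurable_fun setT X).
Hypothesis lawX : forall B : set R, measurable B -> P (X @^-1` B) = normal_prob 0 s B.

Let sn0 : s != 0. Proof. by rewrite gt_eqF. Qed.

Let mpdf (r : R) : measurable_fun setT (fun x : measurableTypeR R => normal_pdf 0 r x).
Proof. exact: measurable_normal_pdf. Qed.

Let law (h : R -> R) : measurable_fun setT h -> (forall x, 0 <= h x) ->
  (\int[P]_w (h (X w))%:E = \int[lm1 R]_x (h x * normal_pdf 0 s x)%:E)%E.
Proof.
move=> mh h0; exact: (@law_integral _ _ _ (measurableTypeR R) R P (lm1 R) X (normal_pdf 0 s) h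
  mX (mpdf s) (normal_pdf_ge0 0 s) lawX mh h0).
Qed.

Lemma gaussian_symmetric :
  (\int[P]_w (Num.max (X w) 0)%:E = \int[P]_w (Num.max (- X w) 0)%:E)%E.
Proof.
have cm : continuous (fun x : R => Num.max x 0).
  by move=> x; apply: continuous_max; [exact: cvg_id|exact: cvg_cst].
have cmN : continuous (fun x : R => Num.max (- x) 0).
  exact: (ct_comp cm (ctN (@ct_id R))).
rewrite (@law (fun x => Num.max x 0)); first last.
- by move=> x; rewrite le_max lexx orbT.
- exact: continuous_measurable_fun.
rewrite (@law (fun x => Num.max (- x) 0)); first last.
- by move=> x; rewrite le_max lexx orbT.
- exact: continuous_measurable_fun.
have cF : continuous (fun x : R => Num.max (- x) 0 * normal_pdf 0 s x).
  by ct; exact: continuous_normal_pdf.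
have F0 x : 0 <= Num.max (- x) 0 * normal_pdf 0 s x.
  by rewrite mulr_ge0 ?normal_pdf_ge0// le_max lexx orbT.
apply: etrans (integral_oppr cF F0); apply: eq_integral => x _.
by rewrite opprK !normal_pdfE// /normal_fun !subr0 sqrrN.
Qed.

(** With z = x^2 / (4 s^2), the inequality z <= exp z bounds x^2 times the density by a multiple of
    the Gaussian density of twice the variance, whose integral is 1. *)
Lemma gaussian_square : exists2 v : R, 0 <= v & (\int[P]_w (X w ^+ 2)%:E <= v%:E)%E.
Proof.
pose s' := Num.sqrt 2 * s.
have s'0 : s' != 0 by rewrite mulf_neq0// gt_eqF// sqrtr_gt0.
have s'2 : s' ^+ 2 = 2 * s ^+ 2 by rewrite exprMn sqr_sqrtr.
pose c := 4 * s ^+ 2 * normal_peak s / normal_peak s'.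
have pk : 0 < normal_peak s' by exact: normal_peak_gt0.
have c0 : 0 <= c by apply: divr_ge0 (ltW pk); apply: mulr_ge0 (normal_peak_ge0 _); rewrite mulr_ge0 ?sqr_ge0.
exists c => //; rewrite (@law (fun x => x ^+ 2)); first last.
- by move=> x; exact: sqr_ge0.
- by apply: mtX; exact: measurable_id.
apply: (@le_trans _ _ (\int[lm1 R]_x (c%:E * (normal_pdf 0 s' x)%:E))%E).
  apply: ge0_le_integral => //.
  - by move=> x _; rewrite lee_fin mulr_ge0 ?sqr_ge0 ?normal_pdf_ge0.
  - by apply/measurable_EFinP; apply: mtM => //; mt.
  - by apply/measurable_EFinP; apply: mtM => //; mt.
  move=> x _; rewrite -EFinM lee_fin !normal_pdfE// /normal_fun subr0 s'2.
  have cE : c * normal_peak s' = normal_peak s * (4 * s ^+ 2).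
    by rewrite /c divfK ?gt_eqF// mulrC.
  rewrite mulrCA [leRHS]mulrA cE -[leRHS]mulrA ler_wpM2l ?normal_peak_ge0//.
  set z := x ^+ 2 / (4 * s ^+ 2).
  have s20 : s ^+ 2 != 0 by rewrite expf_neq0.
  have -> : x ^+ 2 = 4 * s ^+ 2 * z by rewrite /z mulrC divfK// mulf_neq0.
  have -> : - (4 * s ^+ 2 * z) / (s ^+ 2 *+ 2) = - z - z by rewrite -mulr_natl; field.
  have -> : - (4 * s ^+ 2 * z) / (2 * s ^+ 2 *+ 2) = - z by rewrite -mulr_natl; field.
  have p4 : 0 <= 4 * s ^+ 2 by rewrite mulr_ge0 ?sqr_ge0.
  rewrite -[leLHS]mulrA (ler_wpM2l p4)// expRD mulrA ler_piMl ?expR_ge0//.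
  rewrite expRN ler_pdivrMr ?expR_gt0// mul1r.
  by have := expR_ge1Dx z; lra.
rewrite ge0_integralZl//; first last.
- by move=> x _; rewrite lee_fin normal_pdf_ge0.
- by apply/measurable_EFinP; exact: mpdf.
by rewrite (_ : (\int[lm1 R]_x _)%E = 1%E) ?mule1//; exact: integral_normal_pdf.
Qed.

End gaussian.

(** * Series with an integrable majorant *)

Definition tame (R : realType) d (Z : measurableType d) (mu : set Z -> \bar R) (D : set Z)
    (f : nat -> Z -> R) : Prop :=
  exists H : Z -> \bar R, [/\ measurable_fun setT H, forall z, (0 <= H z)%E,
    (\int[mu]_(z in D) H z < +oo)%E &
    forall z, (H z < +oo)%E -> cvgn (series (f^~ z)) /\
      forall N, (`|series (f^~ z) N|%:E <= H z)%E].

(** The majorant is the sum of absolute values. *)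
Lemma tame_absolute (R : realType) d (Z : measurableType d) (mu : {measure set Z -> \bar R})
    (D : set Z) (f : nat -> Z -> R) (b : nat -> R) : measurable D ->
  (forall k, measurable_fun setT (f k)) ->
  (forall k, (\int[mu]_(z in D) `|f k z|%:E <= (b k)%:E)%E) ->
  (\sum_(0 <= k <oo) (b k)%:E < +oo)%E -> tame mu D f.
Proof.
move=> mD mf fb boo.
have f0 k z : (0 <= `|f k z|%:E)%E by rewrite lee_fin.
have mn k : measurable_fun setT (fun z => `|f k z|%:E).
  by apply/measurable_EFinP; apply: mt_norm.
exists (fun z => \sum_(0 <= k <oo) `|f k z|%:E)%E; split.
- exact: ge0_emeasurable_sum.
- by move=> z; exact: nneseries_ge0.
- rewrite integral_nneseries//; last by move=> k; exact: measurable_funTS.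
  apply: le_lt_trans boo; apply: lee_nneseries => // k _ _.
  exact: integral_ge0.
- move=> z Hz.
  have bnd N : (`|series (f^~ z) N|%:E <= \sum_(0 <= k <oo) `|f k z|%:E)%E.
    apply: le_trans (nneseries_lim_ge N (fun k _ _ => f0 k z)).
    by rewrite sumEFin lee_fin /series /=; exact: ler_norm_sum.
  split => //; apply: normed_cvg; apply: nondecreasing_is_cvgn.
    by apply/nondecreasing_seqP => n; rewrite /normed_series_of seriesSr lerDl /= normr_ge0.
  exists (fine (\sum_(0 <= k <oo) `|f k z|%:E)%E) => _ [N _ <-].
  rewrite -lee_fin fineK; last by rewrite ge0_fin_numE// nneseries_ge0.
  by rewrite /series /= -sumEFin; exact: nneseries_lim_ge.
Qed.

Section lepage_model.
Context d (Om : measurableType d) (R : realType) (P : probability Om R) (alpha : R)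
  (phi : R * R -> R) (E Gam : nat -> Om -> R) (xi : nat -> Om -> R * R) (g : nat -> Om -> R).
Hypotheses (al0 : 0 < alpha) (al2 : alpha < 2).
Hypotheses (cphi : continuous phi) (phi0 : forall y, 0 < phi y).
Hypothesis mE : forall k, measurable_fun setT (E k).
Hypothesis lawE : forall k (B : set R), measurable B -> P (E k @^-1` B) = exponential_prob 1 B.
Hypothesis GamE : forall k w, Gam k w = \sum_(i < k.+1) E i w.
Hypothesis mxi : forall k, measurable_fun setT (xi k).
Hypothesis lawxi : forall k (B : set (R * R)), measurable B ->
  P (xi k @^-1` B) = (\int[@leb2 R]_(y in B) (phi y)%:E)%E.
Hypothesis mg : forall k, measurable_fun setT (g k).
Variable s : R.
Hypothesis s0 : 0 < s.
Hypothesis lawg : forall k (B : set R), measurable B -> P (g k @^-1` B) = normal_prob 0 s B.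

Definition sources (i : (nat + nat) + nat) : set (set Om) :=
  match i with
  | inl (inl k) => events_of (E k)
  | inl (inr k) => events_of (xi k)
  | inr k => events_of (g k)
  end.
Hypothesis indep : mutual_indep P sources.

Local Notation TR := (measurableTypeR R).
Local Notation p := (alpha^-1).

Let events_measurable d' (T : measurableType d') (X : Om -> T) A :
  measurable_fun setT X -> events_of X A -> measurable A.
Proof. by move=> mX [B mB ->]; rewrite -[X in measurable X]setTI; exact: mX. Qed.

Let srcM i A : sources i A -> measurable A.
Proof. by case: i => [[k|k]|k]; exact: events_measurable. Qed.

Let srcT i : sources i setT.
Proof. by case: i => [[k|k]|k]; exists setT. Qed.

Let srcI i A B : sources i A -> sources i B -> sources i (A `&` B).
Proof.
by case: i => [[k|k]|k] [A' mA ->] [B' mB ->]; exists (A' `&` B') => //; exact: measurableI.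
Qed.

Let srcE k (B : set R) : measurable B -> sources (inl (inl k)) (E k @^-1` B).
Proof. by exists B. Qed.
Let srcxi k (B : set (R * R)) : measurable B -> sources (inl (inr k)) (xi k @^-1` B).
Proof. by exists B. Qed.
Let srcg k (B : set R) : measurable B -> sources (inr k) (g k @^-1` B).
Proof. by exists B. Qed.

Let p0 : 0 < p. Proof. by rewrite invr_gt0. Qed.

Let Gam_sum k : Gam k = (fun w => \sum_(i < k.+1) E i w).
Proof. by apply/funext => w; rewrite GamE. Qed.

Let mGam k : measurable_fun setT (Gam k).
Proof. by rewrite Gam_sum; apply: measurable_sum. Qed.

Let mpow : measurable_fun setT (fun x : R => x `^ (- p)).
Proof. exact: measurable_powR. Qed.

(** Induction: the new waiting time is independent of the previous ones, and each of them
    contributes a factor 1/2. *)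
Let laplace_Gam k : (\int[P]_w (expR (- Gam k w))%:E = (2^-1 ^+ k.+1)%:E)%E.
Proof.
elim: k => [|k ih].
  rewrite expr1 -(exponential_laplace (mE 0) (@lawE 0%N)).
  by apply: eq_integral => w _; rewrite GamE big_ord1.
have mexpN d' (T : measurableType d') (f : T -> R) : measurable_fun setT f ->
    measurable_fun setT (fun w => expR (- f w)).
  by move=> mf; apply: (@mt_comp _ _ _ expR); [exact: measurable_expR|mt].
have := @indep_integralM _ _ _ P _ sources indep srcM srcT srcI (inl (inl k.+1))
  (fun w => expR (- Gam k w)) (fun w => expR (- E k.+1 w)).
rewrite ih (exponential_laplace (mE k.+1) (@lawE k.+1)) -EFinM -exprSr => <- //.
- by apply: eq_integral => w _; rewrite -expRD -opprD !GamE big_ord_recr.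
- apply: mexpN; rewrite Gam_sum; apply: measurable_sum => i.
  apply: (measurable_others (i := inl (inl (nat_of_ord i)))) => [|B mB]; last exact: srcE.
  by apply/eqP => -[ik]; have := ltn_ord i; rewrite ik ltnn.
- move=> B mB; have mB' : measurable ((fun x : R => expR (- x)) @^-1` B).
    by rewrite -[X in measurable X]setTI; apply: (mexpN _ R id).
  exact: (srcE k.+1 mB').
Qed.

Let ae_finite (f : Om -> \bar R) : measurable_fun setT f -> (forall w, (0 <= f w)%E) ->
  (\int[P]_w f w < +oo)%E -> {ae P, forall w, (f w < +oo)%E}.
Proof.
move=> mf f0 foo.
have fi : P.-integrable setT f.
  by apply/integrableP; split => //; under eq_integral do rewrite gee0_abs//.
apply: filterS (integrable_ae measurableT fi) => w /(_ I).
by rewrite ge0_fin_numE.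
Qed.

Lemma ae_arrival_bound :
  {ae P, forall w, exists m : nat, forall k, Gam k w `^ (- p) <= m%:R * k.+1%:R `^ (- p)}.
Proof.
(* Any base strictly between 1 and 2 would do: above 1 it forces linear growth of [Gam], below 2 it
   leaves expectations (3/4)^(k+1), which are summable. *)
pose f k w : R := (3 / 2) ^+ k.+1 * expR (- Gam k w).
have f0 k w : 0 <= f k w by rewrite mulr_ge0 ?expR_ge0// exprn_ge0//; lra.
have me k : measurable_fun setT (fun w => expR (- Gam k w)).
  by apply: (@mt_comp _ _ _ expR); [exact: measurable_expR|mt; exact: mGam].
have mf k : measurable_fun setT (fun w => (f k w)%:E).
  by apply/measurable_EFinP; apply: mtM; [exact: mt_cst|exact: me].
have h : {ae P, forall w, (\sum_(0 <= k <oo) (f k w)%:E < +oo)%E}.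
  apply: ae_finite.
  - by apply: ge0_emeasurable_sum => // k w _ _; rewrite lee_fin.
  - by move=> w; apply: nneseries_ge0 => k _ _; rewrite lee_fin.
  rewrite integral_nneseries//; last by move=> k w _; rewrite lee_fin.
  apply: (@nneseries_geometric _ (3 / 4) (3 / 4)) => [||k]; [lra|lra|].
  apply/andP; split; first by apply: integral_ge0 => w _; rewrite lee_fin.
  rewrite (_ : (\int[P]_w _)%E = (((3 / 2) ^+ k.+1)%:E * (2^-1 ^+ k.+1)%:E)%E); last first.
    rewrite -laplace_Gam -ge0_integralZl ?lee_fin ?exprn_ge0 ?divr_ge0//.
    exact/measurable_EFinP.
  rewrite -EFinM lee_fin -exprMn -exprS (_ : 3 / 2 * 2^-1 = 3 / 4 :> R)//; lra.
apply: filterS h => w hw.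
apply: (@powR_le_of_exp_growth _ _ (fine (\sum_(0 <= k <oo) (f k w)%:E)%E) p p0) => k.
rewrite -lee_fin fineK; last by rewrite ge0_fin_numE// nneseries_ge0// => i _ _; rewrite lee_fin.
rewrite -/(f k w); apply: le_trans (nneseries_lim_ge k.+1 _); last by move=> i _ _; rewrite lee_fin.
by rewrite big_nat_recr//= leeDr// sume_ge0// => i _; rewrite lee_fin.
Qed.

Let g_square : exists2 v : R, 0 <= v & forall k, (\int[P]_w (g k w ^+ 2)%:E <= v%:E)%E.
Proof.
have [v v0 hv] := gaussian_square s0 (mg 0) (@lawg 0%N).
exists v => // k; apply: le_trans hv.
have mh : measurable_fun setT (fun x : R => x ^+ 2) by apply: mtX; exact: measurable_id.
have law k := @law_integral _ _ _ TR R P (lm1 R) (g k) (normal_pdf 0 s) (fun x => x ^+ 2)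
  (mg k) (@measurable_normal_pdf R 0 s) (normal_pdf_ge0 0 s) (@lawg k) mh (fun x => sqr_ge0 x).
by rewrite (law k) (law 0%N).
Qed.

(** Since 1 / alpha > 1 and E |g_k| is bounded, the deterministic weights k^(-1/alpha) already give
    a finite expectation. Neither the positions [xi] nor a test function enters the event. *)
Lemma ae_weights_summable : alpha < 1 ->
  {ae P, forall w, (\sum_(0 <= k <oo) (Gam k w `^ (- p) * `|g k w|)%:E < +oo)%E}.
Proof.
move=> al1; have p1 : 1 < p by rewrite invf_gt1.
have [v v0 hv] := g_square.
have mn k : measurable_fun setT (fun w => `|g k w|) by apply: mt_norm.
have gb k : (\int[P]_w `|g k w|%:E <= (1 + v)%:E)%E.
  apply: (@le_trans _ _ (\int[P]_w (1%:E + (g k w ^+ 2)%:E))%E).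
    apply: ge0_le_integral => //.
    - exact/measurable_EFinP.
    - by apply/measurable_EFinP; mt; exact: mg.
    - move=> w _; rewrite -EFinD lee_fin; have := sqr_ge0 (`|g k w| - 1).
      by rewrite sqrrB1 real_normK ?num_real//; have := sqr_ge0 (g k w); lra.
  rewrite ge0_integralD//.
  - rewrite EFinD leeD// integral_cst// mul1e.
    exact: probability_le1.
  - by move=> w _; rewrite lee_fin sqr_ge0.
  - by apply/measurable_EFinP; mt; exact: mg.
have h : {ae P, forall w, (\sum_(0 <= k <oo) (k.+1%:R `^ (- p) * `|g k w|)%:E < +oo)%E}.
  have t0 k w : (0 <= (k.+1%:R `^ (- p) * `|g k w|)%:E)%E by rewrite lee_fin mulr_ge0 ?powR_ge0.
  have mt' k : measurable_fun setT (fun w => (k.+1%:R `^ (- p) * `|g k w|)%:E).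
    by apply/measurable_EFinP; apply: mtM => //; exact: mt_cst.
  apply: ae_finite.
  - exact: ge0_emeasurable_sum.
  - by move=> w; exact: nneseries_ge0.
  rewrite integral_nneseries//.
  apply: (@le_lt_trans _ _ (\sum_(0 <= k <oo) ((1 + v)%:E * (k.+1%:R `^ (- p))%:E))%E).
    apply: lee_nneseries => [k _ _|k _]; first exact: integral_ge0.
    under eq_integral do rewrite EFinM.
    rewrite ge0_integralZl ?lee_fin ?powR_ge0//; last exact/measurable_EFinP.
    by rewrite muleC lee_wpmul2r// lee_fin powR_ge0.
  rewrite nneseriesZl; last by move=> k _; rewrite lee_fin powR_ge0.
  by apply: lte_mul_pinfty; rewrite ?lee_fin ?addr_ge0//; exact: nneseries_powR.
apply: filterS2 h ae_arrival_bound => w hw [m hm].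
apply: (@le_lt_trans _ _ (\sum_(0 <= k <oo) (m%:R%:E * (k.+1%:R `^ (- p) * `|g k w|)%:E))%E).
  apply: lee_nneseries => [k _ _|k _]; first by rewrite lee_fin mulr_ge0 ?powR_ge0.
  by rewrite -EFinM lee_fin mulrA ler_wpM2r.
rewrite nneseriesZl; last by move=> k _; rewrite lee_fin mulr_ge0 ?powR_ge0.
by apply: lte_mul_pinfty; rewrite ?lee_fin.
Qed.

(** On a compact box the continuous positive density is bounded and bounded away from 0; over the
    whole plane its negative power need not be bounded. *)
Lemma density_box (rad : R) : exists c K : R, [/\ 0 <= c, 0 <= K & forall y,
  `|y.1| <= rad -> `|y.2| <= rad -> phi y `^ (- p) <= c /\ phi y <= K].
Proof.
have sc := @segment_compact R (- rad) rad.
have cV : continuous (fun y => (phi y)^-1).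
  by move=> y; apply: cvgV; [rewrite gt_eqF|exact: cphi].
have [M hM] := compact_bound (compact_setX sc sc) cV.
have [K hK] := compact_bound (compact_setX sc sc) cphi.
exists (`|M| `^ p), `|K|; split; [exact: powR_ge0|by []|].
move=> y y1 y2.
have yb : ((`[- rad, rad] `*` `[- rad, rad])%classic : set (R * R)) y.
  by split; rewrite /= in_itv /= -ler_norml.
split; last by rewrite (le_trans (ler_norm _))// (le_trans (hK _ yb))// ler_norm.
have := hM _ yb; rewrite ger0_norm ?invr_ge0 ?(ltW (phi0 _))// => hy.
rewrite (_ : phi y `^ (- p) = (phi y)^-1 `^ p).
  rewrite ge0_ler_powR ?nnegrE ?(ltW p0) ?invr_ge0 ?(ltW (phi0 _))//.
  exact: le_trans hy (ler_norm _).
by rewrite -[(phi y)^-1]powR_inv1 ?(ltW (phi0 _))// -powRrM mulN1r.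
Qed.

(** [F y z] is the contribution at [z] of a source at [y]. It will be instantiated twice: on a
    space-time box for the left side of the identity, on a time interval for the right side. *)
Context d' (Z : measurableType d') (mu : {sigma_finite_measure set Z -> \bar R}) (D : set Z)
  (F : R * R -> Z -> R) (rad B : R).
Hypotheses (mD : measurable D) (muD : (mu D < +oo)%E) (B0 : 0 <= B).
Hypothesis mF : measurable_fun setT (fun q : (TR * TR) * Z => F q.1 q.2).
Hypothesis FD : forall y z, ~ D z -> F y z = 0.
Hypothesis Fbox : forall y z, ~ (`|y.1| <= rad /\ `|y.2| <= rad) -> F y z = 0.

Local Notation term k w z := (Gam k w `^ (- p) * phi (xi k w) `^ (- p) * F (xi k w) z * g k w).

Let mFz z : measurable_fun setT (fun y : TR * TR => F y z).
Proof. exact: (measurableT_comp mF (measurable_fun_pair (@measurable_id _ _ _) (@measurable_cst _ _ _ _ _ z))). Qed.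

(** A statement about a single path: an L^1 bound on [F y] uniform in [y] reduces it to summability
    of the random weights. *)
Lemma tame_lepage_absolute w :
  (forall y, \int[mu]_(z in D) `|F y z|%:E <= B%:E)%E ->
  (\sum_(0 <= k <oo) (Gam k w `^ (- p) * `|g k w|)%:E < +oo)%E ->
  tame mu D (fun k z => term k w z).
Proof.
move=> FB hw; have [c [K [c0 K0 hc]]] := density_box rad.
have mFy y : measurable_fun setT (fun z => F y z).
  exact: (measurableT_comp mF (measurable_fun_pair (@measurable_cst _ _ _ _ _ (y : TR * TR)) (@measurable_id _ _ _))).
apply: (@tame_absolute _ _ _ mu D _ (fun k => c * B * (Gam k w `^ (- p) * `|g k w|))) => //.
- by move=> k; mt; exact: mFy.
- move=> k; set y := xi k w.
  pose e := Gam k w `^ (- p) * c * `|g k w|.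
  have e0 : 0 <= e by rewrite !mulr_ge0 ?powR_ge0.
  apply: (@le_trans _ _ (\int[mu]_(z in D) (e%:E * `|F y z|%:E))%E).
    apply: ge0_le_integral => //.
    + by apply: measurable_funTS; apply/measurable_EFinP; mt; exact: mFy.
    + by apply: measurable_funTS; apply/measurable_EFinP; mt; exact: mFy.
    move=> z _; rewrite -EFinM lee_fin !normrM !(ger0_norm (powR_ge0 _ _)) /e mulrAC.
    have [yb|yb] := pselect (`|y.1| <= rad /\ `|y.2| <= rad); last by rewrite (Fbox _ yb) normr0 !mulr0.
    have [h _] := hc y yb.1 yb.2.
    by rewrite ler_wpM2r// ler_wpM2r// ler_wpM2l ?powR_ge0.
  rewrite ge0_integralZl//; last by apply: measurable_funTS; apply/measurable_EFinP; mt; exact: mFy.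
  apply: (@le_trans _ _ (e%:E * B%:E)%E); first by rewrite lee_wpmul2l// lee_fin.
  by rewrite -EFinM lee_fin /e le_eqVlt; apply/orP; left; apply/eqP; ring.
- under eq_eseriesr do rewrite EFinM.
  rewrite nneseriesZl; last by move=> k _; rewrite lee_fin mulr_ge0 ?powR_ge0.
  by apply: lte_mul_pinfty; rewrite ?lee_fin ?mulr_ge0.
Qed.

Hypothesis FB : forall z, (\int[lm2 R]_y (F y z ^+ 2)%:E <= B%:E)%E.

(** The first factors Gam_k^(-1/alpha) have infinite second moment when alpha < 2. The truncation
    restores it and, by the arrival bound, is inactive for some [m] on almost every path. *)
Let trunc (m k : nat) (w : Om) : R := Num.min (Gam k w `^ (- p)) (m%:R * k.+1%:R `^ (- p)).
Let coef m k (w : Om) z : R := trunc m k w * phi (xi k w) `^ (- p) * F (xi k w) z.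
Let X m k (q : Om * Z) : R := coef m k q.1 q.2 * g k q.1.

Let mcoef d2 (T : measurableType d2) (gam : T -> R) (x : T -> TR * TR) (zz : T -> Z) (c : R) :
  measurable_fun setT gam -> measurable_fun setT x -> measurable_fun setT zz ->
  measurable_fun setT (fun w => Num.min (gam w `^ (- p)) c * phi (x w) `^ (- p) * F (x w) (zz w)).
Proof.
move=> m1 m2 m3; apply: mtM; last exact: (measurableT_comp mF (measurable_fun_pair m2 m3)).
apply: mtM.
  by apply: measurable_minr; [exact: (mt_comp mpow m1)|exact: mt_cst].
by apply: (mt_comp mpow); exact: (measurableT_comp (measurable_ct2 cphi) m2).
Qed.

Let mX m k : measurable_fun setT (X m k).
Proof.
apply: mtM; last exact: (measurableT_comp (mg k) measurable_fst).
apply: (mcoef (gam := fun q : Om * Z => Gam k q.1) (x := fun q => xi k q.1) (zz := snd)).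
- exact: (measurableT_comp (mGam k) measurable_fst).
- exact: (measurableT_comp (mxi k) measurable_fst).
- exact: measurable_snd.
Qed.

(** Where [F] is nonzero the negative power of phi is at most [c]. Then g_k^2 factors out by
    independence, and the density of xi_k, at most [K] there, turns the mean of F^2 into K times its
    integral over the plane. *)
Let second_moment m : exists2 K : R, 0 <= K & forall k z,
  (\int[P]_w (X m k (w, z) ^+ 2)%:E <= (K * (k.+1%:R `^ (- p)) ^+ 2)%:E)%E.
Proof.
have [c [K [c0 K0 hc]]] := density_box rad.
have [v v0 hv] := g_square.
exists ((m%:R * c) ^+ 2 * (K * B * v)) => [|k z]; first by rewrite mulr_ge0 ?sqr_ge0// !mulr_ge0.
pose e := (m%:R * k.+1%:R `^ (- p) * c) ^+ 2.
have e0 : 0 <= e by exact: sqr_ge0.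
have mFx : measurable_fun setT (fun w => F (xi k w) z).
  exact: (measurableT_comp (mFz z) (mxi k)).
apply: (@le_trans _ _ (\int[P]_w (e%:E * (F (xi k w) z ^+ 2 * g k w ^+ 2)%:E))%E).
  apply: ge0_le_integral => //.
  - by move=> w _; rewrite lee_fin sqr_ge0.
  - apply/measurable_EFinP; apply: mtX.
    exact: (measurableT_comp (mX m k) (measurable_fun_pair (@measurable_id _ _ _) (@measurable_cst _ _ _ _ _ z))).
  - by apply/measurable_EFinP; mt; exact: mg.
  move=> w _; rewrite -EFinM lee_fin /X /coef /=.
  have [yb|yb] := pselect (`|(xi k w).1| <= rad /\ `|(xi k w).2| <= rad); last first.
    by rewrite (Fbox _ yb) mulr0 mul0r expr0n /= mul0r mulr0.
  have [h _] := hc (xi k w) yb.1 yb.2.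
  have t0 : 0 <= trunc m k w by rewrite le_min powR_ge0 mulr_ge0 ?powR_ge0.
  rewrite (_ : (_ * F _ _ * _) ^+ 2 =
    (trunc m k w * phi (xi k w) `^ (- p)) ^+ 2 * (F (xi k w) z ^+ 2 * g k w ^+ 2)); last by ring.
  have F2 : 0 <= F (xi k w) z ^+ 2 * g k w ^+ 2 by rewrite mulr_ge0 ?sqr_ge0.
  rewrite (ler_wpM2r F2)// /e ler_sqr ?nnegrE ?mulr_ge0 ?powR_ge0//.
  by rewrite ler_pM ?powR_ge0// ge_min lexx orbT.
rewrite ge0_integralZl ?lee_fin//; first last.
- by move=> w _; rewrite lee_fin mulr_ge0 ?sqr_ge0.
- by apply/measurable_EFinP; mt; exact: mg.
rewrite (_ : (m%:R * c) ^+ 2 * (K * B * v) * _ = e * (K * B * v)); last by rewrite /e; ring.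
rewrite [leRHS]EFinM lee_wpmul2l ?lee_fin//.
have E1 := @indep_integralM _ _ _ P _ sources indep srcM srcT srcI (inr k)
  (fun w => F (xi k w) z ^+ 2) (fun w => g k w ^+ 2).
rewrite E1; first last.
- by move=> w; exact: sqr_ge0.
- by move=> w; exact: sqr_ge0.
- move=> A mA; have mA' : measurable ((fun x : R => x ^+ 2) @^-1` A).
    by rewrite -[X in measurable X]setTI; apply: (mtX (f := id)).
  exact: (srcg k mA').
- apply: mtX; apply: (measurableT_comp (mFz z)).
  by apply: (measurable_others (i := inl (inr k))) => // A mA; exact: srcxi.
rewrite EFinM; apply: lee_pmul => //.
- by apply: integral_ge0 => w _; rewrite lee_fin sqr_ge0.
- by apply: integral_ge0 => w _; rewrite lee_fin sqr_ge0.
have mh : measurable_fun setT (fun y : TR * TR => F y z ^+ 2) by apply: mtX; exact: mFz.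
have law := @law_integral _ _ _ (TR * TR)%type R P (lm2 R) (xi k) phi (fun y => F y z ^+ 2)
  (mxi k) (measurable_ct2 cphi) (fun y => ltW (phi0 y)) (@lawxi k) mh (fun y => sqr_ge0 _).
rewrite law.
apply: (@le_trans _ _ (\int[lm2 R]_y (K%:E * (F y z ^+ 2)%:E))%E).
  apply: ge0_le_integral => //.
  - by move=> y _; rewrite lee_fin mulr_ge0 ?sqr_ge0 ?ltW.
  - by apply/measurable_EFinP; apply: mtM => //; exact: (measurable_ct2 cphi).
  - by apply/measurable_EFinP; apply: mtM => //; exact: mt_cst.
  move=> y _; rewrite -EFinM lee_fin mulrC.
  have [yb|yb] := pselect (`|y.1| <= rad /\ `|y.2| <= rad); last first.
    by rewrite (Fbox _ yb) expr0n /= !mulr0.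
  by rewrite ler_wpM2r ?sqr_ge0//; have [] := hc y yb.1 yb.2.
rewrite ge0_integralZl ?lee_fin//; first last.
- by move=> y _; rewrite lee_fin sqr_ge0.
- exact/measurable_EFinP.
by rewrite EFinM lee_wpmul2l ?lee_fin.
Qed.

Let msquare m k z : measurable_fun setT (fun w => (X m k (w, z) ^+ 2)%:E).
Proof.
apply/measurable_EFinP; apply: mtX.
exact: (measurableT_comp (mX m k) (measurable_fun_pair (@measurable_id _ _ _) (@measurable_cst _ _ _ _ _ z))).
Qed.

(** The factor g_k with the larger index is symmetric and independent of all the others, including
    Gam_k and xi_k. *)
Let uncorrelated m j k z : (j < k)%N -> (\int[P]_w (X m j (w, z) * X m k (w, z))%:E = 0)%E.
Proof.
move=> jk.
have mXz i : measurable_fun setT (fun w => X m i (w, z)).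
  exact: (measurableT_comp (mX m i) (measurable_fun_pair (@measurable_id _ _ _) (@measurable_cst _ _ _ _ _ z))).
have [K K0 hK] := second_moment m.
have sqi i : P.-integrable setT (fun w => (X m i (w, z) ^+ 2)%:E).
  apply/integrableP; split => //; under eq_integral do rewrite gee0_abs ?lee_fin ?sqr_ge0//.
  exact: le_lt_trans (hK i z) (ltry _).
have iXX : P.-integrable setT (fun w => (X m j (w, z) * X m k (w, z))%:E).
  apply: (le_integrable measurableT _ _ (integrableD measurableT (sqi j) (sqi k))).
    by apply/measurable_EFinP; mt.
  move=> w _; rewrite /= lee_fin [leRHS]ger0_norm ?addr_ge0 ?sqr_ge0// ler_norml.
  by apply/andP; split; nra.
have mo i d2 (T : measurableType d2) (f : Om -> T) : i != inr k ->
   (forall A, measurable A -> sources i (f @^-1` A)) ->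
   measurable_fun setT (f : others sources (inr k) -> T).
  by move=> ik fA; apply: (measurable_others ik).
have mGo i : measurable_fun setT (Gam i : others sources (inr k) -> R).
  rewrite Gam_sum; apply: measurable_sum => n.
  by apply: (mo (inl (inl (nat_of_ord n)))) => // A mA; exact: srcE.
have mxo i : measurable_fun setT (xi i : others sources (inr k) -> R * R).
  by apply: (mo (inl (inr i))) => // A mA; exact: srcxi.
have mco i : measurable_fun setT ((fun w => coef m i w z) : others sources (inr k) -> R).
  exact: (@mcoef _ (others sources (inr k)) (Gam i) (xi i) (fun=> z)
    (m%:R * i.+1%:R `^ (- p)) (mGo i) (mxo i) (@measurable_cst _ _ _ _ _ z)).
have mgo : measurable_fun setT (g j : others sources (inr k) -> R).
  apply: (mo (inr j)) => [|A mA]; last exact: srcg.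
  by apply/eqP => -[jk']; rewrite jk' ltnn in jk.
have E1 := @indep_mean0 _ _ _ P _ sources indep srcM srcT srcI (inr k)
  (fun w => coef m j w z * g j w * coef m k w z) (g k).
transitivity (\int[P]_w (coef m j w z * g j w * coef m k w z * g k w)%:E)%E.
  by apply: eq_integral => w _; rewrite /X /= !mulrA.
apply: E1.
- by apply: mtM => //; apply: mtM.
- by move=> A mA; exact: srcg.
- exact: (gaussian_symmetric s0 (mg k) (@lawg k)).
- apply: eq_integrable iXX => // w _; by rewrite /X /= !mulrA.
Qed.

Lemma ae_tame_truncated m : p <= 1 -> {ae P, forall w, tame mu D (fun k z => X m k (w, z))}.
Proof.
move=> p1; have [K K0 hK] := second_moment m.
have p12 : 1 < 2 * p by rewrite ltr_pdivlMr// mul1r.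
pose nu := pmeasure P mu.
pose DD := [set: Om] `*` D.
have mDD : measurable DD by exact: measurableX.
have XD k q : ~ DD q -> X m k q = 0.
  by move=> qD; rewrite /X /coef FD ?mulr0 ?mul0r// => h; apply: qD.
have muDf : mu D \is a fin_num by rewrite ge0_fin_numE.
pose Kb := K * fine (mu D).
have Kb0 : 0 <= Kb by rewrite mulr_ge0 ?fine_ge0.
pose b k : R := Kb * (k.+1%:R `^ (- p)) ^+ 2.
have msq k : measurable_fun setT (fun q => (X m k q ^+ 2)%:E).
  by apply/measurable_EFinP; apply: mtX.
have Xb k : (\int[nu]_(q in DD) (X m k q ^+ 2)%:E <= (b k)%:E)%E.
  rewrite integral_vanish; last by move=> q /XD ->; rewrite expr0n.
  have [_ E1] := tonelli P mu (msq k) (fun q => (sqr_ge0 (X m k q) : (0 <= _%:E)%E)).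
  rewrite [leLHS]E1.
  apply: (@le_trans _ _ (\int[mu]_(z in D) (K * (k.+1%:R `^ (- p)) ^+ 2)%:E)%E).
    rewrite [leRHS]integral_mkcond; apply: ge0_le_integral => //.
    - by move=> z _; apply: integral_ge0 => w _; rewrite lee_fin sqr_ge0.
    - have h := @measurable_fun_fubini_tonelli_G _ _ Om Z R P (fun q => (X m k q ^+ 2)%:E)
        (msq k) (fun q => sqr_ge0 (X m k q)).
      exact: h.
    - by apply/(measurable_restrictT _ mD); exact: measurable_cst.
    move=> z _; rewrite /patch; case: ifPn; rewrite ?inE ?notin_setE => zD; first exact: hK.
    by rewrite integral0_eq// => w _; rewrite /= XD ?expr0n// => -[].
  apply: (@le_trans _ _ ((K * (k.+1%:R `^ (- p)) ^+ 2)%:E * mu D)%E); first by rewrite integral_cst.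
  apply: (eq_ind _ (fun u => (_ * u <= _)%E) _ _ (fineK muDf)).
  by rewrite -EFinM lee_fin /b /Kb mulrAC.
have Xorth j k : (j < k)%N -> (\int[nu]_(q in DD) (X m j q * X m k q)%:E = 0)%E.
  move=> jk.
  have sqi i : nu.-integrable DD (fun q => (X m i q ^+ 2)%:E).
    apply/integrableP; split; first exact: measurable_funTS.
    under eq_integral do rewrite gee0_abs ?lee_fin ?sqr_ge0//.
    exact: le_lt_trans (Xb i) (ltry _).
  have iXX : nu.-integrable DD (fun q => (X m j q * X m k q)%:E).
    apply: (le_integrable mDD _ _ (integrableD mDD (sqi j) (sqi k))).
      by apply: measurable_funTS; apply/measurable_EFinP; apply: mtM.
    move=> w _; rewrite /= lee_fin [leRHS]ger0_norm ?addr_ge0 ?sqr_ge0// ler_norml.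
    by apply/andP; split; nra.
  have [_ E1] := fubini_on iXX measurableT mD.
  rewrite [LHS]E1; apply: integral0_eq => z _; exact: uncorrelated.
(* Chosen so that u^(4j) = (2^(1 - 2/alpha))^j, the condensed size of a dyadic block; it is below 1
   because alpha < 2. *)
pose u : R := 2 `^ ((1 - 2 * p) / 4).
have u01 : 0 < u < 1.
  have h : 0 < - ((1 - 2 * p) / 4) by rewrite -mulNr divr_gt0// opprB subr_gt0.
  by have := powR2_lt1 h; rewrite opprK.
have uE j : u ^+ (4 * j) = (2 `^ (1 - 2 * p)) ^+ j.
  rewrite exprM /u -[X in X ^+ j]powR_mulrn ?powR_ge0// -powRrM.
  by rewrite divfK// pnatr_eq0.
have bK j i : (i < 2 ^ j)%N -> (2 ^ j)%:R * b (2 ^ j + i)%N <= Kb * u ^+ (4 * j).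
  move=> _; rewrite /b mulrCA ler_wpM2l// uE.
  rewrite -powR_mulrn ?powR_ge0// -powRrM (_ : - p * 2 = - (2 * p)); last by ring.
  by apply: dyadic_powR; rewrite mulr_ge0 ?(ltW p0).
have nuDD : (nu DD < +oo)%E.
  have e := pmeasureE P mu measurableT mD.
  apply: (eq_ind_r (fun u => (u < +oo)%E) _ e).
  exact: (lte_mul_pinfty (measure_ge0 P _) (fin_num_measure P _ measurableT) muD).
have [H [mH H0 Hoo Hcv]] := menshov mDD (mX m) Xb Xorth nuDD u01 Kb0 bK.
have mHD : measurable_fun setT (H \_ DD) by apply/(measurable_restrictT _ mDD); exact: measurable_funTS.
have H0D q : (0 <= (H \_ DD) q)%E by rewrite /patch; case: ifP.
(* Tonelli on the product: an integrable majorant on [Om] times [D] is integrable in [z] for almost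
   every [w]. *)
have h : {ae P, forall w, (\int[mu]_(z in D) H (w, z) < +oo)%E}.
  apply: ae_finite.
  - exact: (@measurable_fun_integral_snd R _ _ Om Z mu D H mH H0 mD).
  - by move=> w; apply: integral_ge0.
  - move: Hoo; rewrite integral_mkcond.
    have [E1 _] := tonelli P mu mHD H0D.
    rewrite [X in (X < _)%E -> _]E1; apply: le_lt_trans.
    rewrite le_eqVlt; apply/orP; left; apply/eqP; apply: eq_integral => w _.
    by rewrite integral_mkcond; apply: eq_integral => z _; rewrite /patch in_setX in_setT.
apply: filterS h => w hw; exists (fun z => H (w, z)); split => //.
- exact: (measurableT_comp mH (measurable_fun_pair (@measurable_cst _ _ _ _ _ w) (@measurable_id _ _ _))).
- by move=> z /Hcv.
Qed.

(** Countably many truncation levels share one null set; off it, and where the arrival bound holds,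
    the level [m] supplied by that bound makes the minimum inactive. *)
Lemma ae_tame_lepage : p <= 1 -> {ae P, forall w, tame mu D (fun k z => term k w z)}.
Proof.
move=> p1; have h := ae_foralln (fun m => ae_tame_truncated m p1).
apply: filterS2 h ae_arrival_bound => w hw [m hm].
rewrite (_ : (fun k z => _) = (fun k z => X m k (w, z))); first exact: hw.
apply/funext => k; apply/funext => z.
by rewrite /X /coef /trunc /= min_l.
Qed.

End lepage_model.

(** * Exchanging the series with the space-time integral *)

(** By the Cauchy criterion the set of convergence is measurable; partial sums restricted to it
    converge everywhere, to 0 off it, in accordance with the default value. *)
Lemma measurable_series_val (R : realType) d (Z : measurableType d) (f : nat -> Z -> R) :
  (forall k, measurable_fun setT (f k)) ->
  measurable_fun setT (fun z => series_val (f^~ z)).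
Proof.
move=> mf; pose S N z := series (f^~ z) N.
have mS N : measurable_fun setT (S N) by apply: measurable_sum.
pose C := \bigcap_m \bigcup_n \bigcap_k [set z | `|S (n + k)%N z - S n z| < m.+1%:R^-1].
have mC : measurable C.
  apply: bigcapT_measurable => m; apply: bigcupT_measurable => n; apply: bigcapT_measurable => k.
  rewrite -[X in measurable X]setTI.
  have m1 : measurable_fun setT (fun z => `|S (n + k)%N z - S n z|).
    by apply: mt_norm; apply: mtD => //; apply: mtN.
  rewrite (_ : [set z | _] = (fun z => `|S (n + k)%N z - S n z|) @^-1` `]-oo, m.+1%:R^-1[%classic).
    exact: m1.
  by apply/seteqP; split => z /=; rewrite in_itv.
have CE z : C z <-> cvgn (series (f^~ z)).
  split=> [Cz|cz m _].
    apply: cauchy_cvg; apply: cauchy_exP => e e0.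
    have [m me] : exists m : nat, m.+1%:R^-1 < e.
      exists (Num.truncn e^-1); rewrite invf_plt ?posrE ?ltr0n//; exact: truncnS_gt.
    have [n _ hn] := Cz m I; exists (S n z); exists n => // N /= nN.
    have := hn (N - n)%N I; rewrite /= subnKC// => h.
    by rewrite /= -ball_normE /ball_ /= distrC (lt_trans h).
  have m0 : 0 < m.+1%:R^-1 / 2 :> R by rewrite divr_gt0.
  move/cvgrPdist_lt : cz => /(_ _ m0)[n _ hn]; exists n => // k _ /=.
  have h1 := hn n (leqnn n); have h2 := hn (n + k)%N (leq_addr k n).
  rewrite /= in h1 h2; rewrite (splitr m.+1%:R^-1) (le_lt_trans _ (ltrD h2 h1))//.
  rewrite -[S _ z - _](subrKA (limn (series (f^~ z)))) -/(S _ z).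
  by rewrite (le_trans (ler_normD _ _))// distrC.
apply: (@measurable_realfun.measurable_fun_cvg _ _ _ _ (fun N => S N \_ C)).
  by move=> N; apply/(measurable_restrictT _ mC); exact: measurable_funTS.
move=> z _; rewrite /series_val.
case: asboolP => [/CE Cz|nC].
  rewrite (_ : (fun N => _) = series (f^~ z)); first exact/CE.
  by apply/funext => N; rewrite /patch mem_set.
rewrite (_ : (fun N => _) = cst 0); first exact: cvg_cst.
by apply/funext => N; rewrite /patch memNset// => /CE.
Qed.

(** The default value 0 is compatible with scaling: a nonzero factor preserves divergence, and the
    factor 0 gives the zero series. *)
Lemma series_valZ (R : realType) (c : R) (u : nat -> R) :
  series_val (fun k => c * u k) = c * series_val u.
Proof.
have sE v : series (fun k => v * u k) = (fun n => v * series u n).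
  by apply/funext => n; rewrite /series /= mulr_sumr.
have [->|c0] := eqVneq c 0.
  rewrite mul0r /series_val (_ : series _ = cst 0).
    by rewrite lim_cst//; case: asboolP.
  by apply/funext => n; rewrite /series /= big1// => k _; rewrite mul0r.
rewrite /series_val sE; case: asboolP => [cv|ncv].
  have cu : cvgn (series u).
    rewrite (_ : series u = (fun n => c^-1 * (c * series u n))); last by apply/funext => n; rewrite mulKf.
    by apply: is_cvgM => //; exact: is_cvg_cst.
  rewrite asboolT//; apply/cvg_lim => //; exact: cvgMr.
rewrite asboolF ?mulr0// => cu; apply: ncv; apply: is_cvgM => //; exact: is_cvg_cst.
Qed.

Lemma series_val0 (R : realType) : series_val (fun=> 0 : R) = 0.
Proof.
rewrite (_ : (fun=> 0) = (fun k : nat => 0 * (0 : R))) ?series_valZ ?mul0r//.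
Qed.

(** Dominated convergence, with the points where [H] is infinite as null set. *)
Lemma tame_integral (R : realType) d (Z : measurableType d) (mu : {measure set Z -> \bar R})
    (D : set Z) (f : nat -> Z -> R) : measurable D ->
  (forall k, measurable_fun setT (f k)) -> tame mu D f ->
  mu.-integrable D (fun z => (series_val (f^~ z))%:E) /\
  ((\sum_(k < N) \int[mu]_(z in D) (f k z)%:E)%E @[N --> \oo] -->
     (\int[mu]_(z in D) (series_val (f^~ z))%:E)%E).
Proof.
move=> mD mf [H [mH H0 Hoo Hcv]].
have iH : mu.-integrable D H.
  apply/integrableP; split; first exact: measurable_funTS.
  by under eq_integral do rewrite gee0_abs//.
have mS N : measurable_fun D (fun z => (series (f^~ z) N)%:E).
  by apply/measurable_EFinP; apply: measurable_funTS; apply: measurable_sum.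
have Hfin : {ae mu, forall z, D z -> (H z < +oo)%E}.
  apply: filterS (integrable_ae mD iH) => z Hz /Hz; by rewrite ge0_fin_numE.
have f_f : {ae mu, forall z, D z -> (series (f^~ z) N)%:E @[N --> \oo] --> (series_val (f^~ z))%:E}.
  apply: filterS Hfin => z Hz /Hz /Hcv[cv _]; apply: cvg_EFin; first exact: nearW.
  by rewrite /series_val asboolT.
have f_g : {ae mu, forall z N, D z -> (`|(series (f^~ z) N)%:E| <= H z)%E}.
  apply: filterS Hfin => z Hz N /Hz /Hcv[_]; exact.
have mV : measurable_fun D (fun z => (series_val (f^~ z))%:E).
  by apply/measurable_EFinP; apply: measurable_funTS; exact: measurable_series_val.
have [iV _ cV] := dominated_convergence mD mS mV f_f iH f_g.
split => //.
have bH N z : (`|(series (f^~ z) N)%:E| <= H z)%E.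
  have [|] := ltP (H z) +oo%E; first by move/Hcv => [_]; exact.
  by rewrite leye_eq => /eqP ->; rewrite leey.
have iS N : mu.-integrable D (fun z => (series (f^~ z) N)%:E).
  apply: (le_integrable mD _ _ iH) => // z _.
  by rewrite (gee0_abs (H0 z)).
have fE k z : (f k z)%:E = ((series (f^~ z) k.+1)%:E - (series (f^~ z) k)%:E)%E.
  by rewrite -EFinB seriesSr addrAC subrr add0r.
have if_ k : mu.-integrable D (fun z => (f k z)%:E).
  under [X in integrable _ _ X]funext do rewrite fE.
  exact: integrableB.
rewrite (_ : (fun N => _) = (fun N => \int[mu]_(z in D) (series (f^~ z) N)%:E)%E)//.
apply/funext; elim => [|N ih].
  by rewrite big_ord0 integral0_eq// => z _; rewrite /series /= big_geq.
rewrite big_ord_recr /= ih -integralD//.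
by apply: eq_integral => z _; rewrite seriesSr EFinD.
Qed.

(** * Integrals of inverse square roots *)

Section singular_weight.
Variables (R : realType) (l : R).
Hypothesis l0 : 0 < l.
Local Notation TR := (measurableTypeR R).

Definition inv_sqrt_cut (v : R) : R := (`|v| <= l)%R%:R * (Num.sqrt `|v|)^-1.

Lemma inv_sqrt_cut_ge0 v : 0 <= inv_sqrt_cut v.
Proof. by rewrite mulr_ge0// invr_ge0 sqrtr_ge0. Qed.

Lemma inv_sqrt_cutN v : inv_sqrt_cut (- v) = inv_sqrt_cut v.
Proof. by rewrite /inv_sqrt_cut normrN. Qed.

Lemma measurable_inv_sqrt_cut d (T : measurableType d) (v : T -> R) :
  measurable_fun setT v -> measurable_fun setT (fun w => inv_sqrt_cut (v w)).
Proof. by move=> mv; rewrite /inv_sqrt_cut; mt; apply: mt_le; mt. Qed.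

Definition singular_mass : R := 2 * Num.sqrt (2 * l) * pi.

Lemma singular_mass_ge0 : 0 <= singular_mass.
Proof. by rewrite !mulr_ge0 ?sqrtr_ge0 ?pi_ge0. Qed.

(** For 0 < v <= l one has l^2 - (v - l)^2 = v (2 l - v) <= 2 l v, so v^(-1/2) is at most sqrt (2 l)
    times an arcsine density of mass pi centred at l. The two sides of the singularity use the
    centres y + l and y - l, hence the factor 2. *)
Lemma integral_inv_sqrt_cut (y : R) :
  (\int[lm1 R]_x (inv_sqrt_cut (x - y))%:E <= singular_mass%:E)%E.
Proof.
pose h c (x : R) := (Num.sqrt (l ^+ 2 - (x - c) ^+ 2))^-1.
have h0 c x : 0 <= h c x by rewrite invr_ge0 sqrtr_ge0.
have mh c : measurable_fun setT (fun x : TR => h c x) by rewrite /h; mt.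
have s0 : 0 <= Num.sqrt (2 * l) by exact: sqrtr_ge0.
have key v : 0 < v <= l -> (Num.sqrt v)^-1 <= Num.sqrt (2 * l) * (Num.sqrt (l ^+ 2 - (v - l) ^+ 2))^-1.
  move=> /andP[v0 vl]; rewrite (_ : l ^+ 2 - (v - l) ^+ 2 = v * (2 * l - v)); last by ring.
  have w0 : 0 < 2 * l - v by lra.
  rewrite ler_pdivlMr ?sqrtr_gt0 ?mulr_gt0// mulrC (sqrtrM _ (ltW v0)).
  by rewrite mulrAC divff ?mul1r ?gt_eqF ?sqrtr_gt0// ler_wsqrtr//; lra.
apply: (@le_trans _ _ (\int[lm1 R]_x ((Num.sqrt (2 * l))%:E * ((h (y + l) x)%:E + (h (y - l) x)%:E)))%E).
  apply: ge0_le_integral => //.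
  - by move=> x _; rewrite lee_fin inv_sqrt_cut_ge0.
  - by apply/measurable_EFinP; apply: measurable_inv_sqrt_cut; mt.
  - apply: emeasurable_funM; first exact: measurable_cst.
    by apply: emeasurable_funD; exact/measurable_EFinP.
  move=> x _.
  suff : inv_sqrt_cut (x - y) <= Num.sqrt (2 * l) * (h (y + l) x + h (y - l) x) by [].
  rewrite /inv_sqrt_cut; have P0 : 0 <= Num.sqrt (2 * l) * (h (y + l) x + h (y - l) x).
    by rewrite mulr_ge0 ?addr_ge0.
  case: (boolP (`|x - y| <= l)) => [hl|_]; last by rewrite mul0r.
  rewrite mul1r mulrDr; have [xy|xy|xy] := ltgtP x y.
  - apply: (@le_trans _ _ (Num.sqrt (2 * l) * h (y - l) x)); last by rewrite lerDr mulr_ge0.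
    rewrite /h (_ : x - (y - l) = - (`|x - y| - l)); last by rewrite ltr0_norm ?subr_lt0//; ring.
    by rewrite sqrrN; apply: key; rewrite hl normr_gt0 subr_eq0 lt_eqF.
  - apply: (@le_trans _ _ (Num.sqrt (2 * l) * h (y + l) x)); last by rewrite lerDl mulr_ge0.
    rewrite /h (_ : x - (y + l) = `|x - y| - l); last by rewrite gtr0_norm ?subr_gt0//; ring.
    by apply: key; rewrite hl normr_gt0 subr_eq0 gt_eqF.
  - by rewrite xy subrr normr0 sqrtr0 invr0 addr_ge0 ?mulr_ge0.
rewrite ge0_integralZl//; first last.
- by move=> x _; apply: adde_ge0; rewrite lee_fin.
- by apply: emeasurable_funD; exact/measurable_EFinP.
rewrite ge0_integralD//; first last.
- exact/measurable_EFinP.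
- by move=> x _; rewrite lee_fin.
- exact/measurable_EFinP.
- by move=> x _; rewrite lee_fin.
rewrite !arcsine_mass// -EFinD -EFinM lee_fin /singular_mass.
by rewrite le_eqVlt; apply/orP; left; apply/eqP; ring.
Qed.

Lemma integral_singular_weight (y : R * R) :
  (\int[lm2 R]_x (inv_sqrt_cut (x.1 - y.1) * inv_sqrt_cut (x.2 - y.2))%:E
     <= (singular_mass ^+ 2)%:E)%E.
Proof.
have m1 c : measurable_fun setT (fun x : TR => (inv_sqrt_cut (x - c))%:E).
  by apply/measurable_EFinP; apply: measurable_inv_sqrt_cut; mt.
have mm : measurable_fun setT (fun x : TR * TR => (inv_sqrt_cut (x.1 - y.1) * inv_sqrt_cut (x.2 - y.2))%:E).
  by apply/measurable_EFinP; mt; apply: measurable_inv_sqrt_cut; mt.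
have p0 (x : TR * TR) : (0 <= (inv_sqrt_cut (x.1 - y.1) * inv_sqrt_cut (x.2 - y.2))%:E)%E.
  by rewrite lee_fin mulr_ge0 ?inv_sqrt_cut_ge0.
have [E _] := tonelli (lm1 R) (lm1 R) mm p0.
rewrite [leLHS]E /=.
have S0 := singular_mass_ge0.
apply: (@le_trans _ _ (\int[lm1 R]_x ((inv_sqrt_cut (x - y.1))%:E * singular_mass%:E))%E).
  apply: ge0_le_integral => //.
  - by move=> x _; apply: integral_ge0 => z _; rewrite lee_fin mulr_ge0 ?inv_sqrt_cut_ge0.
  - exact: (@measurable_fun_integral_snd R _ _ TR TR (lm1 R) setT _ mm p0 measurableT).
  - by apply: emeasurable_funM => //; exact: measurable_cst.
  move=> x _; under eq_integral do rewrite EFinM.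
  rewrite ge0_integralZl ?lee_fin ?inv_sqrt_cut_ge0//; last by move=> z _; rewrite lee_fin inv_sqrt_cut_ge0.
  by rewrite lee_wpmul2l ?lee_fin ?inv_sqrt_cut_ge0// integral_inv_sqrt_cut.
rewrite ge0_integralZr ?lee_fin//; last by move=> x _; rewrite lee_fin inv_sqrt_cut_ge0.
by rewrite expr2 [leRHS]EFinM lee_wpmul2r ?lee_fin// integral_inv_sqrt_cut.
Qed.

End singular_weight.

(** On these lines the cut inverse square root takes the default value 0 and cannot serve as an
    upper bound; they form a null set. *)
Lemma ae_coordinates_neq (R : realType) (c : R * R) :
  {ae lm2 R, forall x : measurableTypeR R * measurableTypeR R, x.1 != c.1 /\ x.2 != c.2}.
Proof.
have m1 (u : R) : measurable [set u : measurableTypeR R] by exact: measurable_set1.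
have z1 u : (lm1 R [set u] = 0)%E := lebesgue_measure_set1 _.
have n1 : (lm2 R).-negligible ([set c.1] `*` setT).
  exists ([set c.1] `*` setT); split => //; first exact: measurableX.
  by apply: etrans (lm2E (m1 _) measurableT) _; rewrite z1 mul0e.
have n2 : (lm2 R).-negligible (setT `*` [set c.2]).
  exists (setT `*` [set c.2]); split => //; first exact: measurableX.
  by apply: etrans (lm2E measurableT (m1 _)) _; rewrite z1 mule0.
apply: negligibleS (negligibleU n1 n2) => x /= h.
have [e|n] := eqVneq x.1 c.1; [by left|right; split=> //].
by apply: contrapT => /eqP e; exact: h.
Qed.

(** * Response and forcing of one source *)

Section source_response.
Variables (R : realType) (a rho C : R) (sg th : R * R -> R -> R) (r : R).
Hypotheses (a0 : 0 < a) (rho_gt0 : 0 < rho).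
Let rho0 : 0 <= rho := ltW rho_gt0.
Hypothesis csg : continuous (fun q : (R * R) * R => sg q.1 q.2).
Hypothesis sgC : forall x t, `|sg x t| <= C.
Hypothesis sth : smooth th.
Hypothesis th0 : forall x t, r < `|x.1| + `|x.2| + `|t| -> th x t = 0.
Hypothesis rrho : r < rho.
Local Notation TR := (measurableTypeR R).
Local Notation L := (wave_op a th).

Definition response (y : R * R) (z : R * (R * R)) : R := potential a rho sg y z * L z.2 z.1.

Definition spacetime_box : set (TR * (TR * TR)) :=
  `[0, rho]%classic `*` (`[- rho, rho]%classic `*` `[- rho, rho]%classic).

(** Finite propagation speed: within the time rho, a wave reaching the support of the test function
    has travelled at most a rho. *)
Definition source_radius : R := rho + a * rho.

Lemma measurable_spacetime_box : measurable spacetime_box.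
Proof.
have m (b c : R) : measurable (`[b, c]%classic : set TR) by exact: measurable_itv.
by apply: measurableX => //; exact: measurableX.
Qed.

Lemma spacetime_box_mass :
  (pmeasure (lm1 R) (lm2 R) spacetime_box = (rho * (2 * rho) ^+ 2)%:E)%E.
Proof.
have m (b c : R) : measurable (`[b, c]%classic : set TR) by exact: measurable_itv.
have h : - rho <= rho by have := rho0; lra.
apply: etrans (pmeasureE (lm1 R) (lm2 R) (m 0 rho) (measurableX (m (- rho) rho) (m (- rho) rho))) _.
apply: etrans (f_equal (fun u => (_ * u)%E) (lm2E (m (- rho) rho) (m (- rho) rho))) _.
by rewrite !lm1_itv// -!EFinM; congr EFin; ring.
Qed.

Lemma measurable_response :
  measurable_fun setT (fun q : (TR * TR) * (TR * (TR * TR)) => response q.1 q.2).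
Proof.
apply: mtM; first exact: measurable_potential.
have m2 := @measurable_snd _ _ (TR * TR)%type (TR * (TR * TR))%type.
exact: (measurable_ct3 (wave_op_continuous sth (a := a)) (measurableT_comp measurable_snd m2)
  (measurableT_comp measurable_fst m2)).
Qed.

Let potential0 y z : (forall tau, retarded a rho y z tau = 0) -> potential a rho sg y z = 0.
Proof. by move=> h; rewrite /potential integral0_eq// => tau _; rewrite h mul0r. Qed.

Lemma response_vanish y z : ~ spacetime_box z -> response y z = 0.
Proof.
case: z => t x hz; rewrite /response /=.
have [tn|tp] := ltP t 0.
  rewrite potential0 ?mul0r// => tau; rewrite retarded_le /=.
  case: andP => [[h1 h2]|_]; last by rewrite !mul0r.
  by have := lt_le_trans tn (le_trans h1 h2); rewrite ltxx.
have [|h] := boolP (r < `|x.1| + `|x.2| + `|t|).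
  by move/(wave_op_vanish th0 a) => ->; rewrite mulr0.
case: hz; rewrite -leNgt in h.
have := normr_ge0 x.1; have := normr_ge0 x.2; have := ler_norm t; have := rrho.
rewrite (ger0_norm tp) in h *.
by move=> *; do !split; rewrite /= in_itv /= -?ler_norml ?tp /=; lra.
Qed.

Lemma response_far y z : ~ (`|y.1| <= source_radius /\ `|y.2| <= source_radius) ->
  response y z = 0.
Proof.
move=> far; have [[]|/response_vanish ->//] := pselect (spacetime_box z).
case: z => t x /=; rewrite in_itv /= => /andP[t0 tr] [].
rewrite /= !in_itv /= -!ler_norml => x1 x2.
rewrite /response potential0 ?mul0r// => tau; rewrite retarded_le /=.
case: andP => [[h1 h2]|_]; last by rewrite !mul0r.
rewrite /wave_kernel ler0_sqrtr ?invr0 ?mulr0//.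
have s0 : 0 <= a * (t - tau) by rewrite mulr_ge0 ?subr_ge0 ?(ltW a0).
have sr : a * (t - tau) <= a * rho by rewrite ler_wpM2l ?(ltW a0)//; lra.
have key (u v : R) : `|u| <= rho -> ~ `|v| <= source_radius -> (a * (t - tau)) ^+ 2 <= (u - v) ^+ 2.
  move=> hu /negP; rewrite -ltNge /source_radius => hv.
  rewrite -[leRHS]real_normK ?num_real// ler_sqr ?nnegrE//.
  by have := ler_normB u (u - v); rewrite subKr; lra.
have [y1|y1] := pselect (`|y.1| <= source_radius).
  have [y2|y2] := pselect (`|y.2| <= source_radius); first by case: far.
  by have := key _ _ x2 y2; have := sqr_ge0 (x.1 - y.1); lra.
by have := key _ _ x1 y1; have := sqr_ge0 (x.2 - y.2); lra.
Qed.

Local Notation cut := (inv_sqrt_cut (rho + source_radius)).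

Lemma response_sqr_le : exists2 K : R, 0 <= K & forall y z, z.2.1 != y.1 -> z.2.2 != y.2 ->
  response y z ^+ 2 <= K * (cut (z.2.1 - y.1) * cut (z.2.2 - y.2)).
Proof.
have [M M0 hM] := wave_op_bound a sth th0.
exists ((C * kernel_cst a rho) ^+ 2 * M ^+ 2) => [|y z n1 n2]; first by rewrite mulr_ge0 ?sqr_ge0.
have K0 : 0 <= (C * kernel_cst a rho) ^+ 2 * M ^+ 2 by rewrite mulr_ge0 ?sqr_ge0.
have rhs0 : 0 <= (C * kernel_cst a rho) ^+ 2 * M ^+ 2 * (cut (z.2.1 - y.1) * cut (z.2.2 - y.2)).
  by rewrite mulr_ge0// mulr_ge0 ?inv_sqrt_cut_ge0.
have [[_ []]|/response_vanish ->] := pselect (spacetime_box z); last by rewrite expr0n.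
rewrite /= !in_itv /= -!ler_norml => x1 x2.
have [[y1 y2]|/response_far ->] := pselect (`|y.1| <= source_radius /\ `|y.2| <= source_radius); last by rewrite expr0n.
have c1 : `|z.2.1 - y.1| <= rho + source_radius by rewrite (le_trans (ler_normB _ _))// lerD.
have c2 : `|z.2.2 - y.2| <= rho + source_radius by rewrite (le_trans (ler_normB _ _))// lerD.
rewrite /inv_sqrt_cut c1 c2 !mul1r /response [leLHS]exprMn [leRHS]mulrAC.
apply: ler_pM; rewrite ?sqr_ge0//; first exact: (potential_sqr_le (C := C)).
by rewrite -[leLHS]real_normK ?num_real// ler_sqr ?nnegrE.
Qed.

(** The majorant depends only on x - y and is even in each coordinate, so one constant serves both
    directions: integration over sources gives second moments, integration over space gives L^1
    bounds for a fixed source. *)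
Lemma response_sqr_bounds : exists2 B : R, 0 <= B &
  (forall z, \int[lm2 R]_y (response y z ^+ 2)%:E <= B%:E)%E /\
  (forall y t, \int[lm2 R]_x (response y (t, x) ^+ 2)%:E <= B%:E)%E.
Proof.
have [K K0 hK] := response_sqr_le.
have l0 : 0 < rho + source_radius by rewrite /source_radius !addr_gt0 ?mulr_gt0.
set l := rho + source_radius in l0 hK *.
pose S := singular_mass l; have S0 : 0 <= S by exact: singular_mass_ge0.
have mw (c : TR * TR) : measurable_fun setT (fun x : TR * TR => (cut (x.1 - c.1) * cut (x.2 - c.2))%:E).
  by apply/measurable_EFinP; mt; apply: measurable_inv_sqrt_cut; mt.
have key (f : TR * TR -> R) c : measurable_fun setT f ->
    (forall x, x.1 != c.1 -> x.2 != c.2 -> f x ^+ 2 <= K * (cut (x.1 - c.1) * cut (x.2 - c.2))) ->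
    (\int[lm2 R]_x (f x ^+ 2)%:E <= (K * S ^+ 2)%:E)%E.
  move=> mf fK.
  apply: (@le_trans _ _ (\int[lm2 R]_x (K%:E * (cut (x.1 - c.1) * cut (x.2 - c.2))%:E))%E).
    apply: ae_ge0_le_integral => //.
    - by move=> x _; rewrite lee_fin sqr_ge0.
    - by apply/measurable_EFinP; exact: mtX.
    - by move=> x _; rewrite mule_ge0 ?lee_fin ?mulr_ge0 ?inv_sqrt_cut_ge0.
    - by apply: emeasurable_funM => //; exact: measurable_cst.
    apply: filterS (ae_coordinates_neq c) => x [n1 n2] _.
    by rewrite -EFinM lee_fin fK.
  rewrite ge0_integralZl//; last by move=> x _; rewrite lee_fin mulr_ge0 ?inv_sqrt_cut_ge0.
  by rewrite EFinM lee_wpmul2l ?lee_fin//; exact: integral_singular_weight.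
exists (K * S ^+ 2); first by rewrite mulr_ge0 ?sqr_ge0.
split=> [z|y t].
  apply: (key (fun y => response y z) z.2).
    exact: (measurableT_comp measurable_response (measurable_pair2 z)).
  move=> y n1 n2; rewrite eq_sym in n1; rewrite eq_sym in n2; have := hK y z n1 n2.
  by rewrite -[z.2.1 - _]opprB -[z.2.2 - _]opprB !inv_sqrt_cutN.
apply: (key (fun x => response y (t, x)) y).
  exact: (measurableT_comp measurable_response
    (measurable_fun_pair (@measurable_cst _ _ _ _ _ y) (measurable_pair1 t))).
by move=> x n1 n2; exact: hK.
Qed.

(** From |u| <= 1 + u^2 on a box of finite measure. *)
Lemma response_abs_bound : exists2 B : R, 0 <= B &
  forall y, (\int[pmeasure (lm1 R) (lm2 R)]_(z in spacetime_box) `|response y z|%:E <= B%:E)%E.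
Proof.
have [B B0 [_ hB]] := response_sqr_bounds; have mD := measurable_spacetime_box.
exists (rho * (2 * rho) ^+ 2 + B * rho) => [|y].
  by rewrite addr_ge0// mulr_ge0// sqr_ge0.
have mr : measurable_fun setT (fun z => response y z).
  exact: (measurableT_comp measurable_response (measurable_pair1 y)).
have ms : measurable_fun setT (fun z => (response y z ^+ 2)%:E).
  by apply/measurable_EFinP; exact: mtX.
apply: (@le_trans _ _ (\int[pmeasure (lm1 R) (lm2 R)]_(z in spacetime_box)
    (1%:E + (response y z ^+ 2)%:E))%E).
  apply: ge0_le_integral => //.
  - by apply: measurable_funTS; apply/measurable_EFinP; exact: mt_norm.
  - by apply: emeasurable_funD => //; exact: measurable_funTS.
  - move=> z _; rewrite -EFinD lee_fin -[response y z ^+ 2]real_normK ?num_real//.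
    by have := normr_ge0 (response y z); nra.
rewrite ge0_integralD//; first last.
- exact: measurable_funTS.
- by move=> z _; rewrite lee_fin sqr_ge0.
rewrite integral_cst// mul1e EFinD; apply: leeD.
  by rewrite [leLHS]spacetime_box_mass.
rewrite integral_vanish; last by move=> z /response_vanish ->; rewrite expr0n.
have [E1 _] := tonelli (lm1 R) (lm2 R) ms (fun z => (sqr_ge0 (response y z) : (0 <= _%:E)%E)).
rewrite [leLHS]E1.
have mI : measurable (`[0, rho]%classic : set TR) by exact: measurable_itv.
apply: (@le_trans _ _ (\int[lm1 R]_(t in `[0%R, rho]%classic) B%:E)%E).
  rewrite [leRHS]integral_mkcond; apply: ge0_le_integral => //.
  - by move=> t _; apply: integral_ge0 => x _; rewrite lee_fin sqr_ge0.
  - exact: (@measurable_fun_integral_snd R _ _ TR (TR * TR)%type (lm2 R) setT _ ms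
      (fun z => (sqr_ge0 (response y z) : (0 <= _%:E)%E)) measurableT).
  - by apply/(measurable_restrictT _ mI); exact: measurable_cst.
  move=> t _; rewrite /patch; case: ifPn; rewrite ?inE ?notin_setE => tD; first exact: hB.
  by rewrite integral0_eq// => x _; rewrite response_vanish ?expr0n// => -[].
apply: (eq_ind_r (fun u => (u <= _)%E) _ (integral_cst (lm1 R) mI B%:E)).
by apply: (eq_ind_r (fun u => (_ * u <= _)%E) _ (lm1_itv rho0)); rewrite subr0.
Qed.

Definition forcing (y : R * R) (t : R) : R := (0 <= t)%R%:R * (sg y t * th y t).

Lemma measurable_forcing : measurable_fun setT (fun q : (TR * TR) * TR => forcing q.1 q.2).
Proof.
apply: mtM; first by apply: mt_le; mt.
have cth := smooth_continuous sth (l := [::]).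
apply: mtM.
  exact: (measurable_ct3 csg (@measurable_fst _ _ _ _) (@measurable_snd _ _ _ _)).
exact: (measurable_ct3 cth (@measurable_fst _ _ _ _) (@measurable_snd _ _ _ _)).
Qed.

Lemma forcing_vanish y t : ~ `[0, rho]%classic t -> forcing y t = 0.
Proof.
rewrite /= in_itv /= /forcing => ht.
have [t0|] := leP 0 t; last by rewrite mul0r.
rewrite th0 ?mulr0//; apply: contra_notT ht; rewrite -leNgt t0 /=.
have := normr_ge0 y.1; have := normr_ge0 y.2; have := ler_norm t; have := rrho.
by move=> *; lra.
Qed.

Lemma forcing_far y t : ~ (`|y.1| <= source_radius /\ `|y.2| <= source_radius) ->
  forcing y t = 0.
Proof.
move=> far; rewrite /forcing th0 ?mulr0//; apply: contra_notT far; rewrite -leNgt => h.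
have q0 : 0 <= a * rho by rewrite mulr_ge0 ?(ltW a0).
have := normr_ge0 y.1; have := normr_ge0 y.2; have := normr_ge0 t; have := rrho.
by rewrite /source_radius => *; split; lra.
Qed.

Lemma forcing_bounded : exists2 M : R, 0 <= M & forall y t, `|forcing y t| <= M.
Proof.
have [M M0 hM] := vanish_bound (smooth_continuous sth (l := [::])) th0.
have C0 : 0 <= C := le_trans (normr_ge0 _) (sgC (0, 0) 0).
exists (C * M) => [|y t]; first by rewrite mulr_ge0.
rewrite /forcing normrM; case: (0 <= t)%R; last by rewrite normr0 mul0r mulr_ge0.
by rewrite normr1 mul1r normrM ler_pM.
Qed.

Lemma forcing_bounds : exists2 B : R, 0 <= B &
  (forall t, \int[lm2 R]_y (forcing y t ^+ 2)%:E <= B%:E)%E /\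
  (forall y, \int[lm1 R]_(t in `[0%R, rho]%classic) `|forcing y t|%:E <= B%:E)%E.
Proof.
have [M M0 hM] := forcing_bounded.
have rad0 : 0 <= source_radius by rewrite /source_radius addr_ge0// mulr_ge0 ?(ltW a0).
set rad := source_radius in rad0.
have mJ (b c : R) : measurable (`[b, c]%classic : set TR) by exact: measurable_itv.
have mb := measurableX (mJ (- rad) rad) (mJ (- rad) rad).
have hr : - rad <= rad by lra.
exists (M ^+ 2 * (2 * rad) ^+ 2 + M * rho).
  by rewrite addr_ge0 ?mulr_ge0 ?sqr_ge0.
split=> [t|y].
  have mf : measurable_fun setT (fun y : TR * TR => (forcing y t ^+ 2)%:E).
    apply/measurable_EFinP; apply: mtX.
    exact: (measurableT_comp measurable_forcing (measurable_pair2 t)).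
  rewrite -(@integral_vanish _ _ _ (lm2 R) (`[- rad, rad]%classic `*` `[- rad, rad]%classic)); last first.
    move=> y yb; rewrite forcing_far ?expr0n// => -[h1 h2]; apply: yb.
    by split; rewrite /= in_itv /= -ler_norml.
  apply: (@le_trans _ _ (\int[lm2 R]_(y in `[(- rad)%R, rad]%classic `*` `[(- rad)%R, rad]%classic) (M ^+ 2)%:E)%E).
    apply: ge0_le_integral => //.
    - by move=> y _; rewrite lee_fin sqr_ge0.
    - exact: measurable_funTS.
    - by move=> y _; rewrite lee_fin -[leLHS]real_normK ?num_real// ler_sqr ?nnegrE.
  apply: (eq_ind_r (fun u => (u <= _)%E) _ (integral_cst (lm2 R) mb (M ^+ 2)%:E)).
  apply: (eq_ind_r (fun u => (_ * u <= _)%E) _ (lm2E (mJ (- rad) rad) (mJ (- rad) rad))).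
  rewrite !lm1_itv//.
  suff : M ^+ 2 * ((rad - - rad) * (rad - - rad)) <= M ^+ 2 * (2 * rad) ^+ 2 + M * rho by [].
  have := mulr_ge0 M0 rho0; rewrite (_ : (rad - - rad) * (rad - - rad) = (2 * rad) ^+ 2); last by ring.
  by rewrite lerDl.
have mf : measurable_fun setT (fun t => forcing y t).
  exact: (measurableT_comp measurable_forcing (measurable_pair1 y)).
apply: (@le_trans _ _ (\int[lm1 R]_(t in `[0%R, rho]%classic) M%:E)%E).
  apply: ge0_le_integral => //.
  - by apply: measurable_funTS; apply/measurable_EFinP; exact: mt_norm.
  - by move=> t _; rewrite lee_fin.
apply: (eq_ind_r (fun u => (u <= _)%E) _ (integral_cst (lm1 R) (mJ 0 rho) M%:E)).
apply: (eq_ind_r (fun u => (_ * u <= _)%E) _ (lm1_itv rho0)).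
suff : M * (rho - 0) <= M ^+ 2 * (2 * rad) ^+ 2 + M * rho by [].
by rewrite subr0 lerDr mulr_ge0 ?sqr_ge0.
Qed.

Section superposition.
Variables (K : R) (c : nat -> R) (x : nat -> R * R).
Hypothesis tame_response : tame (pmeasure (lm1 R) (lm2 R)) spacetime_box
  (fun k z => c k * response (x k) z).
Hypothesis tame_forcing : tame (lm1 R) `[0, rho]%classic (fun k t => c k * forcing (x k) t).
Local Notation U := (fun z => series_val (fun k => c k * response (x k) z)).
Local Notation V := (fun t => series_val (fun k => c k * forcing (x k) t)).

Let mresp y : measurable_fun setT (fun z => response y z).
Proof. exact: (measurableT_comp measurable_response (measurable_pair1 y)). Qed.

Let mforc y : measurable_fun setT (fun t => forcing y t).
Proof. exact: (measurableT_comp measurable_forcing (measurable_pair1 y)). Qed.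

(** The identity for one source, moved from the whole space-time and the half-line to the bounded
    sets on which the series are controlled. *)
Let integral_response_forcing y :
  (pmeasure (lm1 R) (lm2 R)).-integrable spacetime_box (fun z => (response y z)%:E) /\
  (lm1 R).-integrable `[0, rho]%classic (fun t => (forcing y t)%:E) /\
  (\int[pmeasure (lm1 R) (lm2 R)]_(z in spacetime_box) (response y z)%:E =
   \int[lm1 R]_(t in `[0%R, rho]%classic) (forcing y t)%:E)%E.
Proof.
have [B1 _ hB1] := response_abs_bound; have [B2 _ [_ hB2]] := forcing_bounds.
split; [|split].
- apply/integrableP; split; first by apply: measurable_funTS; apply/measurable_EFinP; exact: mresp.
  exact: le_lt_trans (hB1 y) (ltry _).
- apply/integrableP; split; first by apply: measurable_funTS; apply/measurable_EFinP; exact: mforc.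
  exact: le_lt_trans (hB2 y) (ltry _).
rewrite integral_vanish; last by move=> z /response_vanish ->.
rewrite [RHS]integral_vanish; last by move=> t /forcing_vanish ->.
apply: etrans (integral_potential_wave_op a0 rho0 csg sgC sth th0 rrho y) _.
rewrite -[RHS](@integral_vanish _ _ _ (lm1 R) (`[0%R, +oo[%classic : set TR)); last first.
  by move=> t; rewrite /= in_itv /= andbT /forcing => /negP/negbTE ->; rewrite mul0r.
by apply: eq_integral => t; rewrite inE /= in_itv /= andbT /forcing => ->; rewrite mul1r.
Qed.

Lemma superposition_identity :
  (\int[lm1 R]_(t in (`[0%R, +oo[%classic : set R)) \int[lm2 R]_x (K * U (t, x))%:E =
   \int[lm1 R]_(t in (`[0%R, +oo[%classic : set R)) (K * V t)%:E)%E.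
Proof.
have mD := measurable_spacetime_box.
have mI (u v : R) : measurable (`[u, v]%classic : set TR) by exact: measurable_itv.
have [iU cU] := tame_integral mD (fun k => mtM (mt_cst (c k)) (mresp (x k))) tame_response.
have [iV cV] := tame_integral (mI 0 rho) (fun k => mtM (mt_cst (c k)) (mforc (x k))) tame_forcing.
(* Both sides are limits of finite sums of integrals, and the sums agree term by term. *)
have UV : (\int[pmeasure (lm1 R) (lm2 R)]_(z in spacetime_box) (U z)%:E =
           \int[lm1 R]_(t in `[0%R, rho]%classic) (V t)%:E)%E.
  apply: (cvg_unique _ cU); first exact: ereal_hausdorff.
  move: cV; apply: cvg_trans; rewrite (_ : (fun N => _) = (fun N : nat =>
    \sum_(k < N) \int[lm1 R]_(t in `[0%R, rho]%classic) (c k * forcing (x k) t)%:E)%E)//.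
  apply/funext => N; apply: eq_bigr => k _.
  have [i1 [i2 e]] := integral_response_forcing (x k).
  under eq_integral do rewrite EFinM.
  rewrite integralZl// e -integralZl//.
have iKU : (pmeasure (lm1 R) (lm2 R)).-integrable spacetime_box (fun z => (K * U z)%:E).
  by under [X in integrable _ _ X]funext do rewrite EFinM; exact: integrableZl.
have U0 z : ~ spacetime_box z -> U z = 0.
  move=> hz; rewrite (_ : (fun k => _) = fun=> 0) ?series_val0//.
  by apply/funext => k; rewrite response_vanish ?mulr0.
have V0 t : ~ `[0, rho]%classic t -> V t = 0.
  move=> ht; rewrite (_ : (fun k => _) = fun=> 0) ?series_val0//.
  by apply/funext => k; rewrite forcing_vanish ?mulr0.
have half_line (f : TR -> \bar R) : (forall t, ~ `[0, rho]%classic t -> f t = 0%E) ->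
    (\int[lm1 R]_(t in (`[0%R, +oo[%classic : set R)) f t = \int[lm1 R]_(t in `[0%R, rho]%classic) f t)%E.
  move=> f0; rewrite [LHS]integral_vanish; first by rewrite [RHS]integral_vanish.
  move=> t ht; apply: f0 => h; apply: ht; move: h; rewrite /= !in_itv /= andbT.
  by case/andP.
rewrite [LHS]half_line; last first.
  move=> t ht; rewrite integral0_eq// => z _; rewrite U0 ?mulr0// => -[/=].
  by move=> h; case: ht.
rewrite [RHS]half_line; last by move=> t /V0 ->; rewrite mulr0.
have [E1 _] := fubini_on iKU (mI 0 rho) (measurableX (mI (- rho) rho) (mI (- rho) rho)).
transitivity (\int[pmeasure (lm1 R) (lm2 R)]_(z in spacetime_box) (K * U z)%:E)%E.
  apply: etrans (esym E1); apply: eq_integral => t _; apply/esym; apply: integral_vanish.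
  by move=> z hz; rewrite U0 ?mulr0// => -[].
under eq_integral do rewrite EFinM.
under [RHS]eq_integral do rewrite EFinM.
by rewrite integralZl// UV integralZl.
Qed.

End superposition.

End source_response.

(** * Assembly of the identity *)

Lemma continuous_positive_time (R : realType) (sigma : R * R -> R -> R) :
  {within [set p : (R * R) * R | 0 <= p.2],
     continuous (fun p : (R * R) * R => sigma p.1 p.2)} ->
  continuous (fun q : (R * R) * R => sigma q.1 (Num.max q.2 0)).
Proof.
move/subspace_continuousP => cs q.
pose h (q : (R * R) * R) := (q.1, Num.max q.2 0).
have hq p : 0 <= (h p).2 by rewrite /h /= le_max lexx orbT.
have ch : continuous h.
  move=> p; apply: (cvg_pair (G := nbhs p.1) (H := nbhs (Num.max p.2 0))).
    exact: (@cvg_fst _ _ (nbhs p.1) (nbhs p.2)).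
  have := @continuous_max R _ (snd : (R * R) * R -> R^o) (cst 0) p
    (@cvg_snd _ _ (nbhs p.1) (nbhs p.2) _) (@cvg_cst _ _ _ _ _).
  exact.
apply: cvg_trans (cs (h q) (hq q)) => V /= hV.
have hq' := ch q _ hV.
by apply: (@filterS _ (nbhs q) _ _ _ _ hq') => p; apply; exact: hq.
Qed.

Section identity.
Variables (R : realType) (Om : Type) (alpha a C : R) (phi : R * R -> R)
  (sigma : R * R -> R -> R) (Gam : nat -> Om -> R) (xi : nat -> Om -> R * R)
  (g : nat -> Om -> R) (theta : R * R -> R -> R) (r : R) (w : Om).
Hypothesis a0 : 0 < a.
Hypothesis sigmaC : forall x t, 0 <= t -> `|sigma x t| <= C.
Hypothesis csigma : {within [set p : (R * R) * R | 0 <= p.2],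
  continuous (fun p : (R * R) * R => sigma p.1 p.2)}.
Hypothesis stheta : smooth theta.
Hypothesis theta0 : forall x t, r < `|x.1| + `|x.2| + `|t| -> theta x t = 0.
Local Notation TR := (measurableTypeR R).

(** Freezing sigma at time 0 for negative times keeps it continuous and bounded on the whole time
    line. *)
Definition extension (y : R * R) (t : R) : R := sigma y (Num.max t 0).
Local Notation rho := (`|r| + 1).

Lemma extension_le x t : `|extension x t| <= C.
Proof. by apply: sigmaC; rewrite le_max lexx orbT. Qed.

Lemma horizon_gt0 : 0 < rho. Proof. by rewrite ltr_wpDl. Qed.

Lemma support_lt_horizon : r < rho.
Proof. by rewrite ltr_pwDr// ler_norm. Qed.

Lemma tame_identity_star :
  tame (pmeasure (lm1 R) (lm2 R)) (spacetime_box rho) (fun k z =>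
    Gam k w `^ (- alpha^-1) * phi (xi k w) `^ (- alpha^-1) *
      response a rho extension theta (xi k w) z * g k w) ->
  tame (lm1 R) `[0, rho]%classic (fun k t =>
    Gam k w `^ (- alpha^-1) * phi (xi k w) `^ (- alpha^-1) *
      forcing extension theta (xi k w) t * g k w) ->
  identity_star alpha a phi Gam xi g sigma theta w.
Proof.
pose c k := Gam k w `^ (- alpha^-1) * phi (xi k w) `^ (- alpha^-1) * g k w.
have cE k (u : R) : Gam k w `^ (- alpha^-1) * phi (xi k w) `^ (- alpha^-1) * u * g k w = c k * u.
  by rewrite mulrAC.
move=> tame1 tame2; have cext := continuous_positive_time csigma.
have h1 : tame (pmeasure (lm1 R) (lm2 R)) (spacetime_box rho)
    (fun k z => c k * response a rho extension theta (xi k w) z).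
  by move: tame1; congr tame; apply/funext => k; apply/funext => z; rewrite cE.
have h2 : tame (lm1 R) `[0, rho]%classic (fun k t => c k * forcing extension theta (xi k w) t).
  by move: tame2; congr tame; apply/funext => k; apply/funext => z; rewrite cE.
have e := superposition_identity a0 horizon_gt0 cext extension_le stheta theta0
  support_lt_horizon (C_alpha alpha) h1 h2.
rewrite /identity_star; apply: etrans (etrans _ e) _.
- apply: eq_integral => t _; apply: eq_integral => x _; congr EFin.
  rewrite /Usol /lepage -mulrA; congr (_ * _).
  rewrite mulrC -series_valZ; congr series_val; apply/funext => k.
  rewrite cE /response /=; have [tr|tr] := leP t rho.
    by rewrite (Gfun_potential _ _ a0 cext tr); ring.
  (* Beyond the horizon the potential no longer represents [Gfun], but there the wave operator of
     theta vanishes. *)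
  rewrite (wave_op_vanish theta0) ?mulr0 ?mul0r//.
  have := ler_norm t; have := normr_ge0 x.1; have := normr_ge0 x.2; have := support_lt_horizon.
  by move=> *; lra.
- apply: eq_integral => t; rewrite inE /= in_itv /= andbT => t0; congr EFin.
  rewrite /lepage; congr (_ * series_val _); apply/funext => k.
  by rewrite cE /forcing /extension t0 mul1r max_l// [theta _ _ * _]mulrC.
Qed.

End identity.

Theorem theorem3 (R : realType) (d : measure_display) (Om : measurableType d)
  (P : probability Om R) (alpha a C : R)
  (phi : R * R -> R) (sigma : R * R -> R -> R)
  (E : nat -> Om -> R) (Gam : nat -> Om -> R)
  (xi : nat -> Om -> R * R) (g : nat -> Om -> R) :
  complete_prob P ->
  0 < a -> 0 < alpha -> alpha < 2 ->
  (* sigma bounded and continuous on R^2 x R_+ *)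
  (forall x t, 0 <= t -> `|sigma x t| <= C) ->
  {within [set p : (R * R) * R | 0 <= p.2],
     continuous (fun p : (R * R) * R => sigma p.1 p.2)} ->
  (* phi: continuous positive probability density on R^2 *)
  continuous phi -> (forall y, 0 < phi y) ->
  (* Gam k = Gamma_{k+1} = E_1 + ... + E_{k+1}, E_i i.i.d. Exp(1):
     arrival times of a unit-intensity Poisson process *)
  (forall k, measurable_fun setT (E k)) ->
  (forall k (B : set R), measurable B -> P (E k @^-1` B) = exponential_prob 1 B) ->
  (forall k w, Gam k w = \sum_(i < k.+1) E i w) ->
  (* xi k i.i.d. with density phi *)
  (forall k, measurable_fun setT (xi k)) ->
  (forall k (B : set (R * R)), measurable B ->
     P (xi k @^-1` B) = (\int[@leb2 R]_(y in B) (phi y)%:E)%E) ->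
  (* g k i.i.d. centered Gaussian with E|g_k|^alpha = 1 *)
  (forall k, measurable_fun setT (g k)) ->
  (exists2 s : R, 0 < s & forall k (B : set R), measurable B ->
     P (g k @^-1` B) = normal_prob 0 s B) ->
  (forall k, (\int[P]_(w in setT) (`|g k w| `^ alpha)%:E)%E = 1%E) ->
  (* the three families are (jointly) independent *)
  mutual_indep P (fun i : (nat + nat) + nat =>
    match i with
    | inl (inl k) => events_of (E k)
    | inl (inr k) => events_of (xi k)
    | inr k => events_of (g k)
    end) ->
  (alpha < 1 ->
     exists Om0 : set Om, [/\ measurable Om0, P Om0 = 1%E &
       forall w, Om0 w -> forall theta, test_fun theta ->
         identity_star alpha a phi Gam xi g sigma theta w])
  /\
  (1 <= alpha ->
     forall theta, test_fun theta ->
       {ae P, forall w, identity_star alpha a phi Gam xi g sigma theta w}).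
Proof.
move=> _ a0 al0 al2 sigmaC csigma cphi phi0 mE lawE GamE mxi lawxi mg [s s0 lawg] _ indep.
have cext := continuous_positive_time csigma; have extC := extension_le sigmaC.
have muD (r : R) : (pmeasure (lm1 R) (lm2 R) (spacetime_box (`|r| + 1)) < +oo)%E.
  by rewrite spacetime_box_mass ?horizon_gt0// ltry.
have mI (u v : R) : measurable (`[u, v]%classic : set (measurableTypeR R)) by exact: measurable_itv.
split=> [al1|al1 theta [stheta [r theta0]]].
  (* [N] is a measurable null set fixed before any test function is introduced; its complement is
     the required event. *)
  have [N [mN N0 sub]] := ae_weights_summable al0 mE lawE GamE mxi mg s0 lawg indep al1.
  exists (~` N); split; first exact: measurableC.
    by rewrite probability_setC// N0 sube0.
  move=> w Nw theta [stheta [r theta0]].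
  have hw : (\sum_(0 <= k <oo) (Gam k w `^ (- alpha^-1) * `|g k w|)%:E < +oo)%E.
    by apply: contrapT => h; apply: Nw; exact: sub.
  have rho0 := horizon_gt0 r; have rrho := support_lt_horizon r.
  have [B1 B10 hB1] := response_abs_bound a0 rho0 cext extC stheta theta0 rrho.
  have [B2 B20 [_ hB2]] := forcing_bounds a0 rho0 cext extC stheta theta0 rrho.
  apply: (tame_identity_star a0 sigmaC csigma stheta theta0).
    exact: (tame_lepage_absolute xi al0 cphi phi0 (measurable_spacetime_box _) B10
      (measurable_response _ _ cext stheta)
      (fun y z => @response_far _ a _ (extension sigma) _ _ a0 theta0 rrho y z) hB1 hw).
  exact: (tame_lepage_absolute xi al0 cphi phi0 (mI _ _) B20
    (measurable_forcing cext stheta)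
    (fun y t => @forcing_far _ a _ (extension sigma) _ _ a0 rho0 theta0 rrho y t) hB2 hw).
have rho0 := horizon_gt0 r; have rrho := support_lt_horizon r.
have p1 : alpha^-1 <= 1 by rewrite invf_le1.
have [B1 B10 [hB1 _]] := response_sqr_bounds a0 rho0 cext extC stheta theta0 rrho.
have [B2 B20 [hB2 _]] := forcing_bounds a0 rho0 cext extC stheta theta0 rrho.
(* Here the square bound used is the one integrated over the source position, uniform in the
   space-time point. *)
have t1 := ae_tame_lepage al0 al2 cphi phi0 mE lawE GamE mxi lawxi mg s0 lawg indep
  (measurable_spacetime_box _) (muD r) B10 (measurable_response _ _ cext stheta)
  (fun y z => @response_vanish _ a _ (extension sigma) _ _ theta0 rrho y z)
  (fun y z => @response_far _ a _ (extension sigma) _ _ a0 theta0 rrho y z) hB1 p1.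
have muI : (lm1 R `[0%R, (`|r| + 1)%R]%classic < +oo)%E by rewrite lm1_itv ?(ltW rho0)// ltry.
have t2 := ae_tame_lepage al0 al2 cphi phi0 mE lawE GamE mxi lawxi mg s0 lawg indep
  (mI _ _) muI B20 (measurable_forcing cext stheta)
  (fun y t => @forcing_vanish _ _ (extension sigma) _ _ theta0 rrho y t)
  (fun y t => @forcing_far _ a _ (extension sigma) _ _ a0 rho0 theta0 rrho y t) hB2 p1.
by apply: filterS2 t1 t2 => w; exact: (tame_identity_star a0 sigmaC csigma stheta theta0).
Qed.
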